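(* Let $0<\sigma<1$ and let $f\in\operatorname{Dom}(L^\sigma)$. A solution $u$ of the extension problem $$u(x,0)=f(x)\ \text{ on }\Omega,\qquad -L_xu+\frac{1-2\sigma}{y}\,u_y+u_{yy}=0\ \text{ in }\Omega\times(0,\infty),$$ is given by $$u(x,y)=\frac{1}{\Gamma(\sigma)}\int_0^\infty e^{-tL}(L^\sigma f)(x)\,e^{-\frac{y^2}{4t}}\,\frac{dt}{t^{1-\sigma}},$$ and $$\lim_{y\to0^+}\frac{u(x,y)-u(x,0)}{y^{2\sigma}}=\frac{\Gamma(-\sigma)}{4^\sigma\Gamma(\sigma)}L^\sigma f(x)=\frac{1}{2\sigma}\lim_{y\to0^+}y^{1-2\sigma}u_y(x,y).$$ Moreover, the following Poisson formula for $u$ holds: $$u(x,y)=\frac{y^{2\sigma}}{4^\sigma\Gamma(\sigma)}\int_0^\infty e^{-tL}f(x)\,e^{-\frac{y^2}{4t}}\,\frac{dt}{t^{1+\sigma}}=\frac{1}{\Gamma(\sigma)}\int_0^\infty e^{-\frac{y^2}{4r}L}f(x)\,e^{-r}\,\frac{dr}{r^{1-\sigma}}.$$ All identities are understood in $L^2(\Omega,d\eta)$.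
   Context: Setting: $\Omega\subset\mathbb{R}^n$ ($n\ge1$) is open, $d\eta$ is a positive measure on $\Omega$, and $L$ is a linear second order partial differential operator which is nonnegative, densely defined and self-adjoint in $L^2(\Omega)=L^2(\Omega,d\eta)$. $L_x$ means that $L$ acts in the variable $x$. Let $E$ be the unique resolution of the identity of $L$, supported on the spectrum of $L$ (a subset of $[0,\infty)$), so that $L=\int_0^\infty\lambda\,dE(\lambda)$. For a real measurable function $\phi$ on $[0,\infty)$, $\phi(L)=\int_0^\infty\phi(\lambda)\,dE(\lambda)$ is the operator with domain $\{f\in L^2(\Omega):\int_0^\infty|\phi(\lambda)|^2dE_{f,f}(\lambda)<\infty\}$ defined by $\langle\phi(L)f,g\rangle_{L^2(\Omega)}=\int_0^\infty\phi(\lambda)\,dE_{f,g}(\lambda)$ for $g\in L^2(\Omega)$. In this way $e^{-tL}$ ($t\ge0$) and $L^\sigma$ ($0<\sigma<1$) are defined. $\Gamma$ is the Gamma function and $\Gamma(-\sigma):=\Gamma(1-\sigma)/(-\sigma)<0$. Integrals of $L^2(\Omega)$-valued functions, and limits and derivatives in $y$, are understood through pairings with arbitrary $g\in L^2(\Omega)$; e.g. the first formula for $u$ means $\langle u(\cdot,y),g\rangle_{L^2(\Omega)}=\frac1{\Gamma(\sigma)}\int_0^\infty\langle e^{-tL}L^\sigma f,g\rangle_{L^2(\Omega)}e^{-y^2/(4t)}\frac{dt}{t^{1-\sigma}}$.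
   Formalization: The first formula for u (with e^{-tL}L^σ f) is claimed only when f is orthogonal to the kernel of L, since it fails otherwise (for f in ker L it gives u=0); the extension problem, both limits and both Poisson formulas are proved for every f in Dom(L^σ). *)

(* Defs.v *)
From HB Require Import structures.
From mathcomp Require Import all_boot all_order all_algebra.
From mathcomp Require Import all_classical all_reals all_analysis.
From mathcomp Require Import complex.

Set Implicit Arguments.
Unset Strict Implicit.
Unset Printing Implicit Defensive.

Import Order.TTheory GRing.Theory Num.Theory.
Import numFieldNormedType.Exports.

Local Open Scope classical_set_scope.
Local Open Scope ring_scope.
Local Open Scope complex_scope.

(* R^n with its Borel sigma-algebra (convertible to 'rV[R]_n). *)
Definition borelRn (R : realType) (n : nat) :=
  g_sigma_algebraType (@open ('rV[R]_n)).

Section Gamma.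
Context {R : realType}.

Definition Gamma (s : R) : R :=
  \int[@lebesgue_measure R]_(t in `]0, +oo[) (t `^ (s - 1) * expR (- t)).

(* The value Gamma(-s), for 0 < s < 1. *)
Definition Gamma_opp (s : R) : R := Gamma (1 - s) / - s.

End Gamma.

(* Integrals of a real function with respect to a signed, resp. complex,
   measure, given as a plain set function: through the upper and lower
   variations (Jordan decomposition), resp. the real and imaginary parts. *)
Section signed_measure.
Context {d : measure_display} {S : measurableType d} {R : realType}.

Definition upper_variation (nu : set S -> R) (A : set S) : \bar R :=
  ereal_sup [set (nu B)%:E | B in [set B | measurable B /\ B `<=` A]].

Definition lower_variation (nu : set S -> R) : set S -> \bar R :=
  upper_variation (fun A => - nu A).

Definition signed_integral (nu : set S -> R) (D : set S) (phi : S -> R) : R :=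
  fine (\int[upper_variation nu]_(x in D) (phi x)%:E)%E -
  fine (\int[lower_variation nu]_(x in D) (phi x)%:E)%E.

Definition complex_integral (nu : set S -> R[i]) (D : set S) (phi : S -> R)
    : R[i] :=
  signed_integral (fun A => complex.Re (nu A)) D phi +i*
  signed_integral (fun A => complex.Im (nu A)) D phi.

End signed_measure.

(* An everywhere defined function together with the domain on which it is
   meaningful. *)
Record unbounded_operator (X : Type) := UnboundedOperator {
  opdom : set X ;
  opfun :> X -> X }.

(* Complex L^2(Omega, eta).  Its elements are represented by functions, and
   equality in L^2 is equality eta-a.e. on Omega.  A measure on Omega is
   a measure on the whole space, used only through Omega. *)
Section L2.
Context {d : measure_display} {T : measurableType d} {R : realType}.
Variables (eta : {measure set T -> \bar R}) (Omega : set T).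
Implicit Types (f g h : T -> R[i]).

Definition L2norm2 f : \bar R :=
  (\int[eta]_(x in Omega)
     ((complex.Re (f x)) ^+ 2 + (complex.Im (f x)) ^+ 2)%:E)%E.

Definition L2 : set (T -> R[i]) := [set f |
  [/\ measurable_fun Omega (fun x => complex.Re (f x)),
      measurable_fun Omega (fun x => complex.Im (f x)) &
      (L2norm2 f < +oo)%E]].

Definition inner f g : R[i] :=
  (\int[eta]_(x in Omega) complex.Re (f x * (g x)^*)) +i*
  (\int[eta]_(x in Omega) complex.Im (f x * (g x)^*)).

Definition is_operator (L : unbounded_operator (T -> R[i])) : Prop :=
  [/\ opdom L (fun=> 0) /\
        (forall f, opdom L f -> L2 f /\ L2 (L f)),
      forall f g, opdom L f -> L2 g -> f = g %[ae eta in Omega] ->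
        opdom L g /\ L f = L g %[ae eta in Omega] &
      forall (a : R[i]) f g, opdom L f -> opdom L g ->
        opdom L (fun x => a * f x + g x) /\
        L (fun x => a * f x + g x) = (fun x => a * L f x + L g x)
          %[ae eta in Omega]].

Definition densely_defined (L : unbounded_operator (T -> R[i])) : Prop :=
  forall f (e : R), L2 f -> 0 < e ->
    exists2 g, opdom L g & (L2norm2 (fun x => (f x - g x)%R) < e%:E)%E.

(* (g, h) belongs to the graph of the adjoint of L. *)
Definition adjoint_graph (L : unbounded_operator (T -> R[i])) g h : Prop :=
  [/\ L2 g, L2 h & forall f, opdom L f -> inner (L f) g = inner f h].

Definition self_adjoint (L : unbounded_operator (T -> R[i])) : Prop :=
  forall g h, adjoint_graph L g h <->
    [/\ opdom L g, L2 h & L g = h %[ae eta in Omega]].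

Definition nonnegative_operator (L : unbounded_operator (T -> R[i])) : Prop :=
  forall f, opdom L f -> 0 <= inner (L f) f.

Definition in_resolvent_set (L : unbounded_operator (T -> R[i])) (z : R[i])
    : Prop :=
  exists (B : (T -> R[i]) -> (T -> R[i])) (M : R),
    (forall g, L2 g ->
       [/\ opdom L (B g),
           (fun x => L (B g) x - z * B g x) = g %[ae eta in Omega] &
           (L2norm2 (B g) <= M%:E * L2norm2 g)%E]) /\
    (forall f, opdom L f ->
       B (fun x => L f x - z * f x) = f %[ae eta in Omega]).

Definition spectrum (L : unbounded_operator (T -> R[i])) : set R[i] :=
  [set z | ~ in_resolvent_set L z].

Definition orthogonal_projection (P : (T -> R[i]) -> (T -> R[i])) : Prop :=
  [/\ is_operator (UnboundedOperator L2 P),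
      forall f, L2 f -> P (P f) = P f %[ae eta in Omega] &
      forall f g, L2 f -> L2 g -> inner (P f) g = inner f (P g)].

(* Projection-valued measures on the Borel sets of R. *)
Definition resolution_of_identity (E : set R -> (T -> R[i]) -> (T -> R[i]))
    : Prop :=
  [/\ forall A : set R, measurable A -> orthogonal_projection (E A),
      forall f, L2 f -> E set0 f = (fun=> 0) %[ae eta in Omega],
      forall f, L2 f -> E setT f = f %[ae eta in Omega],
      forall (A B : set R) f, measurable A -> measurable B -> L2 f ->
        E (A `&` B) f = E A (E B f) %[ae eta in Omega] &
      forall (A : nat -> set R) f g, (forall k, measurable (A k)) ->
        trivIset setT A -> L2 f -> L2 g ->
        series (fun k => complex.Re (inner (E (A k) f) g)) @ \oo -->
          complex.Re (inner (E (\bigcup_k A k) f) g) /\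
        series (fun k => complex.Im (inner (E (A k) f) g)) @ \oo -->
          complex.Im (inner (E (\bigcup_k A k) f) g)].

Section functional_calculus.
Variable E : set R -> (T -> R[i]) -> (T -> R[i]).

(* E_{f,g} *)
Definition spectral_measure f g (A : set R) : R[i] := inner (E A f) g.

Definition calculus_dom (phi : R -> R) : set (T -> R[i]) := [set f |
  L2 f /\
  (\int[fun A => (complex.Re (spectral_measure f f A))%:E]_(l in `[0%R, +oo[)
     (`|phi l| ^+ 2)%:E < +oo)%E].

(* h = phi(L) f *)
Definition calculus_graph (phi : R -> R) f h : Prop :=
  [/\ calculus_dom phi f, L2 h &
      forall g, L2 g ->
        inner h g =
          complex_integral (spectral_measure f g) `[0, +oo[%classic phi].

Definition calculus (phi : R -> R) f : T -> R[i] :=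
  xget (fun=> 0) [set h | calculus_graph phi f h].

(* e^{-tL} *)
Definition heat (t : R) := calculus (fun l => expR (- (t * l))).

(* L^s *)
Definition fracpow (s : R) := calculus (fun l => l `^ s).

End functional_calculus.

(* E is concentrated on the spectrum of L, which lies in [0, +oo[, and
   L = \int_0^oo l dE(l), with equality of domains. *)
Definition spectral_resolution (L : unbounded_operator (T -> R[i]))
    (E : set R -> (T -> R[i]) -> (T -> R[i])) : Prop :=
  [/\ resolution_of_identity E,
      forall f, L2 f -> E `[0, +oo[%classic f = f %[ae eta in Omega],
      forall (A : set R) f, measurable A ->
        (forall l, A l -> ~ spectrum L l%:C) -> L2 f ->
        E A f = (fun=> 0) %[ae eta in Omega] &
      forall f h, calculus_graph E id f h <->
        [/\ opdom L f, L2 h & L f = h %[ae eta in Omega]]].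

(* On the kernel of L one has L^sigma f = 0, so that the integral of
   e^{-tL} L^sigma f only recovers the part of f orthogonal to the kernel. *)
Definition orthogonal_to_kernel (L : unbounded_operator (T -> R[i])) f
    : Prop :=
  forall h, opdom L h -> L h = (fun=> 0) %[ae eta in Omega] -> inner f h = 0.

(* h = c \int_0^oo F(t) k(t) dt, tested against arbitrary g in L^2; the scalar
   integrals are required to converge absolutely. *)
Definition weak_integral (c : R) (k : R -> R) (F : R -> T -> R[i]) h : Prop :=
  L2 h /\ forall g, L2 g ->
  let D : set R := `]0, +oo[%classic in
  let re := fun t => complex.Re (inner (F t) g) * k t in
  let im := fun t => complex.Im (inner (F t) g) * k t in
  [/\ (@lebesgue_measure R).-integrable D (EFin \o re),
      (@lebesgue_measure R).-integrable D (EFin \o im) &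
      inner h g = c%:C * ((\int[@lebesgue_measure R]_(t in D) re t) +i*
                          (\int[@lebesgue_measure R]_(t in D) im t))].

(* lim_{y -> 0+} v(y) = h *)
Definition weak_limit0 (v : R -> T -> R[i]) h : Prop :=
  L2 h /\ forall g, L2 g ->
    complex.Re (inner (v y) g) @[y --> 0^'+] --> complex.Re (inner h g) /\
    complex.Im (inner (v y) g) @[y --> 0^'+] --> complex.Im (inner h g).

(* h = v'(y) *)
Definition weak_derivative (v : R -> T -> R[i]) (y : R) h : Prop :=
  L2 h /\ forall g, L2 g ->
    is_derive y 1 (fun z => complex.Re (inner (v z) g))
                  (complex.Re (inner h g)) /\
    is_derive y 1 (fun z => complex.Im (inner (v z) g))
                  (complex.Im (inner h g)).

(* u solves the extension problem with boundary value f, and uy, uyy are its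
   derivatives in y; the boundary value is also attained as a limit. *)
Definition extension_solution (L : unbounded_operator (T -> R[i])) (sigma : R)
    f (u uy uyy : R -> T -> R[i]) : Prop :=
  [/\ u 0 = f %[ae eta in Omega], weak_limit0 u f &
      forall y, 0 < y ->
        [/\ opdom L (u y), weak_derivative u y (uy y),
            weak_derivative uy y (uyy y) &
            (fun x => - L (u y) x + ((1 - 2 * sigma) / y)%:C * uy y x
                      + uyy y x) = (fun=> 0) %[ae eta in Omega]]].

End L2.

Section differential_operator.
Context {R : realType} {n : nat}.

Definition partial (i : 'I_n) (h : 'rV[R]_n -> R) : 'rV[R]_n -> R :=
  fun x => 'D_(delta_mx 0 i) h x.

Definition cpartial (i : 'I_n) (f : 'rV[R]_n -> R[i]) : 'rV[R]_n -> R[i] :=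
  fun x => partial i (fun z => complex.Re (f z)) x +i*
           partial i (fun z => complex.Im (f z)) x.

Definition C2_on (Omega : set 'rV[R]_n) (h : 'rV[R]_n -> R) : Prop :=
  forall x, Omega x -> {for x, continuous h} /\
  forall i j : 'I_n,
    [/\ derivable h x (delta_mx 0 i),
        derivable (partial i h) x (delta_mx 0 j),
        {for x, continuous (partial i h)} &
        {for x, continuous (partial j (partial i h))}].

(* L acts on the twice continuously differentiable functions of its domain as
   sum_ij a_ij d_i d_j + sum_i b_i d_i + c, where (a_ij) is symmetric and not
   a.e. zero, so that the order is exactly two. *)
Definition second_order_pdo (eta : {measure set (borelRn R n) -> \bar R})
    (Omega : set (borelRn R n))
    (L : unbounded_operator (borelRn R n -> R[i])) : Prop :=
  exists (a : 'I_n -> 'I_n -> borelRn R n -> R[i])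
         (b : 'I_n -> borelRn R n -> R[i]) (c : borelRn R n -> R[i]),
  [/\ forall i j, a i j = a j i,
      ~ (forall i j, a i j = (fun=> 0) %[ae eta in Omega]) &
      forall f, opdom L f ->
        C2_on Omega (fun x => complex.Re (f x)) ->
        C2_on Omega (fun x => complex.Im (f x)) ->
        L f = (fun x => \sum_i \sum_j a i j x * cpartial i (cpartial j f) x
                        + \sum_i b i x * cpartial i f x + c x * f x)
          %[ae eta in Omega]].

End differential_operator.

(* Main.v *)
(* Everything is read off the spectral measures.  For f in L^2 the measure
   m = E_{f,f} is finite, and |E_{f,g}(A)|^2 <= E_{f,f}(A) E_{g,g}(A) shows that
   E_{f,g} = rho m with rho in L^2(m), so that <phi(L) f, g> is the integral of
   phi rho against the single measure m, for every real phi in L^2(m).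
   Dominated convergence, differentiation under the integral and Fubini's theorem
   then carry scalar facts about phi over to phi(L) f.  The solution is
   u(y) = p_y(L) f with p_y(l) = G_sigma(y^2 l / 4) / Gamma(sigma), where
   G_s(z) = int_0^oo r^(s-1) e^(-r-z/r) dr, so that G_s(0) = Gamma(s).  The
   inversion r -> z/r gives G_sigma'(z) = - z^(sigma-1) G_(1-sigma)(z), which turns
   the extension equation into an ordinary differential equation in y for each
   fixed l; Cauchy's mean value theorem applied to G_sigma and z^sigma gives both
   limits at 0, dominated by a multiple of l^sigma.  The substitutions r = l t and
   r = y^2/(4t) in G_sigma give the three integral formulas; the first needs
   m{0} = 0, which is the orthogonality of f to the kernel of L. *)

Require Import Defs.
From HB Require Import structures.
From mathcomp Require Import all_boot all_order all_algebra.
From mathcomp Require Import all_classical all_reals all_analysis.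
From mathcomp Require Import complex.
From mathcomp Require Import measurable_realfun ring lra.

Set Implicit Arguments.
Unset Strict Implicit.
Unset Printing Implicit Defensive.

Import Order.TTheory GRing.Theory Num.Theory.
Import numFieldNormedType.Exports.
Import HBNNSimple.

Local Open Scope classical_set_scope.
Local Open Scope ring_scope.
Local Open Scope complex_scope.

(** * Limits, derivatives and exchange of integrals *)

Section parameter_integral.
Context {d : measure_display} {T : measurableType d} {R : realType}.
Variables (mu : {measure set T -> \bar R}) (D : set T).
Hypothesis mD : measurable D.

Lemma is_derive_Rintegral (F F' : R -> T -> R) (a b y : R) (g : T -> R) :
  a < y < b ->
  (forall x, a < x < b -> mu.-integrable D (EFin \o F x)) ->
  mu.-integrable D (EFin \o g) ->
  (forall x t, a < x < b -> D t -> is_derive x 1 (F ^~ t) (F' x t)) ->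
  (forall x t, a < x < b -> D t -> `|F' x t| <= g t) ->
  is_derive y 1 (fun x => \int[mu]_(t in D) F x t) (\int[mu]_(t in D) F' y t).
Proof.
move=> aby iF ig dF leF'.
have inI x : `]a, b[%classic x = (a < x < b) :> Prop by rewrite /= in_itv.
have abyI : `]a, b[%classic y by rewrite inI.
have d1F x t : `]a, b[%classic x -> D t -> partial1of2 F x t = F' x t.
  by rewrite inI partial1of2E => abx Dt; have /@derive_val := dF _ _ abx Dt.
have iFI x : `]a, b[%classic x -> mu.-integrable D (EFin \o F x).
  by rewrite inI; exact: iF.
have dFI x t : `]a, b[%classic x -> D t -> derivable (F ^~ t) x 1.
  by rewrite inI => abx Dt; have /@ex_derive := dF _ _ abx Dt.
have inorm : mu.-integrable D (EFin \o (Num.norm \o g)) by exact: integrable_norm.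
have leg x t : `]a, b[%classic x -> D t -> `|partial1of2 F x t| <= `|g t|.
  move=> abx Dt; rewrite d1F//; apply: le_trans (ler_norm _).
  by rewrite inI in abx; exact: leF'.
have g0 t : 0 <= `|g t| by [].
apply: DeriveDef.
  exact: (derivable_under_integral mD abyI iFI dFI g0 inorm leg).
rewrite -derive1E (differentiation_under_integral mD abyI iFI dFI g0 inorm leg).
by apply: eq_Rintegral => t; rewrite inE => Dt; rewrite d1F.
Qed.

Lemma cvg_Rintegral (F : nat -> T -> R) (F0 g : T -> R) :
  (forall n, measurable_fun D (F n)) ->
  mu.-integrable D (EFin \o g) ->
  (forall t, D t -> F n t @[n --> \oo] --> F0 t) ->
  (forall n t, D t -> `|F n t| <= g t) ->
  \int[mu]_(t in D) F n t @[n --> \oo] --> \int[mu]_(t in D) F0 t.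
Proof.
move=> mF ig cF leF.
have mF0 : measurable_fun D F0 by exact: (measurable_fun_cvg mF).
have mEF n : measurable_fun D (fun t => (F n t)%:E) by exact/measurable_EFinP.
have mEF0 : measurable_fun D (fun t => (F0 t)%:E) by exact/measurable_EFinP.
have cEF : {ae mu, forall t, D t -> (F n t)%:E @[n --> \oo] --> (F0 t)%:E}.
  by apply: aeW => t Dt; apply: cvg_EFin; [exact: nearW|exact: cF].
have leEF : {ae mu, forall t n, D t -> (`|(F n t)%:E| <= (EFin \o g) t)%E}.
  by apply: aeW => t n Dt; rewrite abse_EFin lee_fin leF.
have [iF0 _ cint] := dominated_convergence mD mEF mEF0 cEF ig leEF.
by move: cint; rewrite -(fineK (integrable_fin_num mD iF0)) => /fine_cvg.
Qed.

Lemma cvg_at_right_Rintegral (F : R -> T -> R) (F0 g : T -> R) (a : R) :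
  (forall y, a < y -> measurable_fun D (F y)) ->
  mu.-integrable D (EFin \o g) ->
  (forall t, D t -> F y t @[y --> a^'+] --> F0 t) ->
  (forall y t, a < y -> D t -> `|F y t| <= g t) ->
  \int[mu]_(t in D) F y t @[y --> a^'+] --> \int[mu]_(t in D) F0 t.
Proof.
move=> mF ig cF leF; apply/cvg_at_rightP => v [v_gt va].
apply: (cvg_Rintegral (g := g)) => //.
- by move=> n; exact: mF.
- by move=> t Dt; have /cvg_at_rightP := cF t Dt; apply.
- by move=> n t Dt; exact: leF.
Qed.

Lemma cvg_integral_sqr_nnsfun_approx (g : T -> R) (mg : measurable_fun D (EFin \o g)) :
  (forall x, D x -> 0 <= g x) -> mu.-integrable D (EFin \o (fun x => g x ^+ 2)) ->
  \int[mu]_(x in D) (g x - nnsfun_approx mD mg n x) ^+ 2 @[n --> \oo] --> 0.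
Proof.
move=> g0 ig; set s := nnsfun_approx mD mg.
have g0E x : D x -> (0 <= (EFin \o g) x)%E by move=> Dx; rewrite lee_fin g0.
have mdiff n : measurable_fun D (fun x => (g x - s n x) ^+ 2).
  apply/measurable_funX/measurable_funB; first exact/measurable_EFinP.
  exact: measurable_funTS.
have -> : 0 = \int[mu]_(x in D) cst 0 x by rewrite /Rintegral integral0.
apply: cvg_Rintegral ig _ _ => //.
- move=> x Dx; have -> : cst 0 x = (g x - g x) ^+ 2 by rewrite subrr expr0n.
  have cvg_diff : g x - s n x @[n --> \oo] --> g x - g x.
    apply: cvgB; first exact: cvg_cst.
    by have /fine_cvg := cvg_nnsfun_approx mD mg g0E Dx.
  rewrite expr2; under eq_fun do rewrite expr2; exact: cvgM.
move=> n x Dx; rewrite ger0_norm ?sqr_ge0//.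
have s_le : s n x <= g x by rewrite -lee_fin nnsfun_approxE; exact: le_approx.
have s_ge0 : 0 <= s n x by [].
by rewrite lerXn2r ?nnegrE ?subr_ge0 ?gerBl// (le_trans s_ge0).
Qed.

Lemma sqr_integrable_nnsfun_approx (g : T -> R) (e : nat -> R) : measurable_fun D g ->
  (forall x, D x -> 0 <= g x) -> mu.-integrable D (EFin \o (fun x => g x ^+ 2)) ->
  (forall n, 0 < e n) ->
  exists s : nat -> {nnsfun T >-> R},
  [/\ forall n x, D x -> s n x <= g x,
      forall x, D x -> s n x @[n --> \oo] --> g x &
      forall n, \int[mu]_(x in D) (g x - s n x) ^+ 2 <= e n].
Proof.
move=> mg g0 ig e0; have mgE : measurable_fun D (EFin \o g) by exact/measurable_EFinP.
have g0E x : D x -> (0 <= (EFin \o g) x)%E by move=> Dx; rewrite lee_fin g0.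
have fast n : exists k, (n <= k)%N /\
    \int[mu]_(x in D) (g x - nnsfun_approx mD mgE k x) ^+ 2 <= e n.
  have /cvgr0_norm_le /(_ _ (e0 n)) := cvg_integral_sqr_nnsfun_approx mgE g0 ig.
  move=> small; near \oo => k; exists k; split.
    by near: k; exact: nbhs_infty_ge.
  by apply: le_trans (ler_norm _) _; near: k.
have [k /all_and2[k_ge k_le]] := choice fast.
exists (fun n => nnsfun_approx mD mgE (k n)); split => //.
  by move=> n x Dx; rewrite -lee_fin nnsfun_approxE; exact: le_approx.
move=> x Dx; have /fine_cvg := cvg_nnsfun_approx mD mgE g0E Dx.
apply: cvg_comp; apply/cvgnyPge => A; near=> n.
by apply: leq_trans (k_ge n); near: n; exact: nbhs_infty_ge.
Unshelve. all: by end_near. Qed.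

End parameter_integral.

Lemma EFin_Rintegral {d : measure_display} {T : measurableType d} {R : realType}
    (mu : {measure set T -> \bar R}) (D : set T) (g : T -> R) :
  measurable D -> mu.-integrable D (EFin \o g) ->
  (\int[mu]_(x in D) g x)%:E = (\int[mu]_(x in D) (g x)%:E)%E.
Proof. by move=> mD ig; rewrite /Rintegral fineK//; exact: integrable_fin_num. Qed.

Lemma integrable_mul_sqr {d : measure_display} {T : measurableType d} {R : realType}
    (mu : {measure set T -> \bar R}) (D : set T) (g h : T -> R) :
  measurable D -> measurable_fun D g -> measurable_fun D h ->
  mu.-integrable D (EFin \o (fun x => g x ^+ 2)) ->
  mu.-integrable D (EFin \o (fun x => h x ^+ 2)) ->
  mu.-integrable D (EFin \o (fun x => g x * h x)).
Proof.
move=> mD mg mh ig ih; apply: le_integrable (integrableD mD ig ih) => //.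
  by apply/measurable_EFinP; exact: measurable_funM.
move=> x _ /=; rewrite lee_fin [leRHS]ger0_norm ?addr_ge0 ?sqr_ge0//.
have := sqr_ge0 (g x + h x); have := sqr_ge0 (g x - h x).
by rewrite ler_norml !expr2 => *; apply/andP; split; nra.
Qed.

Lemma integral_fine {d : measure_display} {T : measurableType d} {R : realType}
    (mu : {measure set T -> \bar R}) (D : set T) (g : T -> \bar R) :
  measurable D -> mu.-integrable D g ->
  mu.-integrable D (EFin \o (fine \o g)) /\
  (\int[mu]_(x in D) (fine (g x))%:E = \int[mu]_(x in D) g x)%E.
Proof.
move=> mD ig; have mg := measurable_int _ ig.
have mfg : measurable_fun D (EFin \o (fine \o g)).
  by apply/measurable_EFinP; exact: measurableT_comp.
split.
  apply: le_integrable ig => // x _ /=; case: (g x) => [r||] //=.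
    by rewrite normr0 leey.
  by rewrite normr0 leey.
apply: ae_eq_integral => //; apply: filterS (integrable_ae mD ig) => x gx Dx.
by rewrite fineK// gx.
Qed.

Section fubini_kernel.
Context {d1 d2 : measure_display} {T1 : measurableType d1}.
Context {T2 : measurableType d2} {R : realType}.
Variables (m1 : {sigma_finite_measure set T1 -> \bar R}).
Variables (m2 : {sigma_finite_measure set T2 -> \bar R}).
Implicit Types (K : T1 -> T2 -> R) (H rho : T2 -> R).

Lemma Fubini_kernel K H rho :
  measurable_fun setT (fun p => K p.1 p.2) -> (forall x y, 0 <= K x y) ->
  measurable_fun setT rho ->
  {ae m2, forall y, (\int[m1]_x (K x y)%:E = (H y)%:E)%E} ->
  m2.-integrable setT (fun y => (H y * rho y)%:E) ->
  m1.-integrable setT (fun x => \int[m2]_y (K x y * rho y)%:E)%E /\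
  (\int[m1]_x \int[m2]_y (K x y * rho y)%:E = \int[m2]_y (H y * rho y)%:E)%E.
Proof.
move=> mK K0 mrho KH iH.
pose f (p : T1 * T2) : \bar R := (K p.1 p.2 * rho p.2)%:E.
have mKy y : measurable_fun setT (K^~ y).
  exact: (measurableT_comp mK (measurable_pair2 y)).
have mf : measurable_fun setT f.
  apply/measurable_EFinP/measurable_funM => //.
  exact: (measurableT_comp mrho measurable_snd).
have KrH (r : T2 -> R) : {ae m2, forall y, setT y ->
    (\int[m1]_x (K x y * r y)%:E = (H y * r y)%:E)%E}.
  apply: filterS KH => y Ky _; rewrite EFinM -Ky -integralZr//.
  apply/integrableP; split; first exact/measurable_EFinP.
  by under eq_integral do rewrite /= ger0_norm//; rewrite Ky ltry.
have int_f : (m1 \x m2)%E.-integrable setT f.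
  apply/(integrable21ltyP m1 m2 mf); case/integrableP : iH => mH.
  congr (_ < _)%E; apply: ae_eq_integral => //; first exact: measurableT_comp.
    apply: (measurable_fun_fubini_tonelli_G (abse \o f)) => //=.
    exact: measurableT_comp.
  apply: filterS2 KH (KrH (Num.norm \o rho)) => y Ky Kry _ /=.
  have H_ge0 : 0 <= H y.
    by rewrite -lee_fin -Ky; apply: integral_ge0 => x _; rewrite lee_fin.
  rewrite normrM (ger0_norm H_ge0) -(Kry I).
  by apply: eq_integral => x _; rewrite normrM (ger0_norm (K0 _ _)).
split; first exact: (integrable_fubini_F int_f).
rewrite (Fubini int_f); apply: ae_eq_integral => //.
- exact: (measurable_fubini_G int_f).
- exact: measurable_int iH.
- exact: (KrH rho).
Qed.

End fubini_kernel.

Section Rintegral_fubini_kernel.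
Context {d1 d2 : measure_display} {T1 : measurableType d1}.
Context {T2 : measurableType d2} {R : realType}.
Variables (m1 : {sigma_finite_measure set T1 -> \bar R}).
Variables (m2 : {sigma_finite_measure set T2 -> \bar R}).
Variables (D1 : set T1) (D2 : set T2).
Hypotheses (mD1 : measurable D1) (mD2 : measurable D2).
Implicit Types (K : T1 -> T2 -> R) (H rho : T2 -> R).

Lemma measurable_fun_fst (g : T1 -> R) : measurable_fun D1 g ->
  measurable_fun (D1 `*` D2) (fun p => g p.1).
Proof.
move=> mg; apply: (measurable_comp (g := fst) mD1 _ mg) => [_ [p [D1p _] <-]//|].
by apply: measurable_funTS; exact: measurable_fst.
Qed.

Lemma measurable_fun_snd (g : T2 -> R) : measurable_fun D2 g ->
  measurable_fun (D1 `*` D2) (fun p => g p.2).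
Proof.
move=> mg; apply: (measurable_comp (g := snd) mD2 _ mg) => [_ [p [_ D2p] <-]//|].
by apply: measurable_funTS; exact: measurable_snd.
Qed.

Lemma Rintegral_Fubini_kernel K H rho :
  measurable_fun (D1 `*` D2) (fun p => K p.1 p.2) ->
  (forall x y, D1 x -> D2 y -> 0 <= K x y) ->
  measurable_fun setT rho ->
  {ae m2, forall y, D2 y -> (\int[m1]_(x in D1) (K x y)%:E = (H y)%:E)%E} ->
  m2.-integrable D2 (EFin \o (fun y => H y * rho y)) ->
  m1.-integrable D1 (EFin \o fun x => \int[m2]_(y in D2) (K x y * rho y)) /\
  \int[m1]_(x in D1) \int[m2]_(y in D2) (K x y * rho y) =
  \int[m2]_(y in D2) (H y * rho y).
Proof.
move=> mK K0 mrho KH iH.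
pose K1 x y := \1_D1 x * \1_D2 y * K x y.
have mK1 : measurable_fun setT (fun p => K1 p.1 p.2).
  have -> : (fun p => K1 p.1 p.2) = (fun p => K p.1 p.2) \_ (D1 `*` D2).
    apply/funext => p; rewrite patchE in_setX /K1 !indicE.
    by case: (p.1 \in D1); case: (p.2 \in D2); rewrite ?mul1r ?mul0r.
  exact: (measurable_restrictT _ (measurableX mD1 mD2)).1 mK.
have K1_ge0 x y : 0 <= K1 x y.
  rewrite /K1 !indicE; have [/set_mem Dx|_] := boolP (x \in D1); last by rewrite !mul0r.
  have [/set_mem Dy|_] := boolP (y \in D2); last by rewrite mulr0 mul0r.
  by rewrite !mul1r K0.
have K1H : {ae m2, forall y, (\int[m1]_x (K1 x y)%:E = ((H \_ D2) y)%:E)%E}.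
  apply: filterS KH => y Ky; rewrite patchE /K1 indicE.
  case: ifPn => [|_]; last first.
    by apply: integral0_eq => x _; rewrite mulr0 mul0r.
  rewrite inE => /Ky <-; rewrite [RHS]integral_mkcond; apply: eq_integral => x _.
  by rewrite mulr1 patchE indicE; case: (x \in D1); rewrite ?mul1r ?mul0r.
have HrhoE y : ((H \_ D2) y * rho y)%:E =
    (((fun y => (H y * rho y)%:E) \_ D2) y)%E.
  by rewrite !patchE; case: ifPn => // _; rewrite mul0r.
have iH_D2 : m2.-integrable setT (fun y => ((H \_ D2) y * rho y)%:E).
  by rewrite (funext HrhoE); exact: (integrable_mkcond _ mD2).1 iH.
have innerE x : (\int[m2]_y (K1 x y * rho y)%:E =
    ((fun x => \int[m2]_(y in D2) (K x y * rho y)%:E) \_ D1) x)%E.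
  rewrite patchE /K1 indicE; case: ifPn => _; last first.
    by apply: integral0_eq => y _; rewrite !mul0r.
  rewrite [RHS]integral_mkcond; apply: eq_integral => y _.
  by rewrite mul1r patchE indicE; case: (y \in D2); rewrite ?mul1r ?mul0r.
have [] := Fubini_kernel mK1 K1_ge0 mrho K1H iH_D2.
rewrite (funext innerE) (funext HrhoE) -!integral_mkcond.
move=> /(integrable_mkcond _ mD1).2/(integral_fine mD1)[int_inner <-] eq_inner.
by split; [exact: int_inner|rewrite /Rintegral eq_inner].
Qed.

End Rintegral_fubini_kernel.

(** * Densities *)

Section density.
Context {d : measure_display} {T : measurableType d} {R : realType}.
Variable m : {finite_measure set T -> \bar R}.
Implicit Types (A D : set T) (F rho phi : T -> R).

Lemma density_measure_ex F : m.-integrable setT (EFin \o F) ->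
  (forall x, 0 <= F x) ->
  exists M : {finite_measure set T -> \bar R},
    forall A, measurable A -> M A = (\int[m]_(x in A) (F x)%:E)%E.
Proof.
move=> iF F0; have F0E x : (0 <= (F x)%:E)%E by rewrite lee_fin.
pose nu A := (\int[m]_(x in A) (F x)%:E)%E.
have nu0 : nu set0 = 0%E by rewrite /nu integral_set0.
have nu_ge0 A : (0 <= nu A)%E by apply: integral_ge0.
have nu_sigma : semi_sigma_additive nu.
  exact: (semi_sigma_additive_nng_induced (measurable_int _ iF) F0E).
pose M : measure T R := HB.pack nu (isMeasure.Build _ _ _ nu nu0 nu_ge0 nu_sigma).
have M_fin : fin_num_fun M.
  by move=> A mA; apply: integrable_fin_num => //; exact: integrableS iF.
exists (HB.pack_for {finite_measure set T -> \bar R} nu M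
  (Measure_isFinite.Build _ _ _ M M_fin)) => A _.
by [].
Qed.

Section integral_density.
Variables (M : {finite_measure set T -> \bar R}) (F : T -> R) (D : set T).
Hypotheses (iF : m.-integrable setT (EFin \o F)) (F0 : forall x, 0 <= F x).
Hypothesis ME : forall A, measurable A -> M A = (\int[m]_(x in A) (F x)%:E)%E.
Hypothesis mD : measurable D.

Lemma ge0_integral_density phi :
  measurable_fun D phi -> (forall x, D x -> 0 <= phi x) ->
  (\int[M]_(x in D) (phi x)%:E = \int[m]_(x in D) (phi x * F x)%:E)%E.
Proof.
move=> mphi phi0; have mF : measurable_fun setT (EFin \o F) := measurable_int _ iF.
have Mm : M `<< m.
  apply/null_content_dominatesP => A mA mA0; rewrite ME//.
  by apply: null_set_integral => //; exact: measurable_funTS.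
have dMF : ae_eq m setT (Radon_Nikodym_SigmaFinite.f M m) (EFin \o F).
  apply: integral_ae_eq => //; first exact: Radon_Nikodym_SigmaFinite.f_integrable.
  by move=> A _ mA; rewrite -Radon_Nikodym_SigmaFinite.f_integral// ME.
pose phiD := (fun x => (phi x)%:E) \_ D.
have phiD0 x : (0 <= phiD x)%E.
  by apply: erestrict_ge0 => y Dy; rewrite lee_fin phi0.
have mphiD : measurable_fun setT phiD.
  by apply/(measurable_restrictT _ mD)/measurable_EFinP.
rewrite integral_mkcond -(Radon_Nikodym_SigmaFinite.change_of_variables Mm)//.
rewrite [RHS]integral_mkcond; apply: ae_eq_integral => //.
- apply: emeasurable_funM => //.
  exact: measurable_int (Radon_Nikodym_SigmaFinite.f_integrable Mm).
- apply/(measurable_restrictT _ mD)/measurable_EFinP/measurable_funM => //.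
  by apply: measurable_funTS; exact/measurable_EFinP.
- apply: filterS dMF => x dMFx _; rewrite dMFx// /phiD !patchE.
  by case: ifPn; rewrite ?mul0e.
Qed.

Lemma integral_density phi : measurable_fun D phi ->
  m.-integrable D (EFin \o (fun x => phi x * F x)) ->
  \int[M]_(x in D) phi x = \int[m]_(x in D) (phi x * F x).
Proof.
move=> mphi iphiF; rewrite /Rintegral integralE [in RHS]integralE.
rewrite !funerpos !funerneg; congr (fine (_ - _)).
  rewrite (ge0_integral_density (measurable_funrpos mphi))//.
  by apply: eq_integral => x _; rewrite /funrpos maxr_pMl ?F0// mul0r.
rewrite (ge0_integral_density (measurable_funrneg mphi))//.
by apply: eq_integral => x _; rewrite /funrneg maxr_pMl ?F0// mul0r mulNr.
Qed.

End integral_density.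

Lemma eq_setfun_integral (m1 m2 : set T -> \bar R) D (f : T -> \bar R) :
  (forall A, measurable A -> m1 A = m2 A) ->
  (\int[m1]_(x in D) f x = \int[m2]_(x in D) f x)%E.
Proof.
move=> m12.
have sintegralE (h : {nnsfun T >-> R}) : sintegral m1 h = sintegral m2 h.
  by apply: eq_fsbigr => r _; rewrite m12.
rewrite /integral; congr (ereal_sup _ - ereal_sup _)%E;
  by apply/seteqP; split => _ [h leh <-]; exists h => //; rewrite sintegralE.
Qed.

Lemma measurable_ge0 rho : measurable_fun setT rho ->
  measurable [set x | 0 <= rho x].
Proof.
move=> mrho; rewrite -[mkset _]setTI.
exact: measurable_fun_le (measurable_cst _) mrho.
Qed.

(* The supremum over the measurable subsets of [A] is attained on
   [A `&` [set x | 0 <= rho x]]. *)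
Lemma upper_variation_density (nu : set T -> R) rho A :
  m.-integrable setT (EFin \o rho) ->
  (forall A, measurable A -> nu A = \int[m]_(x in A) rho x) ->
  measurable A ->
  upper_variation nu A = (\int[m]_(x in A) (rho^\+ x)%:E)%E.
Proof.
move=> irho nuE mA.
have mrho : measurable_fun setT rho.
  by apply/measurable_EFinP; exact: measurable_int irho.
have mrhop B : measurable_fun B (EFin \o rho^\+).
  exact/measurable_funTS/measurable_EFinP/measurable_funrpos.
have nuEE B : measurable B -> (nu B)%:E = (\int[m]_(x in B) (rho x)%:E)%E.
  by move=> mB; rewrite nuE// EFin_Rintegral//; exact: integrableS irho.
apply/eqP; rewrite eq_le; apply/andP; split.
  apply: ge_ereal_sup => _ [B [mB BA] <-]; rewrite nuEE//.
  apply: (@le_trans _ _ (\int[m]_(x in B) (rho^\+ x)%:E)%E); last first.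
    by apply: ge0_subset_integral => // x _; rewrite lee_fin.
  by rewrite integralE funerpos geeDl// oppe_le0; exact: integral_ge0.
have mP := measurable_ge0 mrho.
apply: ereal_sup_ubound; exists (A `&` [set x | 0 <= rho x]).
  by split; [exact: measurableI|exact: subIsetl].
rewrite nuEE; last exact: measurableI.
rewrite integral_mkcondr; apply: eq_integral => x _; rewrite patchE.
case: ifPn => [|/negP]; rewrite inE => /= rho0; first by rewrite /funrpos max_l.
by rewrite /funrpos max_r// ltW// ltNge; exact/negP.
Qed.

Lemma integral_upper_variation (nu : set T -> R) rho D phi :
  m.-integrable setT (EFin \o rho) ->
  (forall A, measurable A -> nu A = \int[m]_(x in A) rho x) ->
  measurable D -> measurable_fun D phi ->
  m.-integrable D (EFin \o (fun x => phi x * rho x)) ->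
  m.-integrable D (EFin \o (fun x => phi x * rho^\+ x)) /\
  fine (\int[upper_variation nu]_(x in D) (phi x)%:E)%E =
  \int[m]_(x in D) (phi x * rho^\+ x).
Proof.
move=> irho nuE mD mphi iphirho.
have irhop : m.-integrable setT (EFin \o rho^\+) by exact: integrable_funrpos.
have mrhop : measurable_fun setT rho^\+.
  by apply/measurable_EFinP; exact: measurable_int irhop.
have iphirhop : m.-integrable D (EFin \o (fun x => phi x * rho^\+ x)).
  apply: le_integrable iphirho => //.
    by apply/measurable_EFinP/measurable_funM => //; exact: measurable_funTS.
  move=> x _ /=; rewrite lee_fin !normrM ler_wpM2l//.
  rewrite /funrpos /Num.max; case: ifPn => // _; by rewrite normr0.
split=> //; have [M ME] := density_measure_ex irhop (funrpos_ge0 rho).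
rewrite (@eq_setfun_integral _ M) => [|A mA].
  exact: (integral_density irhop).
by rewrite ME// (upper_variation_density irho nuE).
Qed.

Lemma signed_integral_density (nu : set T -> R) rho D phi :
  m.-integrable setT (EFin \o rho) ->
  (forall A, measurable A -> nu A = \int[m]_(x in A) rho x) ->
  measurable D -> measurable_fun D phi ->
  m.-integrable D (EFin \o (fun x => phi x * rho x)) ->
  signed_integral nu D phi = \int[m]_(x in D) (phi x * rho x).
Proof.
move=> irho nuE mD mphi iphirho.
have irhoN : m.-integrable setT (EFin \o (\- rho)).
  by have := integrableN irho; exact: eq_integrable.
have nuNE A : measurable A -> - nu A = \int[m]_(x in A) (- rho x).
  move=> mA; rewrite nuE// -mulN1r -RintegralZl//.
    by apply: eq_Rintegral => x _; rewrite mulN1r.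
  exact: integrableS irho.
have iphirhoN : m.-integrable D (EFin \o (fun x => phi x * (\- rho) x)).
  by have := integrableN iphirho; apply: eq_integrable => // x _ /=; rewrite mulrN.
have [ip intp] := integral_upper_variation irho nuE mD mphi iphirho.
have [ineg intn] := integral_upper_variation irhoN nuNE mD mphi iphirhoN.
rewrite /signed_integral intp intn -RintegralB//.
apply: eq_Rintegral => x _; rewrite funrposN -mulrBr.
by rewrite -[in RHS](funrposBneg rho).
Qed.

(* On the level set of [rho] between [k] and [k + 1] the hypothesis gives
   [k ^+ 2 * m A <= n A]. *)
Lemma integral_sqr_density_level (n : {finite_measure set T -> \bar R}) rho
    (k : nat) A :
  m.-integrable setT (EFin \o rho) -> measurable A ->
  (\int[m]_(x in A) rho x) ^+ 2 <= fine (m A) * fine (n A) ->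
  (forall x, A x -> k%:R <= rho x < k.+1%:R) ->
  (\int[m]_(x in A) (rho x ^+ 2)%:E <= 2%:E * n A + 2%:E * m A)%E.
Proof.
move=> irho mA le_mn levelA.
have irhoA : m.-integrable A (EFin \o rho) by exact: integrableS irho.
have ksqr : k%:R ^+ 2 * fine (m A) <= fine (n A).
  have kmA : k%:R * fine (m A) <= \int[m]_(x in A) rho x.
    rewrite -Rintegral_cst//; apply: le_Rintegral => //.
      exact: finite_measure_integrable_cst.
    by move=> x /levelA/andP[].
  have [->|mA0] := eqVneq (fine (m A)) 0; first by rewrite mulr0 fine_ge0.
  have {}mA0 : 0 < fine (m A) by rewrite lt_neqAle eq_sym mA0 fine_ge0.
  rewrite -(ler_pM2l mA0) mulrCA -expr2 -exprMn; apply: le_trans le_mn.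
  have kmA0 : 0 <= k%:R * fine (m A) by rewrite mulr_ge0 ?fine_ge0.
  by rewrite lerXn2r// nnegrE// (le_trans kmA0).
apply: (@le_trans _ _ (\int[m]_(x in A) (k.+1%:R ^+ 2)%:E)%E).
  apply: ge0_le_integral => //.
  - by move=> x _; rewrite lee_fin sqr_ge0.
  - by apply/measurable_EFinP/measurable_funX/measurable_EFinP; exact: measurable_int irhoA.
  - move=> x /levelA/andP[krho rhok]; rewrite lee_fin.
    by rewrite lerXn2r ?nnegrE ?(le_trans _ krho)// ltW.
have -> : (2%:E * n A + 2%:E * m A)%E = (2 * fine (n A) + 2 * fine (m A))%:E.
  by rewrite [RHS]EFinD !EFinM !fineK ?fin_num_measure.
rewrite -(@fineK _ (\int[m]_(x in A) _)%E); last first.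
  by rewrite integral_cst// fin_numM// fin_num_measure.
rewrite -/(Rintegral _ _ _) Rintegral_cst// lee_fin.
have mA0 : 0 <= fine (m A) by exact: fine_ge0.
have : 0 <= (k%:R - 1) ^+ 2 * fine (m A) by rewrite mulr_ge0 ?sqr_ge0.
rewrite -natr1 !expr2 in ksqr *; nra.
Qed.

Lemma integral_sqr_density_pos (n : {finite_measure set T -> \bar R}) rho :
  m.-integrable setT (EFin \o rho) ->
  (forall A, measurable A ->
    (\int[m]_(x in A) rho x) ^+ 2 <= fine (m A) * fine (n A)) ->
  (\int[m]_(x in [set x | (0 <= rho x)%R]) (rho x ^+ 2)%:E < +oo)%E.
Proof.
move=> irho le_mn.
have mrho : measurable_fun setT rho.
  by apply/measurable_EFinP; exact: measurable_int irho.
pose A k := rho @^-1` `[k%:R, k.+1%:R[.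
have mA k : measurable (A k).
  by rewrite -[A k]setTI; exact: mrho.
have levelA k x : A k x -> k%:R <= rho x < k.+1%:R by rewrite /A/= in_itv.
have tA : trivIset setT A.
  apply/trivIsetP => i j _ _; apply: contra_neq_eq => /set0P[x [/levelA ix /levelA jx]].
  by rewrite -(truncn_def ix) (truncn_def jx).
have posE : [set x | 0 <= rho x] = \bigcup_k A k.
  apply/seteqP; split => [x rho0|x [k _ /levelA/andP[krho _]]].
    by exists (Num.truncn (rho x)) => //; rewrite /A/= in_itv/= truncn_itv.
  exact: le_trans krho.
have mrho2 B : measurable_fun B (fun x => (rho x ^+ 2)%:E).
  by apply/measurable_funTS/measurable_EFinP/measurable_funX.
have mnA k : (0 <= 2%:E * n (A k) + 2%:E * m (A k))%E.
  by rewrite adde_ge0// mule_ge0.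
rewrite posE ge0_integral_bigcup//; last by move=> x _; rewrite lee_fin sqr_ge0.
apply: (@le_lt_trans _ _
  (\sum_(0 <= k <oo) (2%:E * n (A k) + 2%:E * m (A k)))%E).
  apply: lee_nneseries => [k _ _|k _].
    by apply: integral_ge0 => x _; rewrite lee_fin sqr_ge0.
  exact: (integral_sqr_density_level irho (mA k) (le_mn _ (mA k)) (levelA k)).
rewrite nneseriesD; [|by move=> k _ _; exact: mule_ge0..].
rewrite !nneseriesZl//; [|by move=> *; exact: measure_ge0..].
rewrite -!measure_semi_bigcup//; [|exact: bigcup_measurable..].
by rewrite lte_add_pinfty// lte_mul_pinfty// -ge0_fin_numE// fin_num_measure//;
  exact: bigcup_measurable.
Qed.

Lemma integrable_sqr_density (n : {finite_measure set T -> \bar R}) rho :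
  m.-integrable setT (EFin \o rho) ->
  (forall A, measurable A ->
    (\int[m]_(x in A) rho x) ^+ 2 <= fine (m A) * fine (n A)) ->
  m.-integrable setT (EFin \o (fun x => rho x ^+ 2)).
Proof.
move=> irho le_mn.
have irhoN : m.-integrable setT (EFin \o (\- rho)).
  by have := integrableN irho; exact: eq_integrable.
have le_mnN A : measurable A ->
    (\int[m]_(x in A) (- rho x)) ^+ 2 <= fine (m A) * fine (n A).
  move=> mA; under eq_Rintegral do rewrite -mulN1r.
  rewrite RintegralZl//; last exact: integrableS irho.
  by rewrite mulN1r sqrrN le_mn.
have mrho : measurable_fun setT rho.
  by apply/measurable_EFinP; exact: measurable_int irho.
have mrho2 B : measurable_fun B (fun x => (rho x ^+ 2)%:E).
  by apply/measurable_funTS/measurable_EFinP/measurable_funX.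
have sqr0 x : (0 <= (rho x ^+ 2)%:E)%E by rewrite lee_fin sqr_ge0.
have pos := integral_sqr_density_pos irho le_mn.
have neg : (\int[m]_(x in [set x | (0 <= - rho x)%R]) (rho x ^+ 2)%:E < +oo)%E.
  have := integral_sqr_density_pos irhoN le_mnN.
  by under eq_integral do rewrite sqrrN.
apply/integrableP; split => //.
under eq_integral do rewrite /= ger0_norm ?sqr_ge0//.
rewrite -(setUv [set x | 0 <= rho x]) ge0_integral_setU//.
- rewrite lte_add_pinfty//; apply: le_lt_trans neg; apply: ge0_subset_integral => //.
  + by apply: measurableC; exact: measurable_ge0.
  + by apply: measurable_ge0; exact: measurable_funN.
  + by move=> x /= /negP; rewrite -ltNge oppr_ge0 => /ltW.
- exact: measurable_ge0.
- by apply: measurableC; exact: measurable_ge0.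
- exact/disj_setPCl.
Qed.

End density.

Section sigma_additive_setfun.
Context {d : measure_display} {T : measurableType d} {R : realType}.
Implicit Type nu : set T -> R.

Definition sigma_additive_setfun nu := nu set0 = 0 /\
  forall A : nat -> set T, (forall k, measurable (A k)) -> trivIset setT A ->
    series (fun k => nu (A k)) @ \oo --> nu (\bigcup_k A k).

Let semi_sigma_additive_EFin nu : sigma_additive_setfun nu ->
  semi_sigma_additive (EFin \o nu).
Proof.
move=> [_ nus] F mF tF _; rewrite /comp; under eq_fun do rewrite sumEFin.
by apply: cvg_EFin; [exact: nearW|exact: nus].
Qed.

Lemma ge0_setfun_measure_ex nu : sigma_additive_setfun nu ->
  (forall A, measurable A -> 0 <= nu A) ->
  exists m : {finite_measure set T -> \bar R},
    forall A, measurable A -> m A = (nu A)%:E.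
Proof.
move=> nus nu_ge0; pose absnu A := `|nu A|.
have absnuE A : measurable A -> absnu A = nu A by move=> mA; rewrite /absnu ger0_norm ?nu_ge0.
have absnus : sigma_additive_setfun absnu.
  split; first by rewrite absnuE//; exact: nus.1.
  move=> A mA tA; rewrite absnuE; last exact: bigcup_measurable.
  by rewrite (_ : (fun k => _) = nu \o A) ?[X in series X]/comp;
    [exact: nus.2|apply/funext => k; exact: absnuE].
have m0 : (EFin \o absnu) set0 = 0%E by rewrite /= absnus.1.
have m_ge0 A : (0 <= (EFin \o absnu) A)%E by rewrite lee_fin normr_ge0.
pose m : measure T R := HB.pack (EFin \o absnu)
  (isMeasure.Build _ _ _ _ m0 m_ge0 (semi_sigma_additive_EFin absnus)).
have m_fin : fin_num_fun m by move=> A mA.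
exists (HB.pack_for {finite_measure set T -> \bar R} (EFin \o absnu) m
  (Measure_isFinite.Build _ _ _ m m_fin)) => A mA.
by congr EFin; exact: absnuE.
Qed.

Lemma setfun_density_ex (m : {finite_measure set T -> \bar R}) nu :
  sigma_additive_setfun nu ->
  (forall A, measurable A -> m A = 0%E -> nu A = 0) ->
  exists2 rho : T -> R, m.-integrable setT (EFin \o rho) &
    forall A, measurable A -> nu A = \int[m]_(x in A) rho x.
Proof.
move=> nus nu_m; have nu0 : (EFin \o nu) set0 = 0%E by rewrite /= nus.1.
have nu_fin (A : set T) : measurable A -> (EFin \o nu) A \is a fin_num by [].
pose C : {charge set T -> \bar R} := HB.pack (EFin \o nu)
  (isCharge.Build _ _ _ _ nu0 nu_fin (semi_sigma_additive_EFin nus)).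
have Cm : C `<< m.
  by apply/null_content_dominatesP => A mA mA0; rewrite /= nu_m.
have [irho _] := integral_fine measurableT (Radon_Nikodym_integrable Cm).
exists (fine \o Radon_Nikodym C m) => // A mA.
have /integral_fine - /(_ mA)[_ rhoA] :=
  integrableS measurableT mA (@subsetT _ A) (Radon_Nikodym_integrable Cm).
by rewrite /Rintegral rhoA -Radon_Nikodym_integral.
Qed.

End sigma_additive_setfun.

(** * Substitution on the open half-line *)

Section halfline.
Context {R : realType}.
Local Notation mu := (@lebesgue_measure R).
Local Notation Rgt0 := (`]0%R, +oo[%classic : set R).
Local Notation Rge0 := (`[0%R, +oo[%classic : set R).
Implicit Types (a b c x y M : R) (n : nat) (F G : R -> R).

Lemma Rgt0E x : Rgt0 x = (0 < x) :> Prop.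
Proof. by rewrite /= in_itv/= andbT. Qed.

Lemma Rge0E x : Rge0 x = (0 <= x) :> Prop.
Proof. by rewrite /= in_itv/= andbT. Qed.

Lemma continuous_measurable_Rgt0 G :
  (forall x, 0 < x -> {for x, continuous G}) -> measurable_fun Rgt0 G.
Proof.
move=> cG; apply: open_continuous_measurable_fun; first exact: interval_open.
by move=> x; rewrite inE Rgt0E => /cG.
Qed.

Lemma within_itv_continuous_Rgt0 a b G : 0 < a ->
  (forall x, 0 < x -> {for x, continuous G}) -> {within `[a, b], continuous G}.
Proof.
move=> a0 cG; apply: continuous_in_subspaceT => x.
by rewrite inE/= in_itv/= => /andP[ax _]; apply: cG; exact: lt_le_trans ax.
Qed.

Lemma is_derive1_continuous F x (D : R) :
  is_derive x 1 F D -> {for x, continuous F}.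
Proof.
by move=> ?; apply: differentiable_continuous; apply/derivable1_diffP;
  exact: ex_derive.
Qed.

Lemma continuous_divl c x : 0 < x -> {for x, continuous (fun y => c / y)}.
Proof.
move=> x0; apply: cvgM; first exact: cvg_cst.
by apply: inv_continuous; rewrite gt_eqF.
Qed.

Lemma is_derive_divl c x : 0 < x ->
  is_derive x 1 (fun y => c / y) (- (c / x ^+ 2)).
Proof.
move=> x0; have xn0 : x != 0 by rewrite gt_eqF.
have dV : is_derive x 1 (fun y : R => y^-1) (- x ^- 2 *: 1).
  exact: (is_deriveV xn0 (is_derive_id x 1)).
have dM := is_deriveM (is_derive_cst c x (1 : R)) dV.
rewrite (_ : - (c / x ^+ 2) = cst c x *: (- x ^- 2 *: 1) + x^-1 *: 0); first exact: dM.
by rewrite scaler0 addr0 /GRing.scale/= mulr1 mulrN.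
Qed.

Lemma continuous_div_sqr c x : 0 < x -> {for x, continuous (fun y => c / y ^+ 2)}.
Proof.
move=> x0; apply: cvgM; first exact: cvg_cst.
apply: (@continuous_comp _ _ _ (fun y => y ^+ 2) (@GRing.inv R)).
  exact: exprn_continuous.
by apply: inv_continuous; rewrite gt_eqF ?exprn_gt0.
Qed.

Lemma continuous_comp_divl c G : 0 < c ->
  (forall x, 0 < x -> {for x, continuous G}) ->
  forall x, 0 < x -> {for x, continuous (fun y => G (c / y) * (c / y ^+ 2))}.
Proof.
move=> c0 cG x x0; apply: cvgM; last exact: continuous_div_sqr.
apply: (@continuous_comp _ _ _ (fun y => c / y) G); first exact: continuous_divl.
by apply: cG; rewrite divr_gt0.
Qed.

Lemma integral_itv_divl c a b G : 0 < c -> 0 < a -> a <= b ->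
  (forall x, 0 < x -> {for x, continuous G}) ->
  (\int[mu]_(x in `[(c / b)%R, (c / a)%R]) (G x)%:E =
   \int[mu]_(x in `[a, b]) (G (c / x) * (c / x ^+ 2))%:E)%E.
Proof.
move=> c0 a0 ab cG; have b0 : 0 < b by exact: lt_le_trans ab.
have dE x : 0 < x -> derive1 (fun y => c / y) x = - (c / x ^+ 2).
  by move=> x0; rewrite derive1E; have /@derive_val := is_derive_divl c x0.
have cd x : 0 < x -> {for x, continuous (derive1 (fun y => c / y))}.
  move=> x0.
  have : {near x, (fun y => - (c / y ^+ 2)) =1 derive1 (fun y => c / y)}.
    by near=> z; rewrite dE//; near: z; exact: lt_nbhsr.
  move=> /near_eq_cvg near_derive; apply: cvg_trans near_derive _; rewrite (dE _ x0).
  by apply: cvgN; exact: continuous_div_sqr.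
have gt_a x : x \in `]a, b[ -> 0 < x.
  by rewrite in_itv/= => /andP[ax _]; exact: lt_trans ax.
rewrite (@integration_by_substitution_decreasing _ (fun x => c / x))//.
- apply: eq_integral => x; rewrite inE/= in_itv/= => /andP[ax _].
  by rewrite !fctE dE ?opprK// (lt_le_trans a0).
- move=> x y; rewrite !in_itv/= => /andP[ax _] /andP[ay _] xy.
  by rewrite ltr_pM2l// ltf_pV2// ?posrE (lt_le_trans a0).
- by move=> x /gt_a; exact: cd.
- by apply/cvg_ex; eexists; apply: cvg_at_right_filter; exact: cd.
- by apply/cvg_ex; eexists; apply: cvg_at_left_filter; exact: cd.
- split.
  + by move=> x /gt_a x0; have /@ex_derive := is_derive_divl c x0.
  + by apply: cvg_at_right_filter; exact: continuous_divl.
  + by apply: cvg_at_left_filter; exact: continuous_divl.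
- by apply: within_itv_continuous_Rgt0 => //; rewrite divr_gt0.
Unshelve. all: by end_near. Qed.

Lemma Rgt0_bigcup c : 0 < c ->
  Rgt0 = \bigcup_n `[c / n.+1%:R, c * n.+1%:R]%classic.
Proof.
move=> c0; apply/seteqP; split => x /=; last first.
  move=> [n _]; rewrite /= !in_itv/= andbT => /andP[+ _].
  by apply: lt_le_trans; rewrite divr_gt0.
rewrite in_itv/= andbT => x0.
pose n := (Num.bound (x / c) + Num.bound (c / x))%N.
exists n => //=; rewrite in_itv/=; apply/andP; split.
  rewrite ler_pdivrMr// mulrC -ler_pdivrMr//.
  apply/ltW/(lt_le_trans (archi_boundP _)); first by rewrite divr_ge0 ?ltW.
  by rewrite ler_nat /n -addnS -addSnnS leq_addl.
rewrite mulrC -ler_pdivrMr//.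
apply/ltW/(lt_le_trans (archi_boundP _)); first by rewrite divr_ge0 ?ltW.
by rewrite ler_nat /n -addnS leq_addr.
Qed.

Lemma cvg_integral_Rgt0 c (f : R -> \bar R) : 0 < c ->
  measurable_fun Rgt0 f -> (forall x, 0 < x -> (0 <= f x)%E) ->
  (\int[mu]_(x in `[(c / n.+1%:R)%R, (c * n.+1%:R)%R]) f x)%E @[n --> \oo] -->
  (\int[mu]_(x in Rgt0) f x)%E.
Proof.
move=> c0 mf f0; rewrite (Rgt0_bigcup c0).
have subRgt0 n : `[c / n.+1%:R, c * n.+1%:R]%classic `<=` Rgt0.
  by move=> x itvx; rewrite (Rgt0_bigcup c0); exists n.
apply: ge0_nondecreasing_set_cvg_integral.
- apply/nondecreasing_seqP => n; rewrite subsetEset.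
  apply: subset_itv; rewrite bnd_simp.
    by rewrite ler_pM2l// lef_pV2 ?posrE// ler_nat.
  by rewrite ler_pM2l// ler_nat.
- by move=> n; exact: measurable_itv.
- by move=> n; exact: measurable_funS mf.
- by move=> n x /subRgt0; rewrite Rgt0E; exact: f0.
Qed.

Lemma integral_Rgt0_divl c G : 0 < c ->
  (forall x, 0 < x -> {for x, continuous G}) -> (forall x, 0 < x -> 0 <= G x) ->
  (\int[mu]_(x in Rgt0) (G x)%:E =
   \int[mu]_(x in Rgt0) (G (c / x) * (c / x ^+ 2))%:E)%E.
Proof.
move=> c0 cG G0.
have mG : measurable_fun Rgt0 (EFin \o G).
  by apply/measurable_EFinP; exact: continuous_measurable_Rgt0.
have mGc : measurable_fun Rgt0 (fun x => (G (c / x) * (c / x ^+ 2))%:E).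
  apply/measurable_EFinP; apply: continuous_measurable_Rgt0.
  exact: (continuous_comp_divl c0 cG).
have lim := cvg_integral_Rgt0 c0 mG; have limc := cvg_integral_Rgt0 ltr01 mGc.
have G0E x : 0 < x -> (0 <= (EFin \o G) x)%E by move=> x0; rewrite lee_fin G0.
have Gc0E x : 0 < x -> (0 <= (G (c / x) * (c / x ^+ 2))%:E)%E.
  move=> x0; rewrite lee_fin mulr_ge0 ?G0 ?divr_gt0//.
  by rewrite divr_ge0 ?sqr_ge0// ltW.
apply: (cvg_unique (@ereal_hausdorff R) (lim G0E)); apply: cvg_trans (limc Gc0E).
apply: near_eq_cvg; apply: nearW => n.
have itvE : `[c / n.+1%:R, c * n.+1%:R]%classic =
    `[c / (1 * n.+1%:R), c / (1 / n.+1%:R)]%classic.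
  by rewrite !mul1r invrK.
rewrite itvE integral_itv_divl// !mul1r.
by rewrite (@le_trans _ _ 1) ?invf_le1 ?ler1n.
Qed.

Lemma integral_Rgt0_scale c G : 0 < c ->
  (forall x, 0 < x -> {for x, continuous G}) -> (forall x, 0 < x -> 0 <= G x) ->
  (\int[mu]_(x in Rgt0) (G x)%:E = \int[mu]_(x in Rgt0) (G (c * x) * c)%:E)%E.
Proof.
move=> c0 cG G0; rewrite (integral_Rgt0_divl c0 cG G0).
rewrite (integral_Rgt0_divl (ltr01)); last 2 first.
- exact: (continuous_comp_divl c0 cG).
- by move=> x x0; rewrite mulr_ge0 ?G0 ?divr_gt0// divr_ge0 ?sqr_ge0// ltW.
apply: eq_integral => x; rewrite inE Rgt0E => x0; congr (_%:E).
by rewrite mul1r invrK -mulrA; congr (_ * _); field; rewrite gt_eqF.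
Qed.

(* By the fundamental theorem of calculus the integral over [1/n, n] is
   F n - F (1/n). *)
Lemma integrable_Rgt0_derive F G M :
  (forall x, 0 < x -> is_derive x 1 F (G x)) ->
  (forall x, 0 < x -> {for x, continuous G}) -> (forall x, 0 < x -> 0 <= G x) ->
  (forall x, 0 < x -> 0 <= F x <= M) ->
  mu.-integrable Rgt0 (EFin \o G).
Proof.
move=> dF cG G0 bF.
have cF x : 0 < x -> {for x, continuous F} by move=> /dF; exact: is_derive1_continuous.
have mG : measurable_fun Rgt0 (EFin \o G).
  by apply/measurable_EFinP; exact: continuous_measurable_Rgt0.
apply/integrableP; split => //.
have -> : (\int[mu]_(x in Rgt0) `|(EFin \o G) x| = \int[mu]_(x in Rgt0) (G x)%:E)%E.
  by apply: eq_integral => x; rewrite inE Rgt0E => x0; rewrite gee0_abs ?lee_fin ?G0.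
have G0E x : 0 < x -> (0 <= (EFin \o G) x)%E by move=> x0; rewrite lee_fin G0.
have lim := cvg_integral_Rgt0 ltr01 mG G0E.
apply: (@le_lt_trans _ _ M%:E); last exact: ltry.
rewrite -(cvg_lim (@ereal_hausdorff R) lim).
apply: lime_le; first by apply/cvg_ex; eexists; exact: lim.
have M0 : 0 <= M by have /andP[/le_trans] := bF 1 ltr01; apply.
apply: nearW => -[|n]; first by rewrite mulr1 divr1 set_itv1 integral_set1 lee_fin.
have n0 : 0 < 1 / n.+2%:R :> R by rewrite divr_gt0.
have n1 : 0 < 1 * n.+2%:R :> R by rewrite mulr_gt0.
have gt0 x : x \in `](1 / n.+2%:R), (1 * n.+2%:R)[ -> 0 < x.
  by rewrite in_itv/= => /andP[nx _]; exact: lt_trans nx.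
rewrite (@continuous_FTC2 _ G F).
- rewrite -EFinB lee_fin lerBlDr.
  by rewrite (@le_trans _ _ M)// ?lerDl; [case/andP: (bF _ n1)|case/andP: (bF _ n0)].
- by rewrite !mul1r (@lt_trans _ _ 1) ?invf_lt1 ?ltr1n.
- exact: within_itv_continuous_Rgt0.
- split.
  + by move=> x /gt0 x0; have /@ex_derive := dF _ x0.
  + by apply: cvg_at_right_filter; exact: cF.
  + by apply: cvg_at_left_filter; exact: cF.
- by move=> x /gt0 x0; rewrite derive1E; have /@derive_val := dF _ x0.
Qed.

End halfline.

(** * The generalized Gamma function *)

Section genGamma.
Context {R : realType}.
Local Notation mu := (@lebesgue_measure R).
Local Notation Rgt0 := (`]0%R, +oo[%classic : set R).
Implicit Types (c s t r x y z l : R).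

Let mRgt0 : measurable (Rgt0 : set (measurableTypeR R)) := measurable_itv _.

Lemma gt0_powRD x r s : 0 < x -> x `^ (r + s) = x `^ r * x `^ s.
Proof. by move=> x0; rewrite powRD// (gt_eqF x0) implybT. Qed.

Lemma gt0_powRB x r s : 0 < x -> x `^ (r - s) = x `^ r / x `^ s.
Proof. by move=> x0; rewrite powRB// (gt_eqF x0) implybT. Qed.

Lemma continuous_powR r x : 0 < x -> {for x, continuous (fun y => y `^ r)}.
Proof. by move=> x0; exact: is_derive1_continuous (is_derive1_powR r x0). Qed.

Lemma mulr_expRN_le1 x : x * expR (- x) <= 1.
Proof.
rewrite expRN ler_pdivrMr ?expR_gt0// mul1r (le_trans _ (expR_ge1Dx x))//.
by rewrite lerDr.
Qed.

Lemma powR_le_expR s t : 0 < s -> 0 <= t -> t `^ s <= expR t * s `^ s.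
Proof.
move=> s0 t0; have sn0 : s != 0 by rewrite gt_eqF.
rewrite -{1}(divfK sn0 t) powRM ?divr_ge0 ?(ltW s0)// ler_wpM2r ?powR_ge0//.
have : t / s <= expR (t / s) by rewrite (le_trans _ (expR_ge1Dx _))// lerDr.
move=> /(ge0_ler_powR (ltW s0)); rewrite -expRM divfK//; apply.
  by rewrite nnegrE divr_ge0 ?(ltW s0).
by rewrite nnegrE expR_ge0.
Qed.

Lemma expRN_le_powR s t : 0 < s -> 0 <= t ->
  expR (- t) <= expR 1 * s `^ s * (1 + t) `^ (- s).
Proof.
move=> s0 t0; have t1 : 0 < 1 + t by rewrite ltr_wpDr.
rewrite powRN ler_pdivlMr ?powR_gt0// mulrC -ler_pdivlMr ?expR_gt0//.
by rewrite -expRN opprK mulrAC -expRD powR_le_expR// ltW.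
Qed.

Definition genGamma_kernel s z r :=
  r `^ (s - 1) * expR (- r) * expR (- (`|z| / r)).

(* For z > 0 this is 2 z^(s/2) K_s(2 sqrt z), with K_s the Macdonald function;
   the absolute value in the kernel makes it continuous on the whole line. *)
Definition genGamma s z := \int[mu]_(r in Rgt0) genGamma_kernel s z r.

Lemma genGamma_kernel0 s r : genGamma_kernel s 0 r = r `^ (s - 1) * expR (- r).
Proof. by rewrite /genGamma_kernel normr0 mul0r oppr0 expR0 mulr1. Qed.

Lemma genGamma_kernel_ge0 s z r : 0 <= genGamma_kernel s z r.
Proof. by rewrite !mulr_ge0 ?powR_ge0 ?expR_ge0. Qed.

Lemma genGamma_kernel_le s z r : 0 < r ->
  genGamma_kernel s z r <= genGamma_kernel s 0 r.
Proof.
move=> r0; rewrite ler_wpM2l ?mulr_ge0 ?powR_ge0 ?expR_ge0//.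
by rewrite ler_expR lerN2 normr0 mul0r divr_ge0 ?(ltW r0).
Qed.

Lemma genGamma_kernelB1 s z r : 0 < r ->
  genGamma_kernel (s - 1) z r = r^-1 * genGamma_kernel s z r.
Proof.
move=> r0; rewrite /genGamma_kernel (gt0_powRB (s - 1) 1 r0) powRr1 ?(ltW r0)//.
by ring.
Qed.

Lemma mulr_genGamma_kernel_le s z r : 0 < r ->
  `|z| * genGamma_kernel s z r <= genGamma_kernel (s + 1) 0 r.
Proof.
move=> r0; rewrite -[s in leLHS](addrK 1) genGamma_kernelB1// mulrA.
rewrite genGamma_kernel0 /genGamma_kernel mulrCA ler_piMr ?mulr_expRN_le1//.
by rewrite mulr_ge0 ?powR_ge0 ?expR_ge0.
Qed.

Lemma genGamma_kernel_continuous s z x : 0 < x ->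
  {for x, continuous (genGamma_kernel s z)}.
Proof.
move=> x0; apply: cvgM; first apply: cvgM.
- exact: continuous_powR.
- apply: (@continuous_comp _ _ _ (-%R) expR); first exact: cvgN.
  exact: continuous_expR.
- apply: (@continuous_comp _ _ _ (fun r => - (`|z| / r)) expR).
    by apply: cvgN; exact: continuous_divl.
  exact: continuous_expR.
Qed.

Lemma genGamma_kernel_measurable s z : measurable_fun Rgt0 (genGamma_kernel s z).
Proof.
by apply: continuous_measurable_Rgt0 => x /genGamma_kernel_continuous.
Qed.

Lemma is_derive_ratio_powR s t : 0 < t ->
  is_derive t 1 (fun t => (t / (1 + t)) `^ s)
    (s * t `^ (s - 1) * (1 + t) `^ (- (s + 1))).
Proof.
move=> t0; have t1 : 0 < 1 + t by rewrite addr_gt0.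
have tn0 : 1 + t != 0 by rewrite gt_eqF.
have q0 : 0 < t / (1 + t) by rewrite divr_gt0.
have dq : is_derive t 1 (fun t : R => t / (1 + t)) ((1 + t) ^- 2).
  by apply: is_derive_eq; rewrite /GRing.scale/= add0r; field.
have -> : s * t `^ (s - 1) * (1 + t) `^ (- (s + 1)) =
    s * (t / (1 + t)) `^ (s - 1) * (1 + t) ^- 2.
  rewrite -!mulrA powRM ?invr_ge0 ?(ltW t0) ?(ltW t1)// -mulrA.
  congr (_ * (_ * _)).
  rewrite -powR_inv1 ?(ltW t1)// -powRrM -powR_mulrn ?(ltW t1)// -powRN.
  by rewrite -gt0_powRD//; congr (_ `^ _); ring.
exact: (@is_derive1_comp R (fun x => x `^ s) (fun t => t / (1 + t)) t _ _
  (is_derive1_powR s q0) dq).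
Qed.

(* The bounded increasing function (t / (1 + t)) `^ s has a derivative that
   dominates the integrand of the Gamma function. *)
Lemma genGamma_kernel0_integrable s : 0 < s ->
  mu.-integrable Rgt0 (EFin \o genGamma_kernel s 0).
Proof.
move=> s0; pose f t : R := s * t `^ (s - 1) * (1 + t) `^ (- (s + 1)).
have f0 t : 0 < t -> 0 <= f t by move=> t0; rewrite !mulr_ge0 ?powR_ge0// ltW.
have cf t : 0 < t -> {for t, continuous f}.
  move=> t0; apply: cvgM; first apply: cvgM.
  - exact: cvg_cst.
  - exact: continuous_powR.
  - apply: (@continuous_comp _ _ _ (fun t => 1 + t) (fun x => x `^ (- (s + 1)))).
      by apply: cvgD; [exact: cvg_cst|exact: cvg_id].
    by apply: continuous_powR; rewrite addr_gt0.
have int_f : mu.-integrable Rgt0 (EFin \o f).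
  apply: (integrable_Rgt0_derive (M := 1) (is_derive_ratio_powR s) cf f0) => t t0.
  have t1 : 0 < 1 + t by rewrite addr_gt0.
  have powR1s : 1 `^ s = 1 :> R by rewrite powR1.
  rewrite powR_ge0/= -[leRHS]powR1s.
  rewrite ge0_ler_powR ?(ltW s0) ?nnegrE ?divr_ge0 ?(ltW t0) ?(ltW t1)//.
  by rewrite ler_pdivrMr// mul1r lerDr.
pose C := expR 1 * (s + 1) `^ (s + 1) / s.
have C0 : 0 <= C by rewrite divr_ge0 ?mulr_ge0 ?expR_ge0 ?powR_ge0// ltW.
have := integrableZl mRgt0 C int_f; apply: le_integrable => //.
  by apply/measurable_EFinP; exact: genGamma_kernel_measurable.
move=> t; rewrite Rgt0E => t0 /=; rewrite lee_fin.
rewrite (ger0_norm (genGamma_kernel_ge0 _ _ _)) genGamma_kernel0.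
rewrite (ger0_norm (mulr_ge0 C0 (f0 _ t0))).
have -> : C * f t = t `^ (s - 1) *
    (expR 1 * (s + 1) `^ (s + 1) * (1 + t) `^ (- (s + 1))).
  by rewrite /C /f; field; rewrite gt_eqF.
by rewrite ler_wpM2l ?powR_ge0// expRN_le_powR ?addr_gt0// ltW.
Qed.

Lemma genGamma_kernel_integrable s z : 0 < s ->
  mu.-integrable Rgt0 (EFin \o genGamma_kernel s z).
Proof.
move=> s0; apply: le_integrable (genGamma_kernel0_integrable s0).
- exact: measurable_itv.
- by apply/measurable_EFinP; exact: genGamma_kernel_measurable.
- move=> r; rewrite Rgt0E => r0 /=.
  by rewrite lee_fin !ger0_norm ?genGamma_kernel_ge0// genGamma_kernel_le.
Qed.

Lemma genGamma_ge0 s z : 0 <= genGamma s z.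
Proof. by apply: Rintegral_ge0 => x _; exact: genGamma_kernel_ge0. Qed.

Lemma genGamma0 s : genGamma s 0 = Gamma s.
Proof. by apply: eq_Rintegral => r _; exact: genGamma_kernel0. Qed.

Lemma EFin_genGamma s z : 0 < s ->
  (genGamma s z)%:E = (\int[mu]_(r in Rgt0) (genGamma_kernel s z r)%:E)%E.
Proof.
move=> s0; rewrite /genGamma EFin_Rintegral//.
exact: genGamma_kernel_integrable.
Qed.

Lemma genGamma_le_Gamma s z : 0 < s -> genGamma s z <= Gamma s.
Proof.
move=> s0; rewrite -genGamma0; apply: le_Rintegral.
- exact: measurable_itv.
- exact: genGamma_kernel_integrable.
- exact: genGamma_kernel_integrable.
- by move=> r; rewrite Rgt0E; exact: genGamma_kernel_le.
Qed.

Lemma Gamma_ge0 s : 0 <= Gamma s.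
Proof. by rewrite -genGamma0 genGamma_ge0. Qed.

Lemma Gamma_gt0 s : 0 < s -> 0 < Gamma s.
Proof.
move=> s0; rewrite lt_neqAle Gamma_ge0 andbT eq_sym; apply/eqP => G0.
have mk : measurable_fun Rgt0 (EFin \o genGamma_kernel s 0).
  by apply/measurable_EFinP; exact: genGamma_kernel_measurable.
have : (\int[mu]_(r in Rgt0) `|(EFin \o genGamma_kernel s 0) r| = 0)%E.
  rewrite -[RHS]/(0%:E) -[in RHS]G0 -genGamma0 EFin_genGamma//.
  by apply: eq_integral => r _ /=; rewrite ger0_norm// genGamma_kernel_ge0.
move/(ae_eq_integral_abs mu (measurable_itv _) mk) => [N [mN N0 subN]].
have : Rgt0 `<=` N.
  move=> r r0; apply: subN => /= /(_ r0) [] /eqP; apply/negP.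
  move: r0; rewrite Rgt0E => r0.
  by rewrite gt_eqF// !mulr_gt0 ?powR_gt0 ?expR_gt0.
move=> /(le_measure mu); rewrite !inE => /(_ (measurable_itv _) mN).
have muRgt0 : mu Rgt0 = +oo%E by rewrite lebesgue_measure_itv/= lt0y.
by rewrite [X in (_ <= X)%E]N0 [X in (X <= _)%E]muRgt0 leye_eq.
Qed.

Lemma mulr_genGamma_le s z : 0 < s -> `|z| * genGamma s z <= Gamma (s + 1).
Proof.
move=> s0; rewrite -genGamma0 -RintegralZl//; last exact: genGamma_kernel_integrable.
apply: le_Rintegral => //.
- exact: (integrableZl mRgt0 _ (genGamma_kernel_integrable _ s0)).
- by apply: genGamma_kernel_integrable; rewrite addr_gt0.
- by move=> r; rewrite Rgt0E; exact: mulr_genGamma_kernel_le.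
Qed.

Lemma genGamma_kernel_divl s z r : 0 < z -> 0 < r ->
  genGamma_kernel (- s) z (z / r) * (z / r ^+ 2) =
  z `^ (- s) * genGamma_kernel s z r.
Proof.
move=> z0 r0; rewrite /genGamma_kernel (gtr0_norm z0).
have -> : z / (z / r) = r by field; rewrite !gt_eqF.
rewrite [LHS](_ : _ = expR (- (z / r)) * expR (- r) *
  ((z / r) `^ (- s - 1) * (z / r ^+ 2))); last by ring.
rewrite [RHS](_ : _ = expR (- (z / r)) * expR (- r) *
  (z `^ (- s) * r `^ (s - 1))); last by ring.
congr (_ * _).
rewrite powRM ?invr_ge0 ?(ltW r0) ?(ltW z0)//.
rewrite -(powR_inv1 (ltW r0)) -powRrM.
rewrite (gt0_powRB _ _ z0) powRr1 ?(ltW z0)//.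
have -> : -1 * (- s - 1) = (s - 1) + 2%:R :> R by ring.
rewrite (gt0_powRD _ _ r0) powR_mulrn ?(ltW r0)//.
by field; rewrite !gt_eqF.
Qed.

Lemma integral_genGamma_kernelN s z : 0 < s -> 0 < z ->
  (\int[mu]_(r in Rgt0) (genGamma_kernel (- s) z r)%:E =
   (z `^ (- s) * genGamma s z)%:E)%E.
Proof.
move=> s0 z0; rewrite (@integral_Rgt0_divl _ z)//; last 2 first.
- by move=> x; exact: genGamma_kernel_continuous.
- by move=> x _; exact: genGamma_kernel_ge0.
rewrite EFinM EFin_genGamma// -ge0_integralZl.
- by apply: eq_integral => r; rewrite inE Rgt0E => r0; rewrite genGamma_kernel_divl.
- exact: measurable_itv.
- by apply/measurable_EFinP; exact: genGamma_kernel_measurable.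
- by move=> x _; rewrite lee_fin genGamma_kernel_ge0.
- by rewrite lee_fin powR_ge0.
Qed.

Lemma genGammaN s z : 0 < s -> 0 < z ->
  genGamma (- s) z = z `^ (- s) * genGamma s z.
Proof. by move=> s0 z0; rewrite /genGamma /Rintegral integral_genGamma_kernelN. Qed.

Lemma genGamma_continuous s : 0 < s -> continuous (genGamma s).
Proof.
move=> s0 a.
apply: (@continuity_under_integral R _ _ mu (genGamma_kernel s) Rgt0 _
  (a - 1) (a + 1) _ _ (genGamma_kernel s 0)).
- exact: measurable_itv.
- by move=> x _; exact: genGamma_kernel_integrable.
- apply: aeW => r; rewrite Rgt0E => r0 x _.
  apply: cvgM; first exact: cvg_cst.
  apply: (@continuous_comp _ _ _ (fun x : R => - (`|x| / r)) expR).
    apply: cvgN; apply: cvgM; last exact: cvg_cst.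
    exact: norm_continuous.
  exact: continuous_expR.
- exact: genGamma_kernel0_integrable.
- move=> x _; apply: aeW => r; rewrite Rgt0E => r0.
  by rewrite ger0_norm ?genGamma_kernel_ge0// genGamma_kernel_le.
- by rewrite inE/= in_itv/= ltrBlDr !ltrDl ltr01.
Qed.

Lemma genGamma_measurable s : 0 < s -> measurable_fun [set: R] (genGamma s).
Proof. by move=> s0; apply: continuous_measurable_fun; exact: genGamma_continuous. Qed.

Lemma is_derive_genGamma_kernel s z r : 0 < z -> 0 < r ->
  is_derive z 1 (fun z => genGamma_kernel s z r) (- genGamma_kernel (s - 1) z r).
Proof.
move=> z0 r0; pose f z := r `^ (s - 1) * expR (- r) * expR (- (z / r)).
have df : is_derive z 1 f (- genGamma_kernel (s - 1) z r).
  apply: is_derive_eq; rewrite genGamma_kernelB1// /genGamma_kernel (gtr0_norm z0).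
  by rewrite /GRing.scale/= !mulr0 ?addr0 ?add0r ?mulr1; ring.
apply: near_eq_is_derive df; near=> x.
have x0 : 0 < x by near: x; exact: lt_nbhsr.
by rewrite /genGamma_kernel gtr0_norm.
Unshelve. all: by end_near. Qed.

Lemma is_derive_genGamma s z : 0 < s -> 0 < z ->
  is_derive z 1 (genGamma s) (- genGamma (s - 1) z).
Proof.
move=> s0 z0; have gt0 x : z / 2 < x < z + 1 -> 0 < x.
  by move=> /andP[+ _]; apply: lt_trans; rewrite divr_gt0.
have -> : - genGamma (s - 1) z =
    \int[mu]_(r in Rgt0) (- genGamma_kernel (s - 1) z r).
  rewrite /genGamma /Rintegral; under [in RHS]eq_integral do rewrite EFinN.
  rewrite -fineN -integral_ge0N// => r _; first by rewrite lee_fin genGamma_kernel_ge0.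
apply: (is_derive_Rintegral mRgt0 (a := z / 2) (b := z + 1)
  (F' := fun x r => - genGamma_kernel (s - 1) x r)
  (g := fun r => 2 / z * genGamma_kernel s 0 r)).
- by rewrite ltrDl ltr01 ltr_pdivrMr// mulr_natr mulr2n ltrDl z0.
- by move=> x _; exact: genGamma_kernel_integrable.
- exact: (integrableZl mRgt0 _ (genGamma_kernel0_integrable s0)).
- move=> x r /gt0 x0; rewrite Rgt0E => r0; exact: is_derive_genGamma_kernel.
- move=> x r xz; rewrite Rgt0E => r0; have x0 := gt0 _ xz.
  rewrite normrN ger0_norm ?genGamma_kernel_ge0//.
  rewrite -[2 / z]invf_div mulrC ler_pdivlMr ?divr_gt0//.
  have := mulr_genGamma_kernel_le (s - 1) x r0; rewrite subrK gtr0_norm//.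
  apply: le_trans; rewrite mulrC ler_wpM2r ?genGamma_kernel_ge0//.
  by case/andP : xz => /ltW.
Qed.

(* Cauchy's mean value theorem, as (genGamma s)' = - genGamma (s - 1) and
   genGamma (s - 1) w = w `^ (s - 1) * genGamma (1 - s) w. *)
Lemma genGamma_MVT s z : 0 < s -> s < 1 -> 0 < z ->
  exists2 w, 0 < w < z &
    (genGamma s z - Gamma s) / z `^ s = - (genGamma (1 - s) w / s).
Proof.
move=> s0 s1 z0.
have cp : {within `[0, z], continuous (fun x => x `^ s)}.
  apply/continuous_within_itvP => //; split.
  - by move=> x; rewrite in_itv/= => /andP[x0 _]; exact: continuous_powR.
  - by rewrite powR0 ?gt_eqF//; exact: powR_cvg0.
  - by apply: cvg_at_left_filter; exact: continuous_powR.
have cg : {within `[0, z], continuous (genGamma s)}.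
  by apply: continuous_subspaceT => x; exact: genGamma_continuous.
have [||x|w] := @cauchy_MVT R (genGamma s) (fun x => - genGamma (s - 1) x)
   (fun x => x `^ s) (fun x => s * x `^ (s - 1)) 0 z z0 cg cp.
- by move=> x; rewrite in_itv/= => /andP[x0 _]; exact: is_derive_genGamma.
- by move=> x; rewrite in_itv/= => /andP[x0 _]; exact: is_derive1_powR.
- rewrite in_itv/= => /andP[x0 _].
  by rewrite mulf_neq0 ?gt_eqF// powR_gt0.
move=> /[!in_itv]/= /andP[w0 wz].
rewrite genGamma0 powR0 ?gt_eqF// subr0 => <-.
exists w; first by rewrite w0.
rewrite -[s - 1]opprB genGammaN ?subr_gt0//.
by field; rewrite !gt_eqF ?powR_gt0.
Qed.

Lemma integral_subordination_kernel s c l : 0 < s -> 0 <= c -> 0 <= l ->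
  (\int[mu]_(r in Rgt0) (expR (- (c / r * l)) * (expR (- r) / r `^ (1 - s)))%:E =
   (genGamma s (c * l))%:E)%E.
Proof.
move=> s0 c0 l0; rewrite EFin_genGamma//.
apply: eq_integral => r; rewrite inE Rgt0E => r0; congr (_%:E).
rewrite /genGamma_kernel ger0_norm ?mulr_ge0// -(opprB 1 s) powRN.
by rewrite (mulrAC c); ring.
Qed.

Lemma integral_poisson_kernel s c l : 0 < s -> 0 < c -> 0 <= l ->
  (\int[mu]_(t in Rgt0) (expR (- (t * l)) * (expR (- (c / t)) / t `^ (1 + s)))%:E =
   (c `^ (- s) * genGamma s (c * l))%:E)%E.
Proof.
move=> s0 c0 l0; rewrite EFinM EFin_genGamma//.
have ckernel x := @genGamma_kernel_continuous s (c * l) x.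
have kernel_ge0 x : 0 < x -> 0 <= genGamma_kernel s (c * l) x.
  by move=> _; exact: genGamma_kernel_ge0.
rewrite (integral_Rgt0_divl c0 ckernel kernel_ge0) -ge0_integralZl.
- apply: eq_integral => t; rewrite inE Rgt0E => t0; rewrite -EFinM; congr (_%:E).
  rewrite /genGamma_kernel ger0_norm ?mulr_ge0 ?(ltW c0)//.
  have -> : c * l / (c / t) = t * l by field; rewrite !gt_eqF.
  rewrite powRM ?invr_ge0 ?(ltW c0) ?(ltW t0)// -(powR_inv1 (ltW t0)) -powRrM.
  have -> : -1 * (s - 1) = (2%:R - (1 + s)) :> R by ring.
  rewrite (gt0_powRB _ _ c0) (gt0_powRB _ _ t0).
  rewrite powRN powRr1 ?(ltW c0)// powR_mulrn ?(ltW t0)//.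
  rewrite (powR_inv1 (ltW t0)).
  by field; rewrite !gt_eqF ?powR_gt0.
- exact: measurable_itv.
- apply/measurable_EFinP; apply: continuous_measurable_Rgt0.
  exact: (continuous_comp_divl c0 ckernel).
- move=> x; rewrite Rgt0E => x0.
  by rewrite lee_fin mulr_ge0 ?genGamma_kernel_ge0 ?divr_ge0 ?sqr_ge0// ltW.
- by rewrite lee_fin powR_ge0.
Qed.

Lemma integral_heat_kernel_powR s c l : 0 < s -> 0 <= c -> 0 < l ->
  (\int[mu]_(t in Rgt0)
      (expR (- (t * l)) * l `^ s * (expR (- (c / t)) / t `^ (1 - s)))%:E =
   (genGamma s (c * l))%:E)%E.
Proof.
move=> s0 c0 l0; rewrite EFin_genGamma//.
rewrite [RHS](@integral_Rgt0_scale _ l)//; last 2 first.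
- by move=> x; exact: genGamma_kernel_continuous.
- by move=> x _; exact: genGamma_kernel_ge0.
apply: eq_integral => t; rewrite inE Rgt0E => t0; congr (_%:E).
rewrite /genGamma_kernel ger0_norm ?mulr_ge0 ?(ltW l0)//.
have -> : c * l / (l * t) = c / t by field; rewrite !gt_eqF.
rewrite powRM ?(ltW t0) ?(ltW l0)// -[t `^ (s - 1)]invrK -powRN opprB.
rewrite (gt0_powRB _ _ l0) powRr1 ?(ltW l0)// (mulrC l t).
by field; rewrite !gt_eqF ?powR_gt0.
Qed.

End genGamma.

(** * The kernel of the extension problem *)

Section extension_kernel.
Context {R : realType}.
Local Notation Rge0 := (`[0%R, +oo[%classic : set R).
Variable s : R.
Hypotheses (s0 : 0 < s) (s1 : s < 1).
Implicit Types x y l z : R.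

Let Gamma_pos : 0 < Gamma s. Proof. exact: Gamma_gt0. Qed.
Let Gamma_neq0 : Gamma s != 0. Proof. by rewrite gt_eqF. Qed.
Let sC0 : 0 < 1 - s. Proof. by rewrite subr_gt0. Qed.

Definition ext_arg y l : R := y ^+ 2 / 4 * l.

Definition ext_kernel y l : R := genGamma s (ext_arg y l) / Gamma s.

Definition ext_flux y l : R :=
  ext_arg y l `^ s * genGamma (1 - s) (ext_arg y l) / Gamma s.

Definition ext_kernel_dy y l : R := - (2 / y) * ext_flux y l.

Definition ext_kernel_dyy y l : R :=
  l * ext_kernel y l - (1 - 2 * s) / y * ext_kernel_dy y l.

Definition ext_const : R := Gamma_opp s / (4 `^ s * Gamma s).

Lemma ext_arg_ge0 y l : 0 <= l -> 0 <= ext_arg y l.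
Proof. by move=> l0; rewrite mulr_ge0// divr_ge0// sqr_ge0. Qed.

Lemma ext_arg_gt0 y l : 0 < y -> 0 < l -> 0 < ext_arg y l.
Proof. by move=> y0 l0; rewrite mulr_gt0// divr_gt0// exprn_gt0. Qed.

Lemma powR_ext_arg y l : 0 < y -> 0 <= l ->
  ext_arg y l `^ s = y `^ (2 * s) * l `^ s / 4 `^ s.
Proof.
move=> y0 l0; rewrite (powRM s (x := y ^+ 2 / 4)) ?divr_ge0 ?sqr_ge0//.
rewrite (powRM s (x := y ^+ 2)) ?sqr_ge0 ?invr_ge0//.
rewrite powRrM (powR_mulrn 2 (ltW y0)) -(powR_inv1 (a := 4))// -powRrM mulN1r powRN.
by rewrite mulrAC.
Qed.

Lemma is_derive_ext_arg y l : is_derive y 1 (ext_arg ^~ l) (y / 2 * l).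
Proof.
apply: is_derive_eq; rewrite /GRing.scale/= !mulr0 !add0r !mulr1 ?scaler0.
by rewrite ?expr1 ?mulr2n; field.
Qed.

Lemma ext_arg_dyE y l : 0 < y -> y / 2 * l = 2 / y * ext_arg y l.
Proof. by move=> y0; rewrite /ext_arg; field; rewrite gt_eqF. Qed.

Lemma genGamma_ext_arg_measurable r y : 0 < r ->
  measurable_fun Rge0 (fun l => genGamma r (ext_arg y l)).
Proof.
move=> r0; apply: measurableT_comp; first exact: genGamma_measurable.
exact: measurable_funM.
Qed.

Lemma ext_kernel_ge0 y l : 0 <= ext_kernel y l.
Proof. by rewrite divr_ge0 ?genGamma_ge0// ltW. Qed.

Lemma ext_kernel_le1 y l : `|ext_kernel y l| <= 1.
Proof.
by rewrite ger0_norm ?ext_kernel_ge0// ler_pdivrMr// mul1r genGamma_le_Gamma.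
Qed.

Lemma ext_kernel0l l : ext_kernel 0 l = 1.
Proof. by rewrite /ext_kernel /ext_arg expr0n/= !mul0r genGamma0 divff. Qed.

Lemma ext_kernel0r y : ext_kernel y 0 = 1.
Proof. by rewrite /ext_kernel /ext_arg mulr0 genGamma0 divff. Qed.

Lemma ext_kernel_measurable y : measurable_fun Rge0 (ext_kernel y).
Proof. by apply: measurable_funM => //; exact: genGamma_ext_arg_measurable. Qed.

Lemma mul_ext_kernel_le y l : 0 < y -> 0 <= l ->
  `|l * ext_kernel y l| <= 4 / y ^+ 2 * (Gamma (s + 1) / Gamma s).
Proof.
move=> y0 l0; rewrite (ger0_norm (mulr_ge0 l0 (ext_kernel_ge0 y l))).
have := mulr_genGamma_le (ext_arg y l) s0; rewrite (ger0_norm (ext_arg_ge0 y l0)) => arg_le.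
have -> : l * ext_kernel y l =
    4 / y ^+ 2 * (ext_arg y l * genGamma s (ext_arg y l) / Gamma s).
  by rewrite /ext_kernel {2}/ext_arg; field; rewrite Gamma_neq0 gt_eqF.
by rewrite ler_wpM2l ?divr_ge0 ?sqr_ge0// ler_wpM2r ?invr_ge0 ?(ltW Gamma_pos).
Qed.

Lemma ext_flux_ge0 y l : 0 <= ext_flux y l.
Proof. by rewrite divr_ge0 ?mulr_ge0 ?powR_ge0 ?genGamma_ge0// ltW. Qed.

Lemma ext_flux0r y : ext_flux y 0 = 0.
Proof. by rewrite /ext_flux /ext_arg mulr0 powR0 ?gt_eqF// !mul0r. Qed.

Definition ext_flux_bound : R := (Gamma (1 - s) + Gamma (2 - s)) / Gamma s.

Lemma ext_flux_bound_ge0 : 0 <= ext_flux_bound.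
Proof. by rewrite divr_ge0 ?addr_ge0 ?Gamma_ge0// ltW. Qed.

Lemma ext_flux_le y l : 0 <= l -> `|ext_flux y l| <= ext_flux_bound.
Proof.
move=> l0; rewrite ger0_norm ?ext_flux_ge0// ler_pM2r ?invr_gt0//.
have := ext_arg_ge0 y l0; set z := ext_arg y l => z0.
have [z1|z1] := leP z 1.
  have powR1s : 1 `^ s = 1 :> R by rewrite powR1.
  have zs : z `^ s <= 1 by rewrite -powR1s ge0_ler_powR ?nnegrE// ltW.
  apply: (@le_trans _ _ (Gamma (1 - s))); last by rewrite lerDl Gamma_ge0.
  by apply: le_trans (genGamma_le_Gamma z sC0); rewrite ler_piMl ?genGamma_ge0.
apply: (@le_trans _ _ (Gamma (2 - s))); last by rewrite lerDr Gamma_ge0.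
have := mulr_genGamma_le z sC0; rewrite (ger0_norm z0) addrAC.
apply: le_trans; rewrite ler_wpM2r ?genGamma_ge0// -{2}(powRr1 z0).
by rewrite ler_powR ?ltW.
Qed.

Lemma ext_flux_measurable y : measurable_fun Rge0 (ext_flux y).
Proof.
apply: measurable_funM => //; apply: measurable_funM; last exact: genGamma_ext_arg_measurable.
apply: (measurableT_comp (f := fun x => x `^ s)); first exact: measurable_powR.
exact: measurable_funM.
Qed.

Lemma ext_kernel_dy_le y l : 0 < y -> 0 <= l ->
  `|ext_kernel_dy y l| <= 2 / y * ext_flux_bound.
Proof.
move=> y0 l0; have y2 : 0 <= 2 / y by rewrite divr_ge0// ltW.
by rewrite normrM normrN (ger0_norm y2) ler_wpM2l// ext_flux_le.
Qed.

Lemma ext_kernel_dy_measurable y : measurable_fun Rge0 (ext_kernel_dy y).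
Proof. by apply: measurable_funM => //; exact: ext_flux_measurable. Qed.

Definition ext_kernel_dyy_bound : R := Gamma (s + 1) / Gamma s + ext_flux_bound.

Lemma ext_kernel_dyy_bound_ge0 : 0 <= ext_kernel_dyy_bound.
Proof. by rewrite addr_ge0 ?ext_flux_bound_ge0// divr_ge0 ?Gamma_ge0// ltW. Qed.

Lemma ext_kernel_dyy_le y l : 0 < y -> 0 <= l ->
  `|ext_kernel_dyy y l| <= 4 / y ^+ 2 * ext_kernel_dyy_bound.
Proof.
move=> y0 l0; apply: le_trans (ler_normB _ _) _.
rewrite mulrDr; apply: lerD; first exact: mul_ext_kernel_le.
have coef_le : `|1 - 2 * s| <= 2.
  by have := s0; have := s1; rewrite ler_norml => *; apply/andP; split; lra.
rewrite normrM (_ : 4 / y ^+ 2 * ext_flux_bound =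
  2 / y * (2 / y * ext_flux_bound)); last by field; rewrite gt_eqF.
apply: ler_pM => //; last exact: ext_kernel_dy_le.
by rewrite normrM (gtr0_norm (x := y^-1)) ?invr_gt0// ler_wpM2r// invr_ge0 ltW.
Qed.

Lemma ext_kernel_dyy_measurable y : measurable_fun Rge0 (ext_kernel_dyy y).
Proof.
apply: measurable_funB; apply: measurable_funM => //.
- exact: ext_kernel_measurable.
- exact: ext_kernel_dy_measurable.
Qed.

Lemma is_derive_ext_kernel y l : 0 < y -> 0 <= l ->
  is_derive y 1 (ext_kernel ^~ l) (ext_kernel_dy y l).
Proof.
move=> y0; rewrite le_eqVlt => /predU1P[<-|l0].
  rewrite /ext_kernel_dy ext_flux0r mulr0.
  have -> : ext_kernel^~ 0 = cst 1 by apply/funext => x; exact: ext_kernel0r.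
  exact: is_derive_cst.
have z0 := ext_arg_gt0 y0 l0.
have dgenGamma := @is_derive1_comp R (genGamma s) (ext_arg ^~ l) y _ _
   (is_derive_genGamma s0 z0) (is_derive_ext_arg y l).
have dkernel := is_deriveM dgenGamma (is_derive_cst (Gamma s)^-1 y (1 : R)).
apply: (@is_derive_eq _ _ _ _ _ _ _ _ dkernel).
rewrite scaler0 add0r /ext_kernel_dy /ext_flux /GRing.scale/=.
rewrite -[s - 1]opprB genGammaN// opprB -(mulr_powRB1 (ltW z0) s0) ext_arg_dyE//.
by ring.
Qed.

Lemma is_derive_ext_flux y l : 0 < y -> 0 < l ->
  is_derive y 1 (ext_flux ^~ l)
    (2 * s / y * ext_flux y l - y / 2 * (l * ext_kernel y l)).
Proof.
move=> y0 l0; have z0 := ext_arg_gt0 y0 l0.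
have dgenGamma := @is_derive1_comp R (genGamma (1 - s)) (ext_arg ^~ l) y _ _
   (is_derive_genGamma sC0 z0) (is_derive_ext_arg y l).
have dpowR := @is_derive1_comp R (fun z => z `^ s) (ext_arg ^~ l) y _ _
   (is_derive1_powR s z0) (is_derive_ext_arg y l).
have dflux := is_deriveM (is_deriveM dpowR dgenGamma) (is_derive_cst (Gamma s)^-1 y (1 : R)).
apply: (@is_derive_eq _ _ _ _ _ _ _ _ dflux).
rewrite scaler0 add0r /ext_flux /ext_kernel /GRing.scale/=.
rewrite (_ : 1 - s - 1 = - s); last by ring.
rewrite genGammaN// powRN -(mulr_powRB1 (ltW z0) s0).
have p0 : ext_arg y l `^ (s - 1) != 0 by rewrite gt_eqF// powR_gt0.
rewrite mulrA ext_arg_dyE//.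
by field; rewrite Gamma_neq0 p0 !gt_eqF.
Qed.

Lemma is_derive_ext_kernel_dy y l : 0 < y -> 0 <= l ->
  is_derive y 1 (ext_kernel_dy ^~ l) (ext_kernel_dyy y l).
Proof.
move=> y0; rewrite le_eqVlt => /predU1P[<-|l0].
  rewrite /ext_kernel_dyy /ext_kernel_dy ext_flux0r mulr0 mulr0 mul0r subr0.
  rewrite (_ : (fun x => _) = cst 0); first exact: is_derive_cst.
  by apply/funext => x; rewrite ext_flux0r mulr0.
have dV : is_derive y 1 (fun y : R => y^-1) (- y ^- 2 *: 1).
  by apply: (is_deriveV _ (is_derive_id y 1)); rewrite gt_eqF.
have ddivl := is_deriveM (is_derive_cst (-2 : R) y (1 : R)) dV.
have dkernel := is_deriveM ddivl (is_derive_ext_flux y0 l0).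
rewrite (_ : ext_kernel_dy ^~ l = cst (-2) * (fun y => y^-1) * ext_flux ^~ l).
  apply: (@is_derive_eq _ _ _ _ _ _ _ _ dkernel).
  rewrite scaler0 addr0 /ext_kernel_dyy /ext_kernel_dy /GRing.scale/=.
  rewrite -[(cst (-2) * _) y]/(-2 / y).
  by field; rewrite gt_eqF.
by apply/funext => x; rewrite /ext_kernel_dy !fctE/=; ring.
Qed.

Lemma cvg_ext_arg l : ext_arg y l @[y --> (0 : R)] --> (0 : R).
Proof.
have ext_arg0 : ext_arg 0 l = 0 by rewrite /ext_arg expr0n/= !mul0r.
rewrite -[X in _ --> X]ext_arg0.
exact: is_derive1_continuous (is_derive_ext_arg 0 l).
Qed.

Lemma cvg_genGamma_ext_arg r l : 0 < r ->
  genGamma r (ext_arg y l) @[y --> (0 : R)^'+] --> Gamma r.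
Proof.
move=> r0; rewrite -genGamma0; apply: cvg_at_right_filter.
exact: (cvg_comp _ _ (cvg_ext_arg l) (@genGamma_continuous R r r0 0)).
Qed.

Lemma cvg_ext_kernel l : ext_kernel y l @[y --> 0^'+] --> (1 : R).
Proof.
rewrite -(divff Gamma_neq0); apply: cvgM; last exact: cvg_cst.
exact: cvg_genGamma_ext_arg.
Qed.

Lemma ext_kernel_MVT y l : 0 < y -> 0 < l -> exists2 w, 0 < w < ext_arg y l &
  (ext_kernel y l - 1) / y `^ (2 * s) =
  - (genGamma (1 - s) w / s) * (l `^ s / (4 `^ s * Gamma s)).
Proof.
move=> y0 l0; have [w w_itv quotientE] := genGamma_MVT s0 s1 (ext_arg_gt0 y0 l0).
exists w => //; rewrite -quotientE powR_ext_arg// ?ltW// /ext_kernel; field.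
by rewrite Gamma_neq0 !gt_eqF// powR_gt0.
Qed.

Lemma ext_kernel_quotient_le y l : 0 < y -> 0 <= l ->
  `|(ext_kernel y l - 1) / y `^ (2 * s)| <=
  Gamma (1 - s) / s / (4 `^ s * Gamma s) * l `^ s.
Proof.
move=> y0; rewrite le_eqVlt => /predU1P[<-|l0].
  by rewrite ext_kernel0r subrr mul0r normr0 powR0 ?gt_eqF// mulr0.
have [w _ ->] := ext_kernel_MVT y0 l0.
have c0 : 0 <= l `^ s / (4 `^ s * Gamma s).
  by rewrite divr_ge0 ?mulr_ge0 ?powR_ge0// ltW.
rewrite normrM normrN (ger0_norm c0) ger0_norm ?divr_ge0 ?genGamma_ge0 ?(ltW s0)//.
rewrite [leRHS](_ : _ = Gamma (1 - s) / s * (l `^ s / (4 `^ s * Gamma s))); last by ring.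
have sV_ge0 : 0 <= s^-1 by rewrite invr_ge0 ltW.
exact: (ler_wpM2r c0 (ler_wpM2r sV_ge0 (genGamma_le_Gamma w sC0))).
Qed.

(* The intermediate point given by the mean value theorem tends to 0. *)
Lemma cvg_ext_kernel_quotient l : 0 <= l ->
  (ext_kernel y l - 1) / y `^ (2 * s) @[y --> 0^'+] --> ext_const * l `^ s.
Proof.
rewrite le_eqVlt => /predU1P[<-|l0].
  rewrite powR0 ?gt_eqF// mulr0.
  rewrite (_ : (fun y => _) = cst 0); first exact: cvg_cst.
  by apply/funext => y; rewrite ext_kernel0r subrr mul0r.
set c := l `^ s / (4 `^ s * Gamma s).
have c0 : 0 < c / s by rewrite !divr_gt0 ?mulr_gt0 ?powR_gt0.
have -> : ext_const * l `^ s = - (Gamma (1 - s) * (c / s)).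
  rewrite /ext_const /Gamma_opp /c; field.
  by rewrite Gamma_neq0 !gt_eqF ?powR_gt0.
apply/cvgrPdist_le => e e0.
have /cvgrPdist_le/(_ _ (divr_gt0 e0 c0))[r /= r0 near_Gamma] :=
  @genGamma_continuous R _ sC0 0.
have /cvgr0_norm_lt/(_ _ r0) small_arg := cvg_ext_arg l.
near=> y.
have y0 : 0 < y by near: y; exact: nbhs_right_gt.
have [w /andP[w0 wz] ->] := ext_kernel_MVT y0 l0.
have zr : `|ext_arg y l| < r by near: y; apply: cvg_at_right_filter small_arg; exact: cvg_id.
have : `|Gamma (1 - s) - genGamma (1 - s) w| <= e / (c / s).
  rewrite -genGamma0; apply: near_Gamma => /=.
  rewrite sub0r normrN (gtr0_norm w0) (lt_trans wz)//.
  exact: le_lt_trans (ler_norm _) zr.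
rewrite ler_pdivlMr// -/c => small; rewrite -normrN.
rewrite [X in `|X|](_ : _ = (Gamma (1 - s) - genGamma (1 - s) w) * (c / s)); last by ring.
by rewrite normrM (gtr0_norm c0).
Unshelve. all: by end_near. Qed.

Lemma powR_ext_kernel_dy y l : 0 < y -> 0 <= l ->
  y `^ (1 - 2 * s) * ext_kernel_dy y l =
  - (2 / (4 `^ s * Gamma s)) * l `^ s * genGamma (1 - s) (ext_arg y l).
Proof.
move=> y0 l0; rewrite /ext_kernel_dy /ext_flux powR_ext_arg// gt0_powRB//.
rewrite powRr1 ?ltW//.
by field; rewrite Gamma_neq0 !gt_eqF// powR_gt0.
Qed.

Lemma powR_ext_kernel_dy_le y l : 0 < y -> 0 <= l ->
  `|y `^ (1 - 2 * s) * ext_kernel_dy y l| <=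
  2 / (4 `^ s * Gamma s) * Gamma (1 - s) * l `^ s.
Proof.
move=> y0 l0; rewrite powR_ext_kernel_dy//.
have c0 : 0 <= 2 / (4 `^ s * Gamma s).
  by rewrite divr_ge0 ?mulr_ge0 ?powR_ge0// ltW.
rewrite 2!normrM normrN (ger0_norm c0) !ger0_norm ?genGamma_ge0 ?powR_ge0//.
rewrite mulrAC ler_wpM2r ?powR_ge0// ler_wpM2l//.
exact: genGamma_le_Gamma.
Qed.

Lemma cvg_powR_ext_kernel_dy l : 0 <= l ->
  y `^ (1 - 2 * s) * ext_kernel_dy y l @[y --> 0^'+] -->
  2 * s * ext_const * l `^ s.
Proof.
move=> l0; set c := - (2 / (4 `^ s * Gamma s)) * l `^ s.
have -> : 2 * s * ext_const * l `^ s = c * Gamma (1 - s).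
  rewrite /ext_const /Gamma_opp /c; field.
  by rewrite Gamma_neq0 !gt_eqF ?powR_gt0.
have : c * genGamma (1 - s) (ext_arg y l) @[y --> 0^'+] --> c * Gamma (1 - s).
  by apply: cvgM; [exact: cvg_cst|exact: cvg_genGamma_ext_arg].
apply: cvg_trans; apply: near_eq_cvg; near=> y.
by rewrite powR_ext_kernel_dy//; near: y; exact: nbhs_right_gt.
Unshelve. all: by end_near. Qed.

End extension_kernel.

(** * The complex L2 space as a real Hilbert space *)

Section complex_dot.
Context {R : realType}.
Implicit Types (a b c : R[i]) (t : R).

Definition cdot a b : R :=
  complex.Re a * complex.Re b + complex.Im a * complex.Im b.

Lemma Re_mulCJ a b : complex.Re (a * b^*) = cdot a b.
Proof. by case: a => p q; case: b => r s; rewrite /cdot/=; ring. Qed.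

Lemma Im_mulCJ a b : complex.Im (a * b^*) = cdot a ((0 +i* 1) * b).
Proof. by case: a => p q; case: b => r s; rewrite /cdot/=; ring. Qed.

Lemma cdotC a b : cdot a b = cdot b a.
Proof. by rewrite /cdot; ring. Qed.

Lemma cdot_lin t a b c : cdot (t%:C * a + b) c = t * cdot a c + cdot b c.
Proof. by case: a => p q; case: b => r s; case: c => u v; rewrite /cdot/=; ring. Qed.

Lemma cdot_ge0 a : 0 <= cdot a a.
Proof. by rewrite /cdot -!expr2 addr_ge0 ?sqr_ge0. Qed.

Lemma cdot_eq0 a : cdot a a = 0 -> a = 0.
Proof.
case: a => p q; rewrite /cdot/= -!expr2 => /eqP.
by rewrite paddr_eq0 ?sqr_ge0// !sqrf_eq0 => /andP[/eqP -> /eqP ->].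
Qed.

Lemma norm_cdot_le a b : `|cdot a b| <= cdot a a + cdot b b.
Proof.
case: a => p q; case: b => r s; rewrite /cdot/=.
have := sqr_ge0 (p + r); have := sqr_ge0 (q + s).
have := sqr_ge0 (p - r); have := sqr_ge0 (q - s).
by rewrite ler_norml !expr2 => *; apply/andP; split; nra.
Qed.

Lemma cdot_lin_le a b c : cdot (a * b + c) (a * b + c) <=
  2 * cdot a a * cdot b b + 2 * cdot c c.
Proof.
case: a => p q; case: b => r s; case: c => u v; rewrite /cdot/=.
rewrite -subr_ge0 [leRHS](_ : _ = (p * r - q * s - u) ^+ 2 + (p * s + q * r - v) ^+ 2).
  by rewrite addr_ge0 ?sqr_ge0.
by ring.
Qed.

End complex_dot.

Section geometric_cauchy.
Context {R : realType}.

Lemma geometric_cauchy_cvg (a : nat -> R) (c : R) :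
  (forall n, `|a n.+1 - a n| <= c * 2^-1 ^+ n) ->
  a @ \oo --> limn a /\ forall n, `|a n - limn a| <= 2 * c * 2^-1 ^+ n.
Proof.
move=> step; have c0 : 0 <= c.
  by have := le_trans (normr_ge0 _) (step 0%N); rewrite expr0 mulr1.
have far n k : `|a (n + k)%N - a n| <= 2 * c * (2^-1 ^+ n - 2^-1 ^+ (n + k)).
  elim: k => [|k IHk]; first by rewrite addn0 !subrr normr0 mulr0.
  have -> : a (n + k.+1)%N - a n =
      (a (n + k).+1 - a (n + k)%N) + (a (n + k)%N - a n) by rewrite addnS; ring.
  apply: le_trans (ler_normD _ _) (le_trans (lerD (step _) IHk) _).
  by rewrite addnS (exprS _ (n + k)); lra.
have ca : cvgn a.
  have -> : a = (fun n => a 0%N + series (telescope a) n).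
    by apply/funext => n; rewrite -eq_sum_telescope.
  apply: is_cvgD; first exact: is_cvg_cst.
  apply: normed_cvg; apply: (@series_le_cvg _ _ (geometric c 2^-1)) => //.
  - by move=> n /=.
  - by move=> n; rewrite /geometric/= mulr_ge0 ?exprn_ge0.
  - by apply: is_cvg_geometric_series; rewrite ger0_norm; lra.
split=> // n; rewrite distrC.
have lim_far : `|a m - a n| @[m --> \oo] --> `|limn a - a n|.
  by apply: cvg_norm; apply: cvgB; [exact: ca|exact: cvg_cst].
apply: (ler_cvg_to lim_far (cvg_cst _)); near=> m.
have /subnKC <- : (n <= m)%N by near: m; exact: nbhs_infty_ge.
apply: le_trans (far _ _) _; rewrite ler_wpM2l ?mulr_ge0//.
by rewrite gerBl exprn_ge0.
Unshelve. all: by end_near. Qed.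

End geometric_cauchy.

Section L2_space.
Context {d : measure_display} {T : measurableType d} {R : realType}.
Variables (eta : {measure set T -> \bar R}) (Omega : set T).
Hypothesis mO : measurable Omega.
Implicit Types (f g h : T -> R[i]).
Local Notation L2 := (L2 eta Omega).

Definition rinner f g : R := \int[eta]_(x in Omega) cdot (f x) (g x).

Definition mulI f : T -> R[i] := fun x => (0 +i* 1) * f x.

Lemma innerE f g : inner eta Omega f g = rinner f g +i* rinner f (mulI g).
Proof.
rewrite /inner; congr (_ +i* _); apply: eq_Rintegral => x _.
  by rewrite Re_mulCJ.
by rewrite Im_mulCJ.
Qed.

Lemma Re_inner f g : complex.Re (inner eta Omega f g) = rinner f g.
Proof. by rewrite innerE. Qed.

Lemma Im_inner f g : complex.Im (inner eta Omega f g) = rinner f (mulI g).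
Proof. by rewrite innerE. Qed.

Lemma L2P f : L2 f <->
  [/\ measurable_fun Omega (fun x => complex.Re (f x)),
      measurable_fun Omega (fun x => complex.Im (f x)) &
      eta.-integrable Omega (EFin \o (fun x => cdot (f x) (f x)))].
Proof.
split=> -[mRe mIm f_int]; split => //.
  apply/integrableP; split.
    by apply/measurable_EFinP; apply: measurable_funD; apply: measurable_funM.
  apply: le_lt_trans f_int; rewrite le_eqVlt; apply/orP; left; apply/eqP.
  by apply: eq_integral => x _ /=; rewrite ger0_norm ?cdot_ge0// /cdot -!expr2.
move/integrableP : f_int => [_]; apply: le_lt_trans.
rewrite le_eqVlt; apply/orP; left; apply/eqP.
by apply: eq_integral => x _ /=; rewrite ger0_norm ?cdot_ge0// /cdot -!expr2.
Qed.

Lemma cdot_measurable f g : L2 f -> L2 g ->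
  measurable_fun Omega (fun x => cdot (f x) (g x)).
Proof.
by move=> [mReF mImF _] [mReG mImG _]; apply: measurable_funD; apply: measurable_funM.
Qed.

Lemma cdot_integrable f g : L2 f -> L2 g ->
  eta.-integrable Omega (EFin \o (fun x => cdot (f x) (g x))).
Proof.
move=> Lf Lg; have /L2P[_ _ int_f] := Lf; have /L2P[_ _ int_g] := Lg.
apply: le_integrable (integrableD mO int_f int_g) => //.
  by apply/measurable_EFinP; exact: cdot_measurable.
move=> x _ /=; rewrite lee_fin [leRHS]ger0_norm; last by apply: addr_ge0; exact: cdot_ge0.
exact: norm_cdot_le.
Qed.

Lemma EFin_rinner f : L2 f -> (rinner f f)%:E = L2norm2 eta Omega f.
Proof.
move=> Lf; by rewrite /rinner EFin_Rintegral//; exact: cdot_integrable.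
Qed.

Lemma L2_lin (a : R[i]) f g : L2 f -> L2 g -> L2 (fun x => a * f x + g x).
Proof.
move=> Lf Lg; have [mReF mImF _] := Lf; have [mReG mImG _] := Lg.
have mRe : measurable_fun Omega (fun x => complex.Re (a * f x + g x)).
  rewrite (_ : (fun x => _) = fun x =>
    complex.Re a * complex.Re (f x) - complex.Im a * complex.Im (f x) + complex.Re (g x)).
    by apply: measurable_funD => //; apply: measurable_funB; apply: measurable_funM.
  by apply/funext => x; move: (a) (f x) (g x) => [? ?] [? ?] [? ?].
have mIm : measurable_fun Omega (fun x => complex.Im (a * f x + g x)).
  rewrite (_ : (fun x => _) = fun x =>
    complex.Re a * complex.Im (f x) + complex.Im a * complex.Re (f x) + complex.Im (g x)).
    by apply: measurable_funD => //; apply: measurable_funD; apply: measurable_funM.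
  by apply/funext => x; move: (a) (f x) (g x) => [? ?] [? ?] [? ?].
apply/L2P; split => //.
have int_f := integrableZl mO (2 * cdot a a) (cdot_integrable Lf Lf).
have int_g := integrableZl mO 2 (cdot_integrable Lg Lg).
apply: le_integrable (integrableD mO int_f int_g) => //.
  by apply/measurable_EFinP; apply: measurable_funD; apply: measurable_funM.
move=> x _ /=; rewrite lee_fin [leRHS]ger0_norm; last first.
  by rewrite addr_ge0// mulr_ge0 ?mulr_ge0 ?cdot_ge0.
by rewrite ger0_norm ?cdot_ge0// cdot_lin_le.
Qed.

Lemma L2_0 : L2 (fun=> 0).
Proof.
split; [exact: measurable_cst|exact: measurable_cst|].
rewrite /L2norm2 (_ : (\int[eta]_(x in Omega) _)%E = 0%E) ?ltry//.
by apply: integral0_eq => x _ /=; rewrite expr0n addr0.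
Qed.

Lemma L2_Z (a : R[i]) f : L2 f -> L2 (fun x => a * f x).
Proof.
move=> Lf; have := L2_lin a Lf L2_0.
by rewrite (_ : (fun x => _) = (fun x => a * f x))//; apply/funext => x; rewrite addr0.
Qed.

Lemma L2_mulI f : L2 f -> L2 (mulI f). Proof. exact: L2_Z. Qed.

Lemma rinnerC f g : rinner f g = rinner g f.
Proof. by apply: eq_Rintegral => x _; rewrite cdotC. Qed.

Lemma rinner_linl (t : R) f g h : L2 f -> L2 g -> L2 h ->
  rinner (fun x => t%:C * f x + g x) h = t * rinner f h + rinner g h.
Proof.
move=> Lf Lg Lh; rewrite /rinner -RintegralZl//; last exact: cdot_integrable.
rewrite -RintegralD//.
- by apply: eq_Rintegral => x _; rewrite cdot_lin.
- exact: (integrableZl mO t (cdot_integrable Lf Lh)).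
- exact: cdot_integrable.
Qed.

Lemma rinner0l g : rinner (fun=> 0) g = 0.
Proof.
rewrite /rinner (eq_Rintegral _ _ (g := cst 0)).
  by rewrite /Rintegral integral0.
by move=> x _; rewrite /cdot/= !mul0r addr0.
Qed.

Lemma rinner_ael f f' g : L2 f -> L2 f' -> L2 g -> f = f' %[ae eta in Omega] ->
  rinner f g = rinner f' g.
Proof.
move=> Lf Lf' Lg ff'; congr fine; apply: ae_eq_integral => //.
- by apply/measurable_EFinP; exact: cdot_measurable.
- by apply/measurable_EFinP; exact: cdot_measurable.
- by apply: filterS ff' => x fx Ox; rewrite fx.
Qed.

Lemma rinner_ge0 f : 0 <= rinner f f.
Proof. by apply: Rintegral_ge0 => x _; exact: cdot_ge0. Qed.

Lemma rinner_CS f g : L2 f -> L2 g ->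
  rinner f g ^+ 2 <= rinner f f * rinner g g.
Proof.
move=> Lf Lg; set a := rinner f f; set b := rinner f g; set c := rinner g g.
have quadratic_ge0 t : 0 <= a * t ^+ 2 + 2 * b * t + c.
  have := rinner_ge0 (fun x => t%:C * f x + g x).
  have Lfg : L2 (fun x => t%:C * f x + g x) by exact: L2_lin.
  rewrite rinner_linl// (rinnerC f) (rinnerC g) !rinner_linl// (rinnerC g f).
  by rewrite -/a -/b -/c => ge0; lra.
pose p := Poly [:: c; 2 * b; a].
have : p`_1 ^+ 2 - 4 * p`_2 * p`_0 <= 0.
  apply: deg_le2_poly_ge0; first exact: size_Poly.
  by move=> t; rewrite horner_Poly/= mul0r add0r mulrDl -mulrA -expr2.
by rewrite !coef_Poly/= exprMn; lra.
Qed.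

Lemma rinner_eq0 f : L2 f -> rinner f f = 0 -> f = (fun=> 0) %[ae eta in Omega].
Proof.
move=> Lf f0.
have mf : measurable_fun Omega (EFin \o (fun x => cdot (f x) (f x))).
  by apply/measurable_EFinP; exact: cdot_measurable.
have : (\int[eta]_(x in Omega) `|(EFin \o (fun x => cdot (f x) (f x))) x| = 0)%E.
  rewrite -[RHS]/(0%:E) -f0 EFin_rinner//; apply: eq_integral => x _ /=.
  by rewrite ger0_norm ?cdot_ge0// /cdot -!expr2.
move/(ae_eq_integral_abs eta mO mf); apply: filterS => x fx Ox.
by apply: cdot_eq0; have [] := fx Ox.
Qed.

Lemma L2_sub f g : L2 f -> L2 g -> L2 (fun x => f x - g x).
Proof.
move=> Lf Lg; have := L2_lin (-1) Lg Lf.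
by under eq_fun do rewrite mulN1r addrC.
Qed.

Lemma rinner_subl f g h : L2 f -> L2 g -> L2 h ->
  rinner (fun x => f x - g x) h = rinner f h - rinner g h.
Proof.
move=> Lf Lg Lh; have := rinner_linl (-1) Lg Lf Lh.
rewrite mulN1r addrC => <-; congr rinner; apply/funext => x.
by rewrite rmorphN rmorph1 mulN1r addrC.
Qed.

Lemma rinner_ae_eq f g : L2 f -> L2 g ->
  (forall h, L2 h -> rinner f h = rinner g h) -> f = g %[ae eta in Omega].
Proof.
move=> Lf Lg fg; have Lfg := L2_sub Lf Lg.
have : rinner (fun x => f x - g x) (fun x => f x - g x) = 0.
  by rewrite rinner_subl// fg// subrr.
move/(rinner_eq0 Lfg); apply: filterS => x fgx Ox.
by apply/eqP; rewrite -subr_eq0 fgx.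
Qed.

Lemma cvg_rinner (v : nat -> T -> R[i]) h g :
  (forall n, L2 (v n)) -> L2 h -> L2 g ->
  rinner (fun x => v n x - h x) (fun x => v n x - h x) @[n --> \oo] --> 0 ->
  rinner (v n) g @[n --> \oo] --> rinner h g.
Proof.
move=> Lv Lh Lg vh; apply/cvgrPdist_le => e e0.
have : rinner (fun x => v n x - h x) (fun x => v n x - h x) * rinner g g
    @[n --> \oo] --> 0.
  by rewrite -(mul0r (rinner g g)); apply: cvgM => //; exact: cvg_cst.
move/cvgr0_norm_le => /(_ _ (exprn_gt0 2 e0)); apply: filterS => n vhn.
rewrite distrC -rinner_subl// -ler_sqr ?nnegrE ?(ltW e0)// real_normK ?num_real//.
apply: le_trans (rinner_CS (L2_sub (Lv n) Lh) Lg) _.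
exact: le_trans (ler_norm _) vhn.
Qed.

Section fast_cauchy.
Variables (v : nat -> T -> R[i]) (C : R).
Hypothesis Lv : forall n, L2 (v n).
Let D n x := v n.+1 x - v n x.
Hypothesis rinnerD : forall n, rinner (D n) (D n) <= C * 8^-1 ^+ n.

Let LD n : L2 (D n). Proof. exact: L2_sub. Qed.

(* Where the increments weighted by 4 ^+ n are summable, which is almost
   everywhere, both coordinates of v n are geometric Cauchy sequences. *)
Let majorant x : \bar R := (\sum_(0 <= n <oo) (4 ^+ n * cdot (D n x) (D n x))%:E)%E.

Let term_ge0 n x : (0 <= (4 ^+ n * cdot (D n x) (D n x))%:E)%E.
Proof. by rewrite lee_fin mulr_ge0 ?cdot_ge0 ?exprn_ge0. Qed.

Let majorant_ge0 x : (0 <= majorant x)%E.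
Proof. by apply: nneseries_ge0. Qed.

Let majorant_integrable : eta.-integrable Omega majorant.
Proof.
have mterm n : measurable_fun Omega (fun x => (4 ^+ n * cdot (D n x) (D n x))%:E).
  by apply/measurable_EFinP/measurable_funM => //; exact: cdot_measurable.
apply/integrableP; split; first exact: ge0_emeasurable_sum.
under eq_integral do rewrite gee0_abs//.
rewrite integral_nneseries//.
apply: (@le_lt_trans _ _ (2 * `|C|)%:E); last exact: ltry.
apply: le_trans (epsilon_trick0 xpredT (mulr_ge0 (ler0n R 2) (normr_ge0 C))).
apply: lee_nneseries => [n _ _|n _]; first exact: integral_ge0.
have -> : (\int[eta]_(x in Omega) (4 ^+ n * cdot (D n x) (D n x))%:E)%E =
    (4 ^+ n * rinner (D n) (D n))%:E.
  rewrite /rinner -RintegralZl//; last exact: cdot_integrable.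
  rewrite EFin_Rintegral//.
  exact: (integrableZl mO _ (cdot_integrable (LD n) (LD n))).
rewrite lee_fin; apply: le_trans (ler_wpM2l _ (rinnerD n)) _.
  by rewrite exprn_ge0.
rewrite mulrCA -exprMn (_ : 4 * 8^-1 = 2^-1 :> R); last by field.
rewrite natrX exprS invfM mulrACA divff// mul1r exprVn.
by rewrite ler_wpM2r ?invr_ge0 ?exprn_ge0// ler_norm.
Qed.

Let majorant_lty : set T := Omega `&` majorant @^-1` [set~ +oo%E].

Let majorant_lty_measurable : measurable majorant_lty.
Proof.
apply: (measurable_int _ majorant_integrable) => //.
exact: measurableC.
Qed.

Let majorantE x : majorant_lty x -> majorant x = (fine (majorant x))%:E.
Proof.
by move=> [_ Wx]; rewrite fineK// ge0_fin_numE// ltey; apply/eqP.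
Qed.

Let cdotD_le n x : majorant_lty x ->
  cdot (D n x) (D n x) <= fine (majorant x) * (2^-1 ^+ n) ^+ 2.
Proof.
move=> Fx; rewrite -exprM mulnC exprM (_ : 2^-1 ^+ 2 = 4^-1 :> R); last by field.
rewrite exprVn ler_pdivlMr ?exprn_gt0// mulrC -lee_fin -majorantE//.
apply: le_trans (nneseries_lim_ge n.+1 (fun k _ _ => term_ge0 k x)).
by rewrite big_nat_recr//= leeDr// sume_ge0.
Qed.

Let coordinate_cvg (p : R[i] -> R) x :
  (forall a b, p (a - b) = p a - p b) -> (forall c, p c ^+ 2 <= cdot c c) ->
  majorant_lty x ->
  p (v n x) @[n --> \oo] --> limn (fun n => p (v n x)) /\
  forall n, `|p (v n x) - limn (fun n => p (v n x))| <=
    2 * Num.sqrt (fine (majorant x)) * 2^-1 ^+ n.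
Proof.
move=> pB p_le Fx; apply: geometric_cauchy_cvg => n; rewrite -pB.
rewrite -ler_sqr ?nnegrE ?mulr_ge0 ?exprn_ge0 ?sqrtr_ge0//.
rewrite real_normK ?num_real// exprMn sqr_sqrtr ?fine_ge0//.
exact: le_trans (p_le _) (cdotD_le n Fx).
Qed.

Let ReB (a b : R[i]) : complex.Re (a - b) = complex.Re a - complex.Re b.
Proof. by case: a b => [? ?] [? ?]. Qed.

Let ImB (a b : R[i]) : complex.Im (a - b) = complex.Im a - complex.Im b.
Proof. by case: a b => [? ?] [? ?]. Qed.

Let sqr_Re_le (c : R[i]) : complex.Re c ^+ 2 <= cdot c c.
Proof. by rewrite /cdot -!expr2 lerDl sqr_ge0. Qed.

Let sqr_Im_le (c : R[i]) : complex.Im c ^+ 2 <= cdot c c.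
Proof. by rewrite /cdot -!expr2 lerDr sqr_ge0. Qed.

Let h x : R[i] :=
  (limn (fun n => complex.Re (v n x)) * \1_majorant_lty x) +i*
  (limn (fun n => complex.Im (v n x)) * \1_majorant_lty x).

Let limit_measurable (p : R[i] -> R) :
  (forall n, measurable_fun Omega (fun x => p (v n x))) ->
  (forall a b, p (a - b) = p a - p b) -> (forall c, p c ^+ 2 <= cdot c c) ->
  measurable_fun Omega (fun x => limn (fun n => p (v n x)) * \1_majorant_lty x).
Proof.
move=> mp pB p_le.
apply: (@measurable_fun_cvg _ _ _ _ (fun n x => p (v n x) * \1_majorant_lty x)).
  by move=> n; apply: measurable_funM => //; exact: measurable_indic.
move=> x Ox; rewrite indicE; have [Fx|nFx] := pselect (majorant_lty x).
  rewrite mem_set//; apply: cvgM; last exact: cvg_cst.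
  by have [] := coordinate_cvg pB p_le Fx.
by rewrite memNset// mulr0; under eq_fun do rewrite mulr0; exact: cvg_cst.
Qed.

Let cdot_limit_le n x : majorant_lty x ->
  cdot (v n x - h x) (v n x - h x) <= 8 * (2^-1 ^+ n) ^+ 2 * fine (majorant x).
Proof.
move=> Fx; have W0 : 0 <= fine (majorant x) by exact: fine_ge0.
have [_ /(_ n) leRe] := coordinate_cvg ReB sqr_Re_le Fx.
have [_ /(_ n) leIm] := coordinate_cvg ImB sqr_Im_le Fx.
rewrite /cdot ReB ImB /= indicE mem_set// !mulr1 -!expr2.
have sqr_le (r : R) : `|r| <= 2 * Num.sqrt (fine (majorant x)) * 2^-1 ^+ n ->
    r ^+ 2 <= 4 * (2^-1 ^+ n) ^+ 2 * fine (majorant x).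
  rewrite -ler_sqr ?nnegrE ?mulr_ge0 ?exprn_ge0 ?sqrtr_ge0//.
  rewrite real_normK ?num_real// !exprMn sqr_sqrtr//; move/le_trans; apply.
  by rewrite le_eqVlt; apply/orP; left; apply/eqP; ring.
have := lerD (sqr_le _ leRe) (sqr_le _ leIm); move/le_trans; apply.
by rewrite le_eqVlt; apply/orP; left; apply/eqP; ring.
Qed.

Let rinner_limit_le n : L2 h -> rinner (fun x => v n x - h x) (fun x => v n x - h x) <=
  8 * (2^-1 ^+ n) ^+ 2 * fine (\int[eta]_(x in Omega) majorant x)%E.
Proof.
move=> Lh; have Lvh := L2_sub (Lv n) Lh.
have [int_majorant majorant_fine] := integral_fine mO majorant_integrable.
rewrite -majorant_fine -/(Rintegral _ _ _) -RintegralZl//.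
apply: fine_le.
- by apply: integrable_fin_num => //; exact: cdot_integrable.
- by apply: integrable_fin_num => //; exact: (integrableZl mO _ int_majorant).
apply: ae_ge0_le_integral => //.
- by move=> x _; rewrite lee_fin cdot_ge0.
- by apply/measurable_EFinP; exact: cdot_measurable.
- by move=> x _; rewrite lee_fin !mulr_ge0 ?exprn_ge0// fine_ge0.
- apply/measurable_EFinP/measurable_funM => //.
  exact/measurable_EFinP/(measurable_int _ int_majorant).
have := integrable_ae mO majorant_integrable; apply: filterS => x Wx Ox.
rewrite lee_fin; apply: cdot_limit_le; split=> //= Woo.
by have := Wx Ox; rewrite Woo.
Qed.

Let limit_L2 : L2 h.
Proof.
have mRe n : measurable_fun Omega (fun x => complex.Re (v n x)) by have [] := Lv n.
have mIm n : measurable_fun Omega (fun x => complex.Im (v n x)) by have [] := Lv n.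
have mhRe := limit_measurable mRe ReB sqr_Re_le.
have mhIm := limit_measurable mIm ImB sqr_Im_le.
apply/L2P; split => //.
have Iv := integrableZl mO 2 (cdot_integrable (Lv 0%N) (Lv 0%N)).
have [int_majorant _] := integral_fine mO majorant_integrable.
apply: le_integrable (integrableD mO Iv (integrableZl mO 16 int_majorant)) => //.
  by apply/measurable_EFinP; apply: measurable_funD; apply: measurable_funM.
move=> x _; rewrite /= lee_fin ger0_norm ?cdot_ge0//.
have v0 : 0 <= 2 * cdot (v 0%N x) (v 0%N x) by rewrite mulr_ge0 ?cdot_ge0.
have W0 : 0 <= 16 * fine (majorant x) by rewrite mulr_ge0 ?fine_ge0.
apply: le_trans (ler_norm _); have [Fx|nFx] := pselect (majorant_lty x); last first.
  by rewrite /h indicE memNset// !mulr0 /cdot/= !mulr0 addr0 addr_ge0.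
have -> : h x = -1 * (v 0%N x - h x) + v 0%N x by ring.
have := cdot_lin_le (-1) (v 0%N x - h x) (v 0%N x).
have := cdot_limit_le 0 Fx; rewrite expr0 expr1n mulr1.
have -> : cdot (-1) (-1) = 1 :> R by rewrite /cdot/= oppr0 mulr0 addr0 mulrNN mulr1.
lra.
Qed.

Lemma L2_fast_cauchy_cvg : exists2 h, L2 h &
  rinner (fun x => v n x - h x) (fun x => v n x - h x) @[n --> \oo] --> 0.
Proof.
exists h => //; set c := fine (\int[eta]_(x in Omega) majorant x)%E.
apply: (squeeze_cvgr (f := fun=> 0) (h := fun n => 8 * (2^-1 ^+ n) ^+ 2 * c)).
- by near=> n; rewrite rinner_ge0 rinner_limit_le.
- exact: cvg_cst.
rewrite -[X in _ --> X](mul0r c); apply: cvgM; last exact: cvg_cst.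
rewrite -[X in _ --> X](mulr0 8); apply: cvgM; first exact: cvg_cst.
under eq_fun do rewrite -exprM mulnC exprM.
by apply: cvg_expr; rewrite ger0_norm ?exprn_ge0// expr2; lra.
Unshelve. all: by end_near. Qed.

End fast_cauchy.

Lemma weak_limit0_rinner (v : R -> T -> R[i]) h : L2 h ->
  (forall g, L2 g -> rinner (v y) g @[y --> (0 : R)^'+] --> rinner h g) ->
  weak_limit0 eta Omega v h.
Proof.
move=> Lh cvg_v; split => // g Lg.
rewrite (_ : (fun y => complex.Re _) = fun y => rinner (v y) g); last first.
  by apply/funext => y; rewrite Re_inner.
rewrite (_ : (fun y => complex.Im _) = fun y => rinner (v y) (mulI g)); last first.
  by apply/funext => y; rewrite Im_inner.
by rewrite Re_inner Im_inner; split; apply: cvg_v => //; exact: L2_mulI.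
Qed.

Lemma weak_derivative_rinner (v : R -> T -> R[i]) (y : R) h : L2 h ->
  (forall g, L2 g -> is_derive y 1 (fun z => rinner (v z) g) (rinner h g)) ->
  weak_derivative eta Omega v y h.
Proof.
move=> Lh dv; split=> [|g Lg]; first exact: Lh.
rewrite (_ : (fun y => complex.Re _) = fun y => rinner (v y) g); last first.
  by apply/funext => z; rewrite Re_inner.
rewrite (_ : (fun y => complex.Im _) = fun y => rinner (v y) (mulI g)); last first.
  by apply/funext => z; rewrite Im_inner.
rewrite Re_inner Im_inner; split; apply: dv; first exact: Lg.
exact: L2_mulI.
Qed.

Lemma weak_integral_rinner (c : R) (k : R -> R) (F : R -> T -> R[i]) h : L2 h ->
  (forall g, L2 g ->
    (@lebesgue_measure R).-integrable `]0%R, +oo[ (EFin \o (fun t => rinner (F t) g * k t)) /\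
    rinner h g = c * \int[@lebesgue_measure R]_(t in `]0%R, +oo[) (rinner (F t) g * k t)) ->
  weak_integral eta Omega c k F h.
Proof.
move=> Lh intF; split => // g Lg D re im.
have [iRe Re_hg] := intF g Lg; have [iIm Im_hg] := intF _ (L2_mulI Lg).
have reE : re = fun t => rinner (F t) g * k t.
  by apply/funext => t; rewrite /re Re_inner.
have imE : im = fun t => rinner (F t) (mulI g) * k t.
  by apply/funext => t; rewrite /im Im_inner.
rewrite reE imE; split => //; rewrite innerE Re_hg Im_hg.
move: (Rintegral _ _ _) (Rintegral _ _ _) => p q.
by apply/eqP; rewrite eq_complex/= !mul0r subr0 addr0 !eqxx.
Qed.

End L2_space.

(** * Spectral measures and the functional calculus *)

Section spectral_calculus.
Context {d : measure_display} {T : measurableType d} {R : realType}.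
Variables (eta : {measure set T -> \bar R}) (Omega : set T).
Hypothesis mO : measurable Omega.
Variable E : set R -> (T -> R[i]) -> (T -> R[i]).
Hypothesis resE : resolution_of_identity eta Omega E.
Local Notation Rge0 := (`[0%R, +oo[%classic : set R).
Local Notation Rgt0 := (`]0%R, +oo[%classic : set R).
Local Notation mu := (@lebesgue_measure R).
Hypothesis suppE : forall f, L2 eta Omega f -> E Rge0 f = f %[ae eta in Omega].
Local Notation L2 := (L2 eta Omega).
Local Notation rinner := (rinner eta Omega).
Local Notation graph := (calculus_graph eta Omega E).
Local Notation dom := (calculus_dom eta Omega E).
Local Notation calculus := (calculus eta Omega E).
Local Notation heat := (heat eta Omega E).
Implicit Types (f g h : T -> R[i]) (A B : set R) (phi psi rho : R -> R).
Implicit Types m : {finite_measure set R -> \bar R}.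

Let mRge0 : measurable Rge0. Proof. exact: measurable_itv. Qed.

Definition re_spectral f g A : R := rinner (E A f) g.

Lemma E_L2 A f : measurable A -> L2 f -> L2 (E A f).
Proof. by case: resE => + _ _ _ _ mA Lf => /(_ A mA)[[[_ /(_ f Lf)[]]]]. Qed.

Lemma rinner_E A f g : measurable A -> L2 f -> L2 g ->
  rinner (E A f) g = rinner f (E A g).
Proof.
move=> mA Lf Lg; case: resE => /(_ A mA)[_ _ /(_ f g Lf Lg) symE] _ _ _ _.
by rewrite -!Re_inner symE.
Qed.

Lemma rinner_EE A B f g : measurable A -> measurable B -> L2 f -> L2 g ->
  rinner (E A f) (E B g) = re_spectral f g (A `&` B).
Proof.
move=> mA mB Lf Lg; rewrite -rinner_E//; last exact: E_L2.
rewrite /re_spectral setIC; apply: rinner_ael => //; try exact: E_L2.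
- by apply: E_L2 => //; exact: E_L2.
- by apply: E_L2 => //; exact: measurableI.
- case: resE => _ _ _ /(_ B A f mB mA Lf) EI _.
  by apply: filterS EI => x EIx Ox; rewrite EIx.
Qed.

Lemma re_spectral_sigma_additive f g : L2 f -> L2 g ->
  sigma_additive_setfun (re_spectral f g).
Proof.
move=> Lf Lg; split.
  rewrite /re_spectral (@rinner_ael _ _ _ eta Omega mO _ (fun=> 0)) ?rinner0l//.
  - exact: E_L2.
  - exact: L2_0.
  - by case: resE => _ /(_ f Lf).
move=> A mA tA; case: resE => _ _ _ _ /(_ A f g mA tA Lf Lg)[+ _].
by rewrite Re_inner; under eq_fun do rewrite Re_inner.
Qed.

Lemma re_spectralC f g A : measurable A -> L2 f -> L2 g ->
  re_spectral f g A = re_spectral g f A.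
Proof. by move=> mA Lf Lg; rewrite /re_spectral rinner_E// rinnerC. Qed.

Lemma re_spectral_Rge0 f g A : measurable A -> L2 f -> L2 g ->
  re_spectral f g (A `&` Rge0) = re_spectral f g A.
Proof.
move=> mA Lf Lg; rewrite -rinner_EE// rinnerC [RHS]rinnerC.
by apply: rinner_ael => //; [exact: E_L2|exact: E_L2|exact: suppE].
Qed.

Lemma re_spectral_total f g : L2 f -> L2 g -> re_spectral f g Rge0 = rinner f g.
Proof. by move=> Lf Lg; apply: rinner_ael => //; [exact: E_L2|exact: suppE]. Qed.

Lemma re_spectral_ge0 f A : measurable A -> L2 f -> 0 <= re_spectral f f A.
Proof. by move=> mA Lf; rewrite -(setIid A) -rinner_EE// rinner_ge0. Qed.

Lemma re_spectral_CS f g A : measurable A -> L2 f -> L2 g ->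
  re_spectral f g A ^+ 2 <= re_spectral f f A * re_spectral g g A.
Proof.
move=> mA Lf Lg; rewrite -(setIid A) -!rinner_EE//.
by apply: rinner_CS => //; exact: E_L2.
Qed.

Definition is_spectral_measure f m :=
  forall A, measurable A -> m A = (re_spectral f f A)%:E.

Lemma spectral_measure_ex f : L2 f -> exists m, is_spectral_measure f m.
Proof.
move=> Lf; apply: ge0_setfun_measure_ex; first exact: re_spectral_sigma_additive.
by move=> A mA; exact: re_spectral_ge0.
Qed.

Definition is_spectral_density f g m rho := [/\ m.-integrable setT (EFin \o rho),
  m.-integrable setT (EFin \o (fun x => rho x ^+ 2)) &
  forall A, measurable A -> re_spectral f g A = \int[m]_(x in A) rho x].

Lemma spectral_density_ex f g m : L2 f -> L2 g -> is_spectral_measure f m ->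
  exists rho, is_spectral_density f g m rho.
Proof.
move=> Lf Lg mE; have [n nE] := spectral_measure_ex Lg.
have CS A : measurable A -> re_spectral f g A ^+ 2 <= fine (m A) * fine (n A).
  by move=> mA; rewrite mE// nE//; exact: re_spectral_CS.
have [|rho irho rhoE] := setfun_density_ex (m := m) (re_spectral_sigma_additive Lf Lg).
  move=> A mA mA0; apply/eqP; rewrite -sqrf_eq0 eq_le sqr_ge0 andbT.
  by rewrite (le_trans (CS A mA))// mA0 mul0r.
exists rho; split => //; apply: (integrable_sqr_density (n := n)) => // A mA.
by rewrite -rhoE//; exact: CS.
Qed.

Lemma spectral_density1 f m : is_spectral_measure f m ->
  is_spectral_density f f m (cst 1).
Proof.
move=> mE; have int1 : m.-integrable setT (EFin \o cst 1).
  exact: finite_measure_integrable_cst.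
split => //; first by under eq_fun do rewrite expr1n.
move=> A mA; transitivity (fine (m A)); first by rewrite mE.
by rewrite Rintegral_cst// mul1r.
Qed.

Lemma calculus_domE f m phi : is_spectral_measure f m ->
  dom phi f <->
  L2 f /\ (\int[m]_(x in Rge0) (phi x ^+ 2)%:E < +oo)%E.
Proof.
move=> mE; rewrite /calculus_dom /mkset.
rewrite (@eq_setfun_integral _ _ _ _ m); last first.
  by move=> A mA; rewrite mE// /re_spectral -Re_inner.
by under eq_integral do rewrite real_normK ?num_real//.
Qed.

Lemma calculus_graph_reP phi f h : graph phi f h <->
  [/\ dom phi f, L2 h &
      forall g, L2 g -> rinner h g = signed_integral (re_spectral f g) Rge0 phi].
Proof.
have ReE g : (fun A => complex.Re (spectral_measure eta Omega E f g A)) = re_spectral f g.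
  by apply/funext => A; rewrite /spectral_measure Re_inner.
have ImE g : (fun A => complex.Im (spectral_measure eta Omega E f g A)) = re_spectral f (mulI g).
  by apply/funext => A; rewrite /spectral_measure Im_inner.
split=> -[domf Lh hg]; split; try exact: domf; try exact: Lh.
  by move=> g Lg; rewrite -Re_inner (hg g Lg) -ReE.
move=> g Lg.
by rewrite innerE /complex_integral ReE ImE (hg g Lg) hg//; exact: L2_mulI.
Qed.

Lemma dom_integrable_sqr phi f m : is_spectral_measure f m ->
  measurable_fun Rge0 phi -> dom phi f ->
  m.-integrable Rge0 (EFin \o (fun x => phi x ^+ 2)).
Proof.
move=> mE mphi /(calculus_domE phi mE)[_ iphi]; apply/integrableP; split.
  by apply/measurable_EFinP; exact: measurable_funX.
by under eq_integral do rewrite gee0_abs ?lee_fin ?sqr_ge0//.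
Qed.

Lemma integrable_sqr_dom phi f m : L2 f -> is_spectral_measure f m ->
  m.-integrable Rge0 (EFin \o (fun x => phi x ^+ 2)) -> dom phi f.
Proof.
move=> Lf mE /integrableP[_ iphi]; apply/(calculus_domE phi mE); split => //.
by move: iphi; under eq_integral do rewrite gee0_abs ?lee_fin ?sqr_ge0//.
Qed.

Lemma dom_le phi psi f : measurable_fun Rge0 phi -> measurable_fun Rge0 psi ->
  (forall x, 0 <= x -> `|psi x| <= `|phi x|) -> dom phi f -> dom psi f.
Proof.
move=> mphi mpsi psi_le domf; have Lf : L2 f by case: domf.
have [m mE] := spectral_measure_ex Lf; apply: (integrable_sqr_dom Lf mE).
apply: le_integrable (dom_integrable_sqr mE mphi domf) => //.
  by apply/measurable_EFinP; exact: measurable_funX.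
move=> x; rewrite Rge0E => x0.
by rewrite lee_fin !normrX lerXn2r ?nnegrE ?psi_le.
Qed.

Lemma dom_bounded phi f (M : R) : measurable_fun Rge0 phi -> L2 f ->
  (forall x, 0 <= x -> `|phi x| <= M) -> dom phi f.
Proof.
move=> mphi Lf phi_le; have [m mE] := spectral_measure_ex Lf.
apply: (@dom_le (cst M)) => //.
  by move=> x x0; apply: le_trans (phi_le x x0) _; exact: ler_norm.
apply: (integrable_sqr_dom Lf mE).
exact: (finite_measure_integrable_cst m (M ^+ 2) mRge0).
Qed.

Lemma dom_lin (t : R) phi psi f : measurable_fun Rge0 phi -> measurable_fun Rge0 psi ->
  dom phi f -> dom psi f -> dom (fun x => t * phi x + psi x) f.
Proof.
move=> mphi mpsi domphi dompsi; have Lf : L2 f by case: domphi.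
have [m mE] := spectral_measure_ex Lf; apply: (integrable_sqr_dom Lf mE).
have iphi := integrableZl mRge0 (2 * t ^+ 2) (dom_integrable_sqr mE mphi domphi).
have ipsi := integrableZl mRge0 2 (dom_integrable_sqr mE mpsi dompsi).
apply: le_integrable (integrableD mRge0 iphi ipsi) => //.
  apply/measurable_EFinP/measurable_funX/measurable_funD => //.
  exact: measurable_funM.
move=> x _ /=; rewrite lee_fin ger0_norm ?sqr_ge0//; apply: le_trans (ler_norm _).
by have := sqr_ge0 (t * phi x - psi x); rewrite !expr2; nra.
Qed.

Lemma integrable_mul_density phi f g m rho : is_spectral_measure f m ->
  is_spectral_density f g m rho -> measurable_fun Rge0 phi -> dom phi f ->
  m.-integrable Rge0 (EFin \o (fun x => phi x * rho x)).
Proof.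
move=> mE [irho irho2 _] mphi domf; apply: integrable_mul_sqr => //.
- by apply/measurable_EFinP; apply: measurable_funTS; exact: measurable_int irho.
- exact: dom_integrable_sqr domf.
- exact: integrableS irho2.
Qed.

Lemma signed_integral_spectral phi f g m rho : is_spectral_measure f m ->
  is_spectral_density f g m rho -> measurable_fun Rge0 phi -> dom phi f ->
  signed_integral (re_spectral f g) Rge0 phi = \int[m]_(x in Rge0) (phi x * rho x).
Proof.
move=> mE dens mphi domf; have [irho _ rhoE] := dens.
by apply: signed_integral_density => //; exact: (integrable_mul_density mE dens).
Qed.

Lemma calculus_graphP phi f h m : is_spectral_measure f m -> measurable_fun Rge0 phi ->
  graph phi f h <-> [/\ dom phi f, L2 h & forall g rho, L2 g ->
    is_spectral_density f g m rho ->
    rinner h g = \int[m]_(x in Rge0) (phi x * rho x)].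
Proof.
move=> mE mphi; rewrite calculus_graph_reP; split=> -[domf Lh hE]; split => // g.
  by move=> rho Lg dens; rewrite hE// (signed_integral_spectral mE dens).
move=> Lg; have [rho dens] := spectral_density_ex (proj1 domf) Lg mE.
by rewrite (signed_integral_spectral mE dens)//; exact: hE.
Qed.

Lemma rinner_calculus_density phi f h g m rho : is_spectral_measure f m ->
  measurable_fun Rge0 phi -> graph phi f h -> L2 g -> is_spectral_density f g m rho ->
  rinner h g = \int[m]_(x in Rge0) (phi x * rho x).
Proof.
by move=> mE mphi /(calculus_graphP h mE mphi)[_ _ hE] Lg dens; exact: hE.
Qed.

Lemma calculus_graph_uniq phi f h k : graph phi f h -> graph phi f k ->
  h = k %[ae eta in Omega].
Proof.
move=> /calculus_graph_reP[_ Lh hE] /calculus_graph_reP[_ Lk kE].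
by apply: rinner_ae_eq => // g Lg; rewrite hE// kE.
Qed.

Lemma calculus_graph_lin (t : R) phi psi f h k : measurable_fun Rge0 phi ->
  measurable_fun Rge0 psi -> graph phi f h -> graph psi f k ->
  graph (fun x => t * phi x + psi x) f (fun x => t%:C * h x + k x).
Proof.
move=> mphi mpsi graphh graphk; have Lf : L2 f by case: graphh => -[].
have [m mE] := spectral_measure_ex Lf.
have [domphi Lh hE] := proj1 (calculus_graphP h mE mphi) graphh.
have [dompsi Lk kE] := proj1 (calculus_graphP k mE mpsi) graphk.
apply/(calculus_graphP _ mE).
  by apply: measurable_funD => //; exact: measurable_funM.
split; [exact: dom_lin|exact: L2_lin|move=> g rho Lg dens].
have iphi := integrable_mul_density mE dens mphi domphi.
have ipsi := integrable_mul_density mE dens mpsi dompsi.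
rewrite rinner_linl// (hE g rho)// (kE g rho)// -RintegralZl// -RintegralD//.
  by apply: eq_Rintegral => x _; ring.
exact: (integrableZl mRge0 t iphi).
Qed.

Lemma calculus_graph_indic A f : measurable A -> L2 f -> graph \1_A f (E A f).
Proof.
move=> mA Lf; have [m mE] := spectral_measure_ex Lf.
have mindic : measurable_fun Rge0 (\1_A : R -> R) by exact: measurable_indic.
apply/(calculus_graphP _ mE) => //; split; last 1 first.
- move=> g rho Lg [irho _ rhoE]; rewrite -/(re_spectral f g A).
  rewrite -re_spectral_Rge0// rhoE; last exact: measurableI.
  rewrite setIC Rintegral_mkcondr; apply: eq_Rintegral => x _.
  by rewrite patch_indic/= mulrC.
- apply: (@dom_bounded _ _ 1) => // x _; rewrite indicE.
  by case: (x \in A); rewrite ?normr1 ?normr0.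
- exact: E_L2.
Qed.

Lemma calculus_graph1 f : L2 f -> graph (cst 1) f f.
Proof.
move=> Lf; have [m mE] := spectral_measure_ex Lf.
apply/(calculus_graphP _ mE) => //; split => //.
  by apply: (@dom_bounded _ _ 1) => // x _; rewrite normr1.
move=> g rho Lg [_ _ rhoE]; rewrite -re_spectral_total// rhoE//.
by apply: eq_Rintegral => x _; rewrite mul1r.
Qed.

Lemma calculus_graph0 f : L2 f -> graph (cst 0) f (fun=> 0).
Proof.
move=> Lf; have graph1 := calculus_graph1 Lf.
have mcst1 : measurable_fun Rge0 (cst 1 : R -> R) by exact: measurable_cst.
have := calculus_graph_lin (-1) mcst1 mcst1 graph1 graph1.
by congr graph; apply/funext => x; rewrite ?rmorphN ?rmorph1 ?mulN1r/= ?addNr// mulr1 addNr.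
Qed.

Lemma calculus_graphZ (t : R) phi f h : measurable_fun Rge0 phi ->
  graph phi f h -> graph (fun x => t * phi x) f (fun x => t%:C * h x).
Proof.
move=> mphi graphh; have Lf : L2 f by case: graphh => -[].
have m0 : measurable_fun Rge0 (cst 0 : R -> R) by exact: measurable_cst.
have := calculus_graph_lin t mphi m0 graphh (calculus_graph0 Lf).
by congr graph; apply/funext => x; rewrite addr0.
Qed.

Lemma spectral_density_E f g m rho A : L2 f -> L2 g -> measurable A ->
  is_spectral_density f g m rho -> is_spectral_density f (E A g) m (rho \_ A).
Proof.
move=> Lf Lg mA [irho irho2 rhoE].
have iA (F : R -> R) : m.-integrable setT (EFin \o F) -> m.-integrable setT (EFin \o F \_ A).
  move=> iF; rewrite -restrict_EFin; apply/(integrable_mkcond _ mA).1.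
  exact: integrableS iF.
split; first exact: iA.
  have -> : (fun x => (rho \_ A) x ^+ 2) = (fun x => rho x ^+ 2) \_ A.
    by apply/funext => x; rewrite !patchE; case: ifP => // _; rewrite expr0n.
  exact: iA.
move=> B mB; rewrite -Rintegral_mkcondr -rhoE; last exact: measurableI.
exact: rinner_EE.
Qed.

Lemma re_spectral_calculus phi f h g m rho A : is_spectral_measure f m ->
  measurable_fun Rge0 phi -> graph phi f h -> L2 g ->
  is_spectral_density f g m rho -> measurable A ->
  re_spectral h g A = \int[m]_(x in A) ((fun x => phi x * rho x) \_ Rge0) x.
Proof.
move=> mE mphi /(calculus_graphP _ mE mphi)[domf Lh hE] Lg dens mA.
rewrite /re_spectral rinner_E// (hE _ _ _ (spectral_density_E _ _ mA dens))//.
- rewrite -Rintegral_mkcondl Rintegral_mkcondr; apply: eq_Rintegral => x _.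
  by rewrite !patchE; case: ifP => // _; rewrite mulr0.
- exact: E_L2.
- by case: domf.
Qed.

Lemma calculus_density phi f h m : is_spectral_measure f m ->
  measurable_fun Rge0 phi -> graph phi f h ->
  is_spectral_density f h m (phi \_ Rge0).
Proof.
move=> mE mphi graphh; have [domf Lh _] := graphh; have [Lf _] := domf.
have iphi2 := dom_integrable_sqr mE mphi domf.
split.
- rewrite -restrict_EFin; apply/(integrable_mkcond _ mRge0).1.
  have int1 : m.-integrable Rge0 (EFin \o (fun x => cst 1 x ^+ 2)).
    exact: (finite_measure_integrable_cst m (1 ^+ 2) mRge0).
  have := integrable_mul_sqr mRge0 mphi (measurable_cst _) iphi2 int1.
  by apply: eq_integrable => // x _ /=; rewrite mulr1.
- have -> : (fun x => (phi \_ Rge0) x ^+ 2) = (fun x => phi x ^+ 2) \_ Rge0.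
    by apply/funext => x; rewrite !patchE; case: ifP => // _; rewrite expr0n.
  by rewrite -restrict_EFin; apply/(integrable_mkcond _ mRge0).1.
move=> A mA; rewrite re_spectralC//.
rewrite (re_spectral_calculus mE mphi graphh Lf (spectral_density1 mE) mA).
by apply: eq_Rintegral => x _; rewrite !patchE mulr1.
Qed.

Lemma spectral_measure_calculus phi f h m mh : is_spectral_measure f m ->
  is_spectral_measure h mh -> measurable_fun Rge0 phi -> graph phi f h ->
  forall A, measurable A ->
  mh A = (\int[m]_(x in A) (((fun x => phi x ^+ 2) \_ Rge0) x)%:E)%E.
Proof.
move=> mE mhE mphi graphh A mA; have [_ Lh _] := graphh.
have phi_phi : (fun x => phi x * (phi \_ Rge0) x) \_ Rge0 = (fun x => phi x ^+ 2) \_ Rge0.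
  by apply/funext => x; rewrite patchE [RHS]patchE; case: ifPn => //= Rx; rewrite patchE Rx.
have dens := calculus_density mE mphi graphh.
rewrite mhE// (re_spectral_calculus mE mphi graphh Lh dens mA) phi_phi.
rewrite EFin_Rintegral// -restrict_EFin.
apply: integrableS (subsetT A) _ => //; apply/(integrable_mkcond _ mRge0).1.
by apply: dom_integrable_sqr mE mphi _; case: graphh.
Qed.

Lemma rinner_calculus phi f h m : is_spectral_measure f m ->
  measurable_fun Rge0 phi -> graph phi f h ->
  rinner h h = \int[m]_(x in Rge0) (phi x ^+ 2).
Proof.
move=> mE mphi graphh; have [_ Lh hE] := proj1 (calculus_graphP h mE mphi) graphh.
rewrite (hE h _ Lh (calculus_density mE mphi graphh)).
by apply: eq_Rintegral => x Rx; rewrite patchE Rx expr2.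
Qed.

Lemma dom_comp phi psi f h : measurable_fun Rge0 phi -> measurable_fun Rge0 psi ->
  graph phi f h -> dom psi h <-> dom (fun x => psi x * phi x) f.
Proof.
move=> mphi mpsi graphh; have [domf Lh _] := graphh; have [Lf _] := domf.
have [m mE] := spectral_measure_ex Lf; have [mh mhE] := spectral_measure_ex Lh.
rewrite (calculus_domE psi mhE) (calculus_domE _ mE).
rewrite (ge0_integral_density (m := m) (F := (fun x => phi x ^+ 2) \_ Rge0))//.
- have -> : (\int[m]_(x in Rge0) (psi x ^+ 2 * ((fun x => phi x ^+ 2) \_ Rge0) x)%:E =
      \int[m]_(x in Rge0) ((psi x * phi x) ^+ 2)%:E)%E.
    by apply: eq_integral => x Rx; rewrite patchE Rx exprMn.
  by split=> -[].
- have := dom_integrable_sqr mE mphi domf.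
  by rewrite (integrable_mkcond _ mRge0) restrict_EFin.
- exact: spectral_measure_calculus graphh.
- exact: measurable_funX.
- by move=> x _; exact: sqr_ge0.
Qed.

Lemma signed_integral_calculus phi psi f h g m rho : is_spectral_measure f m ->
  measurable_fun Rge0 phi -> measurable_fun Rge0 psi -> graph phi f h ->
  dom psi h -> L2 g -> is_spectral_density f g m rho ->
  signed_integral (re_spectral h g) Rge0 psi =
    \int[m]_(x in Rge0) (psi x * phi x * rho x).
Proof.
move=> mE mphi mpsi graphh domk Lg dens; have [domf _ _] := graphh.
have mpp : measurable_fun Rge0 (fun x => psi x * phi x) by exact: measurable_funM.
have ipp := integrable_mul_density mE dens mpp ((dom_comp mphi mpsi graphh).1 domk).
have patchM x : x \in Rge0 ->
    psi x * ((fun x => phi x * rho x) \_ Rge0) x = psi x * phi x * rho x.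
  by move=> Rx; rewrite patchE Rx mulrA.
rewrite (signed_integral_density (m := m) (rho := (fun x => phi x * rho x) \_ Rge0))//.
- exact: eq_Rintegral.
- rewrite -restrict_EFin; apply/(integrable_mkcond _ mRge0).1.
  exact: integrable_mul_density mE dens mphi domf.
- by move=> A mA; exact: re_spectral_calculus graphh Lg dens mA.
- by apply: eq_integrable ipp => // x Rx /=; rewrite patchM.
Qed.

Lemma calculus_graph_comp phi psi f h k : measurable_fun Rge0 phi ->
  measurable_fun Rge0 psi -> graph phi f h ->
  graph psi h k <-> graph (fun x => psi x * phi x) f k.
Proof.
move=> mphi mpsi graphh; have [[Lf _] _ _] := graphh.
have [m mE] := spectral_measure_ex Lf.
have dom_psi := dom_comp mphi mpsi graphh.
rewrite calculus_graph_reP (calculus_graphP _ mE); last exact: measurable_funM.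
split=> -[domk Lk kE].
  split; [exact: dom_psi.1|exact: Lk|move=> g rho Lg dens].
  by rewrite kE//; exact: signed_integral_calculus mE mphi mpsi graphh domk Lg dens.
have domh := dom_psi.2 domk; split; [exact: domh|exact: Lk|move=> g Lg].
have [rho dens] := spectral_density_ex Lf Lg mE.
rewrite (kE g rho Lg dens); apply/esym.
exact: signed_integral_calculus mE mphi mpsi graphh domh Lg dens.
Qed.

Lemma calculus_graph_sub phi psi f h k : measurable_fun Rge0 phi ->
  measurable_fun Rge0 psi -> graph phi f h -> graph psi f k ->
  graph (fun x => phi x - psi x) f (fun x => h x - k x).
Proof.
move=> mphi mpsi graphh graphk.
have := calculus_graph_lin (-1) mpsi mphi graphk graphh.
by congr graph; apply/funext => x; rewrite ?rmorphN ?rmorph1 mulN1r addrC.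
Qed.

Lemma calculus_graph_nnsfun_ex (s : {nnsfun R >-> R}) f : L2 f ->
  exists h, graph s f h.
Proof.
move=> Lf; have ms y : measurable (s @^-1` [set y]) by [].
have sumE (l : seq R) : exists h,
    graph (fun x => \sum_(y <- l) y * \1_(s @^-1` [set y]) x) f h.
  elim: l => [|y l [h graphh]].
    by exists (fun=> 0); under eq_fun do rewrite big_nil; exact: calculus_graph0.
  exists (fun x => y%:C * E (s @^-1` [set y]) f x + h x).
  under eq_fun do rewrite big_cons.
  apply: calculus_graph_lin graphh; [exact: measurable_indic| |exact: calculus_graph_indic].
  by apply: measurable_sum => z; apply: measurable_funM => //; exact: measurable_indic.
have [h graphh] := sumE (finmap.enum_fset (fset_set (range s))).
exists h; rewrite (_ : (s : R -> R) =
  fun x => \sum_(y <- finmap.enum_fset (fset_set (range s))) y * \1_(s @^-1` [set y]) x)//.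
by apply/funext => x; rewrite {1}fimfunE fsbig_finite.
Qed.

Lemma rinner_calculus_sub_le phi psi (chi : R -> R) f m h k : is_spectral_measure f m ->
  measurable_fun Rge0 phi -> measurable_fun Rge0 psi -> measurable_fun Rge0 chi ->
  dom phi f -> graph psi f h -> graph chi f k ->
  rinner (fun x => h x - k x) (fun x => h x - k x) <=
    2 * \int[m]_(x in Rge0) (phi x - psi x) ^+ 2 +
    2 * \int[m]_(x in Rge0) (phi x - chi x) ^+ 2.
Proof.
move=> mE mphi mpsi mchi domphi graphh graphk.
have graph_diff := calculus_graph_sub mpsi mchi graphh graphk.
have [[dompsi _ _] [domchi _ _]] := (graphh, graphk).
have i_diff F : measurable_fun Rge0 F -> dom F f ->
    m.-integrable Rge0 (EFin \o (fun x => (phi x - F x) ^+ 2)).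
  move=> mF domF; apply: dom_integrable_sqr mE (measurable_funB mphi mF) _.
  have := dom_lin (-1) mF mphi domF domphi.
  by congr dom; apply/funext => x; rewrite mulN1r addrC.
have ipsi := i_diff psi mpsi dompsi; have ichi := i_diff chi mchi domchi.
rewrite (rinner_calculus mE (measurable_funB mpsi mchi) graph_diff).
have ipsi2 := integrableZl mRge0 2 ipsi; have ichi2 := integrableZl mRge0 2 ichi.
rewrite -!RintegralZl// -RintegralD//; apply: le_Rintegral => //.
- have [dom_diff _ _] := graph_diff.
  exact: (dom_integrable_sqr mE (measurable_funB mpsi mchi) dom_diff).
- exact: integrableD ipsi2 ichi2.
- move=> x _; have := sqr_ge0 ((phi x - psi x) + (phi x - chi x)).
  by rewrite /= !expr2; lra.
Qed.

Lemma calculus_ex_ge0 phi f : measurable_fun Rge0 phi ->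
  (forall x, Rge0 x -> 0 <= phi x) -> dom phi f -> exists h, graph phi f h.
Proof.
move=> mphi phi0 domf; have [Lf _] := domf.
have [m mE] := spectral_measure_ex Lf.
have iphi2 := dom_integrable_sqr mE mphi domf.
have eps_gt0 n : 0 < 8^-1 ^+ n :> R by rewrite exprn_gt0.
have [s [s_le s_cvg s_near]] := sqr_integrable_nnsfun_approx mRge0 mphi phi0 iphi2 eps_gt0.
have ms n : measurable_fun Rge0 (s n) by exact: measurable_funTS.
have [v graphv] := choice (fun n => calculus_graph_nnsfun_ex (s n) Lf).
have Lv n : L2 (v n) by case: (graphv n).
have fast n : rinner (fun x => v n.+1 x - v n x) (fun x => v n.+1 x - v n x) <= 4 * 8^-1 ^+ n.
  apply: le_trans (rinner_calculus_sub_le mE mphi (ms _) (ms _) domf (graphv _) (graphv _)) _.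
  by have := s_near n; have := s_near n.+1; have := eps_gt0 n; rewrite exprS; lra.
have [h Lh v_cvg] := L2_fast_cauchy_cvg mO Lv fast.
exists h; apply/(calculus_graphP h mE mphi); split => // g rho Lg dens.
apply: (cvg_unique _ (cvg_rinner mO Lv Lh Lg v_cvg)) => //.
have iphirho := integrable_mul_density mE dens mphi domf.
have -> : (fun n => rinner (v n) g) = fun n => \int[m]_(x in Rge0) (s n x * rho x).
  apply/funext => n; exact: rinner_calculus_density mE (ms n) (graphv n) Lg dens.
have [irho _ _] := dens.
apply: cvg_Rintegral (integrable_norm iphirho) _ _ => //.
- move=> n; apply: measurable_funM => //; apply: measurable_funTS.
  by apply/measurable_EFinP; exact: measurable_int irho.
- by move=> x Rx; apply: cvgM; [exact: s_cvg|exact: cvg_cst].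
move=> n x Rx; rewrite /= !normrM ler_wpM2r//.
by rewrite !ger0_norm ?s_le ?phi0//.
Qed.

Lemma calculusP phi f : measurable_fun Rge0 phi -> dom phi f ->
  graph phi f (calculus phi f).
Proof.
move=> mphi domf; have mpos := measurable_funrpos mphi; have mneg := measurable_funrneg mphi.
have [hpos graph_pos] : exists h, graph phi^\+ f h.
  apply: calculus_ex_ge0 => //; apply: dom_le domf => // x x0.
  by rewrite ger0_norm// ge_max normr_ge0 ler_norm.
have [hneg graph_neg] : exists h, graph phi^\- f h.
  apply: calculus_ex_ge0 => //; apply: dom_le domf => // x x0.
  by rewrite ger0_norm// ge_max normr_ge0 -normrN ler_norm.
have := calculus_graph_sub mpos mneg graph_pos graph_neg.
have <- : phi = (fun x => phi^\+ x - phi^\- x) by rewrite -[LHS]funrposBneg.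
by move=> graph_phi; apply: (xgetPex _ (ex_intro _ _ graph_phi)).
Qed.

Lemma calculus_limit0 (Phi : R -> R -> R) phi psi f (v : R -> T -> R[i]) h :
  (forall y, 0 < y -> measurable_fun Rge0 (Phi y)) -> measurable_fun Rge0 phi ->
  measurable_fun Rge0 psi -> dom psi f ->
  (forall l, 0 <= l -> Phi y l @[y --> (0 : R)^'+] --> phi l) ->
  (forall y l, 0 < y -> 0 <= l -> `|Phi y l| <= psi l) ->
  (forall y, 0 < y -> graph (Phi y) f (v y)) -> graph phi f h ->
  weak_limit0 eta Omega v h.
Proof.
move=> mPhi mphi mpsi dompsi cvgPhi Phi_le graphv graphh.
have [_ Lh _] := graphh; have [Lf _] := dompsi; apply: weak_limit0_rinner => // g Lg.
have [m mE] := spectral_measure_ex Lf; have [rho dens] := spectral_density_ex Lf Lg mE.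
have mrho : measurable_fun Rge0 rho.
  by have [irho _ _] := dens; apply/measurable_funTS/measurable_EFinP; exact: measurable_int irho.
rewrite (rinner_calculus_density mE mphi graphh Lg dens).
have : \int[m]_(x in Rge0) (Phi y x * rho x) @[y --> (0 : R)^'+] -->
    \int[m]_(x in Rge0) (phi x * rho x).
  have ipsirho := integrable_mul_density mE dens mpsi dompsi.
  apply: cvg_at_right_Rintegral (integrable_norm ipsirho) _ _ => //.
  - by move=> y y0; apply: measurable_funM => //; exact: mPhi.
  - by move=> l; rewrite Rge0E => l0; apply: cvgM; [exact: cvgPhi|exact: cvg_cst].
  - move=> y l y0; rewrite Rge0E => l0; rewrite /= !normrM ler_wpM2r//.
    exact: le_trans (Phi_le _ _ y0 l0) (ler_norm _).
apply: cvg_trans; apply: near_eq_cvg; near=> y.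
apply/esym/(rinner_calculus_density mE _ (graphv y _) Lg dens); last by [].
exact: mPhi.
Unshelve. all: by end_near. Qed.

Lemma calculus_derivative (Phi Phi' : R -> R -> R) f (v : R -> T -> R[i]) h (a b y M : R) :
  a < y < b ->
  (forall x, a < x < b -> measurable_fun Rge0 (Phi x)) ->
  measurable_fun Rge0 (Phi' y) ->
  (forall x l, a < x < b -> 0 <= l -> is_derive x 1 (Phi ^~ l) (Phi' x l)) ->
  (forall x l, a < x < b -> 0 <= l -> `|Phi' x l| <= M) ->
  (forall x, a < x < b -> graph (Phi x) f (v x)) -> graph (Phi' y) f h ->
  weak_derivative eta Omega v y h.
Proof.
move=> aby mPhi mPhi' dPhi Phi'_le graphv graphh.
have [[Lf _] Lh _] := graphh; apply: weak_derivative_rinner => // g Lg.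
have [m mE] := spectral_measure_ex Lf; have [rho dens] := spectral_density_ex Lf Lg mE.
have domM : dom (cst M) f by apply: (@dom_bounded _ _ `|M|) => // x _.
rewrite (rinner_calculus_density mE mPhi' graphh Lg dens).
apply: (@near_eq_is_derive _ _ _ (fun x => \int[m]_(l in Rge0) (Phi x l * rho l))).
  near=> x; have abx : a < x < b by near: x; exact: near_in_itvoo.
  by apply/esym/(rinner_calculus_density mE (mPhi x abx) (graphv x abx) Lg dens).
apply: (is_derive_Rintegral (F := fun x l => Phi x l * rho l)
  (F' := fun x l => Phi' x l * rho l) mRge0 aby _
  (integrable_norm (integrable_mul_density mE dens _ domM))) => //.
- move=> x abx; have [domPhi _ _] := graphv x abx.
  exact: (integrable_mul_density mE dens (mPhi x abx) domPhi).
- move=> x l abx; rewrite Rge0E => l0.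
  have dl := dPhi x l abx l0.
  by apply: is_derive_eq; rewrite scaler0 add0r mulrC.
- move=> x l abx; rewrite Rge0E => l0; rewrite /= !normrM ler_wpM2r//.
  exact: le_trans (Phi'_le _ _ abx l0) (ler_norm _).
Unshelve. all: by end_near. Qed.

Lemma calculus_weak_integral (Phi : R -> R -> R) (k H : R -> R) (c : R)
    (F : R -> T -> R[i]) f h m : is_spectral_measure f m ->
  measurable_fun (Rgt0 `*` Rge0) (fun p => Phi p.1 p.2 * k p.1) ->
  (forall t l, 0 < t -> 0 <= l -> 0 <= Phi t l * k t) ->
  (forall t, 0 < t -> measurable_fun Rge0 (Phi t)) ->
  (forall t, 0 < t -> graph (Phi t) f (F t)) ->
  {ae m, forall l, Rge0 l ->
    (\int[mu]_(t in Rgt0) (Phi t l * k t)%:E = (H l)%:E)%E} ->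
  measurable_fun Rge0 H -> dom H f -> graph (fun l => c * H l) f h ->
  weak_integral eta Omega c k F h.
Proof.
move=> mE mK K0 mPhi graphF KH mH domH graphh.
have [[Lf _] Lh _] := graphh; apply: weak_integral_rinner => // g Lg.
have [rho dens] := spectral_density_ex Lf Lg mE; have [irho _ _] := dens.
have mrho : measurable_fun setT rho by apply/measurable_EFinP; exact: measurable_int irho.
have iHrho := integrable_mul_density mE dens mH domH.
have mcH : measurable_fun Rge0 (fun l => c * H l) by exact: measurable_funM.
have FE t : Rgt0 t -> rinner (F t) g * k t =
    \int[m]_(l in Rge0) (Phi t l * k t * rho l).
  rewrite Rgt0E => t0; have [domPhi _ _] := graphF t t0.
  rewrite (rinner_calculus_density mE (mPhi t t0) (graphF t t0) Lg dens).
  rewrite -RintegralZr//; last exact: integrable_mul_density mE dens (mPhi t t0) domPhi.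
  by apply: eq_Rintegral => l _; ring.
have K_ge0 t l : Rgt0 t -> Rge0 l -> 0 <= Phi t l * k t.
  by rewrite Rgt0E Rge0E; exact: K0.
have [int_K iterated_K] := Rintegral_Fubini_kernel (m1 := mu) (K := fun t l => Phi t l * k t)
  (measurable_itv _) mRge0 mK K_ge0 mrho KH iHrho.
split.
  by apply: eq_integrable int_K => // t; rewrite inE => t0; rewrite /= FE.
rewrite (rinner_calculus_density mE mcH graphh Lg dens).
under eq_Rintegral do rewrite -mulrA.
rewrite RintegralZl//; congr (c * _); rewrite -iterated_K.
by apply: eq_Rintegral => t; rewrite inE => t0; rewrite FE.
Qed.

Lemma spectral_measure_set1_eq0 f m : is_spectral_measure f m ->
  rinner f (E [set 0] f) = 0 -> {ae m, forall l, l != 0}.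
Proof.
move=> mE f0; have m0 : measurable [set (0 : R)] by exact: measurable_set1.
exists [set 0]; split=> [||l /= /negP/negPn/eqP //]; first exact: m0.
have := mE _ m0; rewrite /re_spectral (rinnerC eta Omega (E _ f) f) f0.
by move=> ->.
Qed.

Lemma calculus_graph_id_kernel f : L2 f -> graph id (E [set 0] f) (fun=> 0).
Proof.
move=> Lf; have m0 : measurable [set (0 : R)] by exact: measurable_set1.
have m_indic : measurable_fun Rge0 (\1_[set 0] : R -> R) by exact: measurable_indic.
apply/(calculus_graph_comp _ m_indic (@measurable_id _ _ _) (calculus_graph_indic m0 Lf)).
rewrite (_ : (fun x => _) = cst 0); first exact: calculus_graph0.
apply/funext => x /=; rewrite indicE.
by case: (pselect (x = 0)) => [->|x0]; rewrite ?mul0r// memNset ?mulr0.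
Qed.

Lemma expRN_measurable (t : R) : measurable_fun Rge0 (fun l => expR (- (t * l))).
Proof.
apply: measurableT_comp; first exact: measurable_expR.
by apply: measurable_funN; exact: measurable_funM.
Qed.

Lemma calculus_graph_heat t f : 0 <= t -> L2 f ->
  graph (fun l => expR (- (t * l))) f (heat t f).
Proof.
move=> t0 Lf; apply: calculusP; first exact: expRN_measurable.
apply: (@dom_bounded _ _ 1) => //; first exact: expRN_measurable.
by move=> l l0; rewrite gtr0_norm ?expR_gt0// expR_le1 oppr_le0 mulr_ge0.
Qed.

Section extension_problem.
Variables (s : R) (f : T -> R[i]).
Hypotheses (s0 : 0 < s) (s1 : s < 1).
Hypothesis domf : dom (fun l => l `^ s) f.
Implicit Types y l t : R.

Let Lf : L2 f. Proof. by case: domf. Qed.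

Let powR_measurable : measurable_fun Rge0 (fun l => l `^ s).
Proof. exact: (measurable_funS measurableT _ (measurable_powR s)). Qed.

Definition ext_solution y := calculus (ext_kernel s y) f.
Definition ext_solution_dy y := calculus (ext_kernel_dy s y) f.
Definition ext_solution_dyy y := calculus (ext_kernel_dyy s y) f.
Definition ext_solution_L y := calculus (fun l => l * ext_kernel s y l) f.

Lemma graph_ext_solution y : graph (ext_kernel s y) f (ext_solution y).
Proof.
have mk := ext_kernel_measurable s0 y; apply: calculusP => //.
by apply: (@dom_bounded _ _ 1) => // l _; exact: ext_kernel_le1.
Qed.

Lemma graph_ext_solution_dy y : 0 < y ->
  graph (ext_kernel_dy s y) f (ext_solution_dy y).
Proof.
move=> y0; have mk := ext_kernel_dy_measurable s1 y; apply: calculusP => //.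
by apply: dom_bounded => // l; exact: ext_kernel_dy_le.
Qed.

Lemma graph_ext_solution_dyy y : 0 < y ->
  graph (ext_kernel_dyy s y) f (ext_solution_dyy y).
Proof.
move=> y0; have mk := ext_kernel_dyy_measurable s0 s1 y; apply: calculusP => //.
by apply: dom_bounded => // l; exact: ext_kernel_dyy_le.
Qed.

Let mul_ext_kernel_measurable y : measurable_fun Rge0 (fun l => l * ext_kernel s y l).
Proof. by apply: measurable_funM => //; exact: ext_kernel_measurable. Qed.

Lemma graph_ext_solution_L y : 0 < y ->
  graph (fun l => l * ext_kernel s y l) f (ext_solution_L y).
Proof.
move=> y0; apply: calculusP => //; apply: dom_bounded => // l.
exact: mul_ext_kernel_le.
Qed.

Lemma graph_id_ext_solution y : 0 < y -> graph id (ext_solution y) (ext_solution_L y).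
Proof.
move=> y0; apply/(calculus_graph_comp _ _ _ (graph_ext_solution y)) => //.
  exact: ext_kernel_measurable.
exact: graph_ext_solution_L.
Qed.

Lemma ext_solution_ode y : 0 < y ->
  (fun x => - ext_solution_L y x + ((1 - 2 * s) / y)%:C * ext_solution_dy y x +
    ext_solution_dyy y x) = (fun=> 0) %[ae eta in Omega].
Proof.
move=> y0; have mdy := ext_kernel_dy_measurable s1 y.
have mdyy := ext_kernel_dyy_measurable s0 s1 y.
have mlin : measurable_fun Rge0
    (fun l => (1 - 2 * s) / y * ext_kernel_dy s y l + ext_kernel_dyy s y l).
  by apply: measurable_funD => //; exact: measurable_funM.
have graph_lin := calculus_graph_lin ((1 - 2 * s) / y) mdy mdyy
  (graph_ext_solution_dy y0) (graph_ext_solution_dyy y0).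
have := calculus_graph_sub mlin (mul_ext_kernel_measurable y) graph_lin
  (graph_ext_solution_L y0).
rewrite [X in graph X](_ : _ = cst 0); last first.
  by apply/funext => l; rewrite /ext_kernel_dyy/=; ring.
move=> graph_sum; have := calculus_graph_uniq graph_sum (calculus_graph0 Lf).
by apply: filterS => x /[apply] <-; ring.
Qed.

Lemma ext_solution0 : ext_solution 0 = f %[ae eta in Omega].
Proof.
apply: calculus_graph_uniq (graph_ext_solution 0) _.
rewrite (_ : ext_kernel s 0 = cst 1); first exact: calculus_graph1.
by apply/funext => l; exact: ext_kernel0l.
Qed.

Lemma cvg_ext_solution : weak_limit0 eta Omega ext_solution f.
Proof.
apply: (calculus_limit0 (Phi := ext_kernel s) (phi := cst 1) (psi := cst 1) (f := f)) => //.
- by move=> y _; exact: ext_kernel_measurable.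
- by case: (calculus_graph1 Lf).
- by move=> l _; exact: cvg_ext_kernel.
- by move=> y l _ _; exact: ext_kernel_le1.
- by move=> y _; exact: graph_ext_solution.
- exact: calculus_graph1.
Qed.

Lemma weak_derivative_ext_solution y : 0 < y ->
  weak_derivative eta Omega ext_solution y (ext_solution_dy y).
Proof.
move=> y0; have near_y x : y / 2 < x < 2 * y -> 0 < x.
  by move=> /andP[+ _]; apply: lt_trans; exact: divr_gt0.
apply: (calculus_derivative (Phi := ext_kernel s) (Phi' := ext_kernel_dy s) (f := f)
  (a := y / 2) (b := 2 * y) (M := 2 / (y / 2) * ext_flux_bound s)).
- by apply/andP; split; lra.
- by move=> x _; exact: ext_kernel_measurable.
- exact: ext_kernel_dy_measurable.
- by move=> x l /near_y x0 l0; exact: is_derive_ext_kernel.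
- move=> x l xy l0; have x0 := near_y x xy; have /andP[yx _] := xy.
  apply: le_trans (ext_kernel_dy_le s0 s1 x0 l0) _.
  rewrite ler_wpM2r ?ext_flux_bound_ge0// ler_wpM2l// lef_pV2 ?posrE//; last exact: divr_gt0.
  exact: ltW.
- by move=> x _; exact: graph_ext_solution.
- exact: graph_ext_solution_dy.
Qed.

Lemma weak_derivative_ext_solution_dy y : 0 < y ->
  weak_derivative eta Omega ext_solution_dy y (ext_solution_dyy y).
Proof.
move=> y0; have near_y x : y / 2 < x < 2 * y -> 0 < x.
  by move=> /andP[+ _]; apply: lt_trans; exact: divr_gt0.
apply: (calculus_derivative (Phi := ext_kernel_dy s) (Phi' := ext_kernel_dyy s) (f := f)
  (a := y / 2) (b := 2 * y) (M := 4 / (y / 2) ^+ 2 * ext_kernel_dyy_bound s)).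
- by apply/andP; split; lra.
- by move=> x _; exact: ext_kernel_dy_measurable.
- exact: ext_kernel_dyy_measurable.
- by move=> x l /near_y x0 l0; exact: is_derive_ext_kernel_dy.
- move=> x l xy l0; have x0 := near_y x xy; have /andP[yx _] := xy.
  apply: le_trans (ext_kernel_dyy_le s0 s1 x0 l0) _.
  have y2 : 0 < y / 2 by exact: divr_gt0.
  rewrite ler_wpM2r ?ext_kernel_dyy_bound_ge0// ler_wpM2l// lef_pV2 ?posrE ?exprn_gt0//.
  by rewrite lerXn2r ?nnegrE ?ltW.
- by move=> x /near_y; exact: graph_ext_solution_dy.
- exact: graph_ext_solution_dyy.
Qed.

Let Lsf := fracpow eta Omega E s f.

Lemma graph_fracpow : graph (fun l => l `^ s) f Lsf.
Proof. exact: calculusP. Qed.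

Let graph_scale_fracpow (c : R) : graph (fun l => c * l `^ s) f (fun x => c%:C * Lsf x).
Proof. by apply: calculus_graphZ => //; exact: graph_fracpow. Qed.

Let scale_powR_measurable (c : R) : measurable_fun Rge0 (fun l => c * l `^ s).
Proof. exact: measurable_funM. Qed.

Lemma cvg_ext_solution_quotient : weak_limit0 eta Omega
  (fun y x => (ext_solution y x - ext_solution 0 x) / (y `^ (2 * s))%:C)
  (fun x => (ext_const s)%:C * Lsf x).
Proof.
pose c := Gamma (1 - s) / s / (4 `^ s * Gamma s).
apply: (calculus_limit0 (Phi := fun y l => (ext_kernel s y l - 1) / y `^ (2 * s))
  (phi := fun l => ext_const s * l `^ s) (psi := fun l => c * l `^ s) (f := f)) => //.
- move=> y _; apply: measurable_funM => //; apply: measurable_funB => //.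
  exact: ext_kernel_measurable.
- by case: (graph_scale_fracpow c).
- by move=> l l0; exact: cvg_ext_kernel_quotient.
- by move=> y l y0 l0; exact: ext_kernel_quotient_le.
move=> y y0; have mk z := ext_kernel_measurable s0 z.
have := calculus_graphZ (y `^ (2 * s))^-1 (measurable_funB (mk y) (mk 0))
  (calculus_graph_sub (mk y) (mk 0) (graph_ext_solution y) (graph_ext_solution 0)).
congr graph; apply/funext => x; first by rewrite /= ext_kernel0l// mulrC.
by rewrite fmorphV/= mulrC.
Qed.

Lemma cvg_ext_solution_flux : weak_limit0 eta Omega
  (fun y x => (y `^ (1 - 2 * s))%:C * ext_solution_dy y x)
  (fun x => (2 * s * ext_const s)%:C * Lsf x).
Proof.
pose c := 2 / (4 `^ s * Gamma s) * Gamma (1 - s).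
have mdy y := ext_kernel_dy_measurable s1 y.
apply: (calculus_limit0 (Phi := fun y l => y `^ (1 - 2 * s) * ext_kernel_dy s y l)
  (phi := fun l => 2 * s * ext_const s * l `^ s) (psi := fun l => c * l `^ s) (f := f)) => //.
- by move=> y _; exact: measurable_funM.
- by case: (graph_scale_fracpow c).
- by move=> l l0; exact: cvg_powR_ext_kernel_dy.
- by move=> y l y0 l0; exact: powR_ext_kernel_dy_le.
- by move=> y y0; apply: calculus_graphZ => //; exact: graph_ext_solution_dy.
Qed.

Let measurable_fst_Rgt0 (k : R -> R) : measurable_fun Rgt0 k ->
  measurable_fun (Rgt0 `*` Rge0) (fun p => k p.1).
Proof. by move=> mk; exact: (measurable_fun_fst (measurable_itv _) mk). Qed.

Let measurable_snd_Rge0 (k : R -> R) : measurable_fun Rge0 k ->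
  measurable_fun (Rgt0 `*` Rge0) (fun p => k p.2).
Proof. by move=> mk; exact: (measurable_fun_snd mRge0 mk). Qed.

Let expRN_mul_measurable (a : R -> R) : measurable_fun Rgt0 a ->
  measurable_fun (Rgt0 `*` Rge0) (fun p => expR (- (a p.1 * p.2))).
Proof.
move=> ma; apply: measurableT_comp; first exact: measurable_expR.
apply: measurable_funN; apply: measurable_funM; first exact: measurable_fst_Rgt0.
exact: (measurable_snd_Rge0 (@measurable_id _ _ _)).
Qed.

Let ext_arg_divr y t : y ^+ 2 / (4 * t) = y ^+ 2 / 4 / t.
Proof. by rewrite invfM mulrA. Qed.

Let continuous_ext_arg_divr y t : 0 < t ->
  {for t, continuous (fun t => y ^+ 2 / (4 * t))}.
Proof.
move=> t0; rewrite (_ : (fun t => _) = fun t => y ^+ 2 / 4 / t).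
  exact: continuous_divl.
by apply/funext => x; exact: ext_arg_divr.
Qed.

Let weight_measurable y p : measurable_fun Rgt0 (fun t => expR (- (y ^+ 2 / (4 * t))) / t `^ p).
Proof.
apply: continuous_measurable_Rgt0 => x x0; apply: cvgM; last first.
  by apply: cvgV; [rewrite gt_eqF// powR_gt0|exact: continuous_powR].
apply: continuous_comp; last exact: continuous_expR.
by apply: cvgN; exact: continuous_ext_arg_divr.
Qed.

Let weight_subordination_measurable : measurable_fun Rgt0 (fun r => expR (- r) / r `^ (1 - s)).
Proof.
apply: continuous_measurable_Rgt0 => x x0; apply: cvgM; last first.
  by apply: cvgV; [rewrite gt_eqF// powR_gt0|exact: continuous_powR].
by apply: continuous_comp; [apply: cvgN; exact: cvg_id|exact: continuous_expR].
Qed.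

Let dom_genGamma y (c : R) : dom (fun l => c * genGamma s (ext_arg y l)) f.
Proof.
apply: (@dom_bounded _ _ (`|c| * Gamma s)) => // [|l _].
  by apply: measurable_funM => //; exact: genGamma_ext_arg_measurable.
by rewrite normrM ler_wpM2l// ger0_norm ?genGamma_ge0 ?genGamma_le_Gamma.
Qed.

Let scale_genGamma_measurable y (c : R) :
  measurable_fun Rge0 (fun l => c * genGamma s (ext_arg y l)).
Proof. by apply: measurable_funM => //; exact: genGamma_ext_arg_measurable. Qed.

Lemma ext_solution_poisson y : 0 < y -> weak_integral eta Omega
  (y `^ (2 * s) / (4 `^ s * Gamma s))
  (fun t => expR (- (y ^+ 2 / (4 * t))) / t `^ (1 + s))
  (fun t => heat t f) (ext_solution y).
Proof.
move=> y0; have c0 : 0 < y ^+ 2 / 4 by rewrite divr_gt0// exprn_gt0.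
have [m mE] := spectral_measure_ex Lf.
apply: (calculus_weak_integral (Phi := fun t l => expR (- (t * l)))
  (H := fun l => (y ^+ 2 / 4) `^ (- s) * genGamma s (ext_arg y l)) mE).
- apply: measurable_funM (measurable_fst_Rgt0 (weight_measurable y (1 + s))).
  exact: (expRN_mul_measurable (@measurable_id _ _ _)).
- by move=> t l _ _; rewrite mulr_ge0 ?divr_ge0 ?expR_ge0 ?powR_ge0.
- by move=> t _; exact: expRN_measurable.
- by move=> t /ltW t0; exact: calculus_graph_heat.
- apply: aeW => l; rewrite Rge0E => l0; rewrite -(integral_poisson_kernel s0 c0 l0).
  by apply: eq_integral => t _; rewrite ext_arg_divr.
- exact: scale_genGamma_measurable.
- exact: dom_genGamma.
have := graph_ext_solution y; congr graph; apply/funext => l.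
rewrite /ext_kernel powRN -[y ^+ 2 / 4]mulr1 -/(ext_arg y 1) powR_ext_arg// powR1 mulr1.
by field; rewrite !gt_eqF ?powR_gt0 ?Gamma_gt0.
Qed.

Lemma ext_solution_subordination y : 0 < y -> weak_integral eta Omega (Gamma s)^-1
  (fun r => expR (- r) / r `^ (1 - s))
  (fun r => heat (y ^+ 2 / (4 * r)) f) (ext_solution y).
Proof.
move=> y0; have c0 : 0 <= y ^+ 2 / 4 by rewrite divr_ge0// sqr_ge0.
have [m mE] := spectral_measure_ex Lf.
apply: (calculus_weak_integral (Phi := fun r l => expR (- (y ^+ 2 / (4 * r) * l)))
  (H := fun l => 1 * genGamma s (ext_arg y l)) mE).
- have marg := continuous_measurable_Rgt0 (@continuous_ext_arg_divr y).
  apply: measurable_funM (measurable_fst_Rgt0 weight_subordination_measurable).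
  exact: expRN_mul_measurable marg.
- by move=> r l _ _; rewrite mulr_ge0 ?divr_ge0 ?expR_ge0 ?powR_ge0.
- by move=> r _; exact: expRN_measurable.
- move=> r r0; apply: calculus_graph_heat => //.
  by rewrite divr_ge0 ?sqr_ge0// mulr_ge0// ltW.
- apply: aeW => l; rewrite Rge0E => l0; rewrite mul1r -(integral_subordination_kernel s0 c0 l0).
  by apply: eq_integral => r _; rewrite ext_arg_divr.
- exact: scale_genGamma_measurable.
- exact: dom_genGamma.
have := graph_ext_solution y; congr graph; apply/funext => l.
by rewrite /ext_kernel mul1r mulrC.
Qed.

Lemma graph_heat_fracpow t : 0 <= t ->
  graph (fun l => expR (- (t * l)) * l `^ s) f (heat t Lsf).
Proof.
move=> t0; have [_ LLsf _] := graph_fracpow.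
have comp := calculus_graph_comp (heat t Lsf) powR_measurable
  (expRN_measurable t) graph_fracpow.
exact: comp.1 (calculus_graph_heat t0 LLsf).
Qed.

Lemma ext_solution_heat_fracpow y : rinner f (E [set 0] f) = 0 ->
  weak_integral eta Omega (Gamma s)^-1
    (fun t => expR (- (y ^+ 2 / (4 * t))) / t `^ (1 - s))
    (fun t => heat t Lsf) (ext_solution y).
Proof.
move=> f0; have c0 : 0 <= y ^+ 2 / 4 by rewrite divr_ge0// sqr_ge0.
have [m mE] := spectral_measure_ex Lf.
apply: (calculus_weak_integral (Phi := fun t l => expR (- (t * l)) * l `^ s)
  (H := fun l => 1 * genGamma s (ext_arg y l)) mE).
- apply: measurable_funM (measurable_fst_Rgt0 (weight_measurable y (1 - s))).
  apply: measurable_funM (measurable_snd_Rge0 powR_measurable).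
  exact: (expRN_mul_measurable (@measurable_id _ _ _)).
- by move=> t l _ _; rewrite !mulr_ge0 ?invr_ge0 ?expR_ge0 ?powR_ge0.
- by move=> t _; apply: measurable_funM => //; exact: expRN_measurable.
- by move=> t /ltW t0; exact: graph_heat_fracpow.
- have := spectral_measure_set1_eq0 mE f0; apply: filterS => l l_neq0; rewrite Rge0E => l_ge0.
  have l0 : 0 < l by rewrite lt_def l_neq0.
  rewrite mul1r -(integral_heat_kernel_powR s0 c0 l0).
  by apply: eq_integral => t _; rewrite ext_arg_divr.
- exact: scale_genGamma_measurable.
- exact: dom_genGamma.
have := graph_ext_solution y; congr graph; apply/funext => l.
by rewrite /ext_kernel mul1r mulrC.
Qed.

End extension_problem.

End spectral_calculus.

Theorem theorem1p1 (R : realType) (n : nat) (hn : (0 < n)%N)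
    (Omega : set (borelRn R n)) (hOmega : @open 'rV[R]_n Omega)
    (eta : {measure set (borelRn R n) -> \bar R})
    (L : unbounded_operator (borelRn R n -> R[i]))
    (hL : is_operator eta Omega L)
    (hLpdo : second_order_pdo eta Omega L)
    (hLnneg : nonnegative_operator eta Omega L)
    (hLdense : densely_defined eta Omega L)
    (hLsa : self_adjoint eta Omega L)
    (E : set R -> (borelRn R n -> R[i]) -> (borelRn R n -> R[i]))
    (hE : spectral_resolution eta Omega L E)
    (sigma : R) (hsigma0 : 0 < sigma) (hsigma1 : sigma < 1)
    (f : borelRn R n -> R[i])
    (hf : calculus_dom eta Omega E (fun l => l `^ sigma) f) :
  exists u uy uyy : R -> borelRn R n -> R[i],
    let Lsf := fracpow eta Omega E sigma f in
    let c := Gamma_opp sigma / (4 `^ sigma * Gamma sigma) in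
    [/\ orthogonal_to_kernel eta Omega L f ->
          forall y : R, 0 <= y ->
          weak_integral eta Omega (Gamma sigma)^-1
            (fun t => expR (- (y ^+ 2 / (4 * t))) / t `^ (1 - sigma))
            (fun t => heat eta Omega E t Lsf) (u y),
        extension_solution eta Omega L sigma f u uy uyy,
        weak_limit0 eta Omega
          (fun y x => (u y x - u 0 x) / (y `^ (2 * sigma))%:C)
          (fun x => c%:C * Lsf x) /\
        (exists2 l, weak_limit0 eta Omega
            (fun y x => (y `^ (1 - 2 * sigma))%:C * uy y x) l &
          (fun x => c%:C * Lsf x) = (fun x => ((2 * sigma)^-1)%:C * l x)
            %[ae eta in Omega]) &
        forall y : R, 0 < y ->
          weak_integral eta Omega
            (y `^ (2 * sigma) / (4 `^ sigma * Gamma sigma))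
            (fun t => expR (- (y ^+ 2 / (4 * t))) / t `^ (1 + sigma))
            (fun t => heat eta Omega E t f) (u y) /\
          weak_integral eta Omega (Gamma sigma)^-1
            (fun r => expR (- r) / r `^ (1 - sigma))
            (fun r => heat eta Omega E (y ^+ 2 / (4 * r)) f) (u y)].
Proof.
have mO : measurable Omega by exact: sub_sigma_algebra.
have [resE suppE _ graphL] := hE; have [Lf _] := hf.
exists (ext_solution eta Omega E sigma f), (ext_solution_dy eta Omega E sigma f),
  (ext_solution_dyy eta Omega E sigma f).
move=> Lsf c; split.
- move=> orth y _; apply: ext_solution_heat_fracpow => //.
  have /graphL[domE0 _ LE0] := calculus_graph_id_kernel mO resE suppE Lf.
  by have := orth _ domE0 LE0; rewrite innerE => -[].
- split; [exact: ext_solution0|exact: cvg_ext_solution|move=> y y0].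
  have /graphL[domu _ Lu] := graph_id_ext_solution mO resE suppE hsigma0 hf y0.
  split; [exact: domu|exact: weak_derivative_ext_solution|
    exact: weak_derivative_ext_solution_dy|].
  have := ext_solution_ode mO resE suppE hsigma0 hsigma1 hf y0.
  by apply: filterS2 Lu => x Lux ode Ox; rewrite Lux// ode.
- split; first exact: cvg_ext_solution_quotient.
  exists (fun x => (2 * sigma * c)%:C * Lsf x); first exact: cvg_ext_solution_flux.
  by apply: aeW => x _; rewrite mulrA -rmorphM mulKf// mulf_neq0// gt_eqF.
- by move=> y y0; split; [exact: ext_solution_poisson|exact: ext_solution_subordination].
Qed.
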